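(* Let $d\ge1$, $p>0$, and let $\mu\in\mathcal{P}(\mathbb{R}^d)$ satisfy $M_q(\mu)<\infty$ for some $q>p$. Then the following hold, with constants $c,C>0$ depending only on $d,p,q,M_q(\mu)$ and, where $\varepsilon$ appears, also on $\varepsilon$. (a) If $q>2p$, then for all integers $N\ge1$ and $x>0$, $$\mathbb{P}(\mathcal{T}_p(\mu,\mu_N)>x)\le C\Big(e^{-cN\varphi(x)}\mathbf{1}_{\{x\le1\}}+N(Nx)^{-q/p}\Big).$$ (b) If $p>d/2$ and $q\in(p,2p]$, then for all integers $N\ge1$, $\varepsilon\in(0,1-p/q)$ and $x>0$, $$\mathbb{P}(\mathcal{T}_p(\mu,\mu_N)>x)\le C\Big(e^{-cN^{2(1-p/q-\varepsilon)}x^2}\mathbf{1}_{\{x\le1\}}+N(Nx)^{-q/p}\Big).$$ (c) If $p=d/2$ and $q\in(p,2p]$, then for all integers $N\ge1$, $\varepsilon\in(0,1-p/q)$ and $x>0$, $$\mathbb{P}(\mathcal{T}_p(\mu,\mu_N)>x)\le C\Big(e^{-cNx^{1/(1-p/q-\varepsilon)}/(\log(2+1/x))^2}\mathbf{1}_{\{x\le1\}}+e^{-cN^{2(1-p/q-\varepsilon)}x^2}\mathbf{1}_{\{x\le1\}}+N(Nx)^{-q/p}\Big).$$ (d) If $p\in(0,d/2)$ and $q\in(dp/(d-p),2p]$, then for all integers $N\ge1$, $\varepsilon\in(0,1-p/q)$ and $x>0$, $$\mathbb{P}(\mathcal{T}_p(\mu,\mu_N)>x)\le C\Big(e^{-cNx^{d/p}}\mathbf{1}_{\{x\le1\}}+e^{-cN^{2(1-p/q-\varepsilon)}x^2}\mathbf{1}_{\{x\le1\}}+N(Nx)^{-q/p}\Big).$$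 (e) If $p\in(0,d/2)$ and $q\in(p,dp/(d-p)]$, then for all integers $N\ge1$, $\varepsilon\in(0,1-p/q)$ and $x>0$, $$\mathbb{P}(\mathcal{T}_p(\mu,\mu_N)>x)\le C\Big(e^{-cN^{2(1-p/q-\varepsilon)}x^2}\mathbf{1}_{\{x\le1\}}+N(Nx)^{-q/p}\Big).$$
   Context: $\mathcal{P}(\mathbb{R}^d)$ is the set of Borel probability measures on $\mathbb{R}^d$; $|\cdot|$ is the Euclidean norm; $M_q(\mu):=\int|y|^q\,d\mu(y)$. $X_1,X_2,\dots$ are i.i.d. with law $\mu$ on a probability space $(\Omega,\mathbb{P})$ and $\mu_N=\frac1N\sum_{i=1}^N\delta_{X_i}$. $\mathcal{T}_p(\mu,\nu):=\inf_{\pi\in\mathrm{Cpl}(\mu,\nu)}\int_{\mathbb{R}^d\times\mathbb{R}^d}|x-y|^p\,d\pi(x,y)$, where $\mathrm{Cpl}(\mu,\nu)$ is the set of couplings of $\mu$ and $\nu$. Rate function (depending on $d,p$): $\varphi(x)=x^2$ if $p>d/2$; $\varphi(x)=(x/\log(2+1/x))^2$ if $p=d/2$; $\varphi(x)=x^{d/p}$ if $p\in(0,d/2)$. *)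

(* Defs.v *)
From HB Require Import structures.
From mathcomp Require Import all_boot all_order all_algebra.
From mathcomp Require Import all_classical all_reals all_analysis.

Set Implicit Arguments.
Unset Strict Implicit.
Unset Printing Implicit Defensive.

Import Order.TTheory GRing.Theory Num.Theory.
Import numFieldNormedType.Exports.

Local Open Scope classical_set_scope.
Local Open Scope ring_scope.

(* R^d with its Borel sigma-algebra; products [Rd R d * Rd R d] carry the
   product sigma-algebra, which is the Borel one on R^d x R^d. *)
Definition Rd (R : realType) (d : nat) := g_sigma_algebraType (@open 'rV[R]_d).

(* The library norm on ['rV[R]_d] is the sup norm, hence this definition. *)
Definition enorm (R : realType) (d : nat) (x : 'rV[R]_d) : R :=
  Num.sqrt (\sum_(i < d) (x ord0 i) ^+ 2).

Definition moment (R : realType) (d : nat) (q : R)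
    (mu : {measure set (Rd R d) -> \bar R}) : \bar R :=
  \int[mu]_y ((enorm y) `^ q)%:E.

Definition coupling (R : realType) (d : nat)
    (mu nu : {measure set (Rd R d) -> \bar R}) :
    set (probability (Rd R d * Rd R d)%type R) :=
  [set pi | forall A : set (Rd R d), measurable A ->
    pushforward pi fst A = mu A /\ pushforward pi snd A = nu A].

Definition transport_cost (R : realType) (d : nat) (p : R)
    (mu nu : {measure set (Rd R d) -> \bar R}) : \bar R :=
  ereal_inf
    [set (\int[pi]_z ((enorm (z.1 - z.2 : 'rV[R]_d)) `^ p)%:E)%E
    | pi in coupling mu nu].

(* The sample is indexed from 0: its first [N] points are [x 0, ..., x N.-1]. *)
Definition empirical (R : realType) (d N : nat) (x : nat -> Rd R d) :
    {measure set (Rd R d) -> \bar R} :=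
  mscale (N%:R^-1)%:nng (msum (fun i => dirac (x i)) N).

Definition iid_law (R : realType) (d : nat) (dO : measure_display)
    (Omega : measurableType dO) (P : probability Omega R)
    (mu : probability (Rd R d) R) (X : nat -> {RV P >-> Rd R d}) : Prop :=
  (forall (i : nat) (A : set (Rd R d)), measurable A ->
     distribution P (X i) A = mu A) /\
  (forall (s : seq nat) (A : nat -> set (Rd R d)), uniq s ->
     (forall i, measurable (A i)) ->
     P (\bigcap_(i in [set` s]) (X i @^-1` A i)) =
     (\prod_(i <- s) P (X i @^-1` A i))%E).

Definition rate_fun (R : realType) (d : nat) (p x : R) : R :=
  if d%:R / 2 < p then x ^+ 2
  else if p == d%:R / 2 then (x / ln (2 + x^-1)) ^+ 2
  else x `^ (d%:R / p).

(* [F c N x] is the bound up to the multiplicative constant [C]. The constants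
   are chosen before the measure, the probability space and the sample, so they
   depend only on [d], [p], [q], the value [m] of the moment and the parameters
   occurring in [F]. *)
Definition deviation_bound (R : realType) (d : nat) (p q m : R)
    (F : R -> nat -> R -> R) : Prop :=
  exists c C : R, [/\ 0 < c, 0 < C &
    forall mu : probability (Rd R d) R, moment q mu = m%:E ->
    forall (dO : measure_display) (Omega : measurableType dO)
      (P : probability Omega R) (X : nat -> {RV P >-> Rd R d}),
    iid_law mu X ->
    forall (N : nat) (x : R), (0 < N)%N -> 0 < x ->
    (P [set w | x%:E < transport_cost p mu (empirical N (fun i => X i w))]
      <= (C * F c N x)%:E)%E].

(* Main.v *)
(* Cut R^d into the annuli A_n of outer radius 2^n and each near annulus A_n (n < M) into
   dyadic cubes of side 2^(n - l), l <= ell n. Coupling the mass greedily inside the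
   cells, from the finest level upwards, lets a cell g export at most |mu g - mu_N g|. So
   T_p(mu, mu_N) is at most a constant times the sum over n < M and l <= ell n of
   2^(p (n - l)) sum_g |mu g - mu_N g|, plus the mean diameter of the finest cells, plus
   the p-th moments of mu and mu_N outside the near annuli.
   The index M makes the far mean negligible against x; the far empirical moment is a sum
   of truncated heavy-tailed variables, and its Chernoff bound is N (N x)^(-q/p). In a near
   annulus, of mass v <= K 2^(-q n), Bernstein's inequality and a union bound over the sign
   patterns of the cells give Gaussian tails. It remains to share x among the annuli and
   the levels so that all the exponents exceed the target times 2^(d l) 2^(delta n), which
   makes the sum of the tails geometric. Shares decreasing in n give the exponent
   N rate_fun(x) when the moments allow it; otherwise shares increasing in n give
   N x^((q + eta)/(q - p)), which with eta = 2 eps q is at least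
   N^(2 (1 - p/q - eps)) x^2 as soon as N (N x)^(-q/p) <= 1. *)

(* Points are replaced by labels in a finite set, so the sample has a finite product law and every
   tail bound concerns finite sums. There are two radii. Beyond [M] the mean is negligible; the
   second index [Q >= M] is the first one where [2^(p Q)] exceeds a quarter of [N x] ([x] rescaled),
   or [M] if that is larger. Annuli between [M] and [Q] thus carry the bounded variables that the
   Chernoff bound requires, and a sample point falls beyond them with probability of order
   [N 2^(-q Q)], at most a multiple of [N (N x)^(-q/p)]. The depth [ell n] has two competing duties:
   the finest cells must be cheap, and the allowed discrepancy must stay below a multiple of the
   mass [v], where Bernstein's bound is Gaussian. Stopping at the first cheap level achieves both,
   up to a factor [2^p]. The regimes come from one competition. With a rate [x^s], the exponent in
   annulus [n] before sharing varies like [2^((s (q - p) - q) n)]. It grows if and only if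
   [q < s (q - p)]: this is [q > 2p] for [s = 2] and [q > dp/(d - p)] for [s = d/p]. Otherwise the
   outermost near annulus, where [2^((q - p) M)] is of order [1/x], decides. *)
From HB Require Import structures.
Require Import Defs.
From mathcomp Require Import all_boot all_order all_algebra.
From mathcomp Require Import all_classical all_reals all_analysis.
From mathcomp Require Import measurable_realfun zify ring lra.
Import Order.TTheory GRing.Theory Num.Theory.
Import numFieldNormedType.Exports.
Local Open Scope ring_scope.

(** * Couplings along a tree *)

Section TreeCoupling.
Context {R : realFieldType} {I J : finType}.
Implicit Types (a b : I -> R) (w : I -> I -> R).

(* A sub-coupling of [a] and [b] with leftovers [a'] and [b'] in which, for every
   cell, the mass leaving it or left over in it does not exceed the excess. *)
Definition cell_tight (c : nat -> I -> J) (K : nat) a b w (a' b' : I -> R) :=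
  [/\ (forall i j, 0 <= w i j) /\ (forall i, 0 <= a' i /\ 0 <= b' i),
      (forall i, a i = \sum_j w i j + a' i) /\
      (forall j, b j = \sum_i w i j + b' j) &
      forall k g, (k < K)%N ->
        \sum_(i | c k i == g) (\sum_(j | c k j != g) w i j + a' i) <=
          Num.max 0 (\sum_(i | c k i == g) a i - \sum_(i | c k i == g) b i) /\
        \sum_(j | c k j == g) (\sum_(i | c k i != g) w i j + b' j) <=
          Num.max 0 (\sum_(i | c k i == g) b i - \sum_(i | c k i == g) a i)].

(* [c k i] is the cell of the leaf [i] at depth [k] counted from the finest level;
   what is left over in a cell of level [K] is coupled proportionally. *)
Lemma greedy_coupling (c : nat -> I -> J) (K : nat) a b :
  (forall k i j, c k i = c k j -> c k.+1 i = c k.+1 j) ->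
  (forall i, 0 <= a i) -> (forall i, 0 <= b i) ->
  exists w a' b', cell_tight c K a b w a' b' /\
    forall i j, c K i != c K j -> w i j = 0.
Proof.
move=> cS a0 b0; elim: K => [|K [w [a' [b' [[[w0 ab0] [wa wb] tight] wc]]]]].
  exists (fun _ _ => 0), a, b; split=> //; split=> //.
  by split=> i; rewrite big1 ?add0r.
pose ma g := \sum_(i | c K i == g) a' i.
pose mb g := \sum_(i | c K i == g) b' i.
have ma0 g : 0 <= ma g by apply: sumr_ge0 => i _; case: (ab0 i).
have mb0 g : 0 <= mb g by apply: sumr_ge0 => i _; case: (ab0 i).
pose mm g := Num.max (ma g) (mb g).
have mm0 g : 0 <= mm g by rewrite le_max ma0.
(* Dividing by the larger of the two leftovers exhausts the smaller one. If both vanish, [x / 0 = 0]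
   is the value wanted. *)
pose w' i j := if c K i == c K j then a' i * b' j / mm (c K i) else 0.
have w'0 i j : 0 <= w' i j.
  rewrite /w'; case: ifP => // _; apply: divr_ge0 => //.
  by case: (ab0 i) (ab0 j) => ? _ [_ ?]; apply: mulr_ge0.
have w'r i : \sum_j w' i j = a' i * (mb (c K i) / mm (c K i)).
  rewrite /w' -big_mkcond /= [mb _ / _]mulr_suml mulr_sumr.
  by apply: eq_big => [j|j _]; [rewrite eq_sym|rewrite mulrA].
have w'c j : \sum_i w' i j = b' j * (ma (c K j) / mm (c K j)).
  rewrite /w' -big_mkcond /= [ma _ / _]mulr_suml mulr_sumr.
  by apply: eq_big => [i|i /eqP ->] //; rewrite mulrA [b' j * _]mulrC.
have mb1 g : mb g / mm g <= 1.
  have [->|mmg] := eqVneq (mm g) 0; first by rewrite invr0 mulr0 ler01.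
  by rewrite ler_pdivrMr ?lt0r ?mmg ?mm0// mul1r le_max lexx orbT.
have ma1 g : ma g / mm g <= 1.
  have [->|mmg] := eqVneq (mm g) 0; first by rewrite invr0 mulr0 ler01.
  by rewrite ler_pdivrMr ?lt0r ?mmg ?mm0// mul1r le_max lexx.
pose a2 i := a' i - \sum_j w' i j.
pose b2 j := b' j - \sum_i w' i j.
have a20 i : 0 <= a2 i.
  rewrite /a2 w'r subr_ge0 -[leRHS]mulr1; apply: ler_wpM2l => //.
  by case: (ab0 i).
have b20 i : 0 <= b2 i.
  rewrite /b2 w'c subr_ge0 -[leRHS]mulr1; apply: ler_wpM2l => //.
  by case: (ab0 i).
have ww'c i j : c K i != c K j -> w i j + w' i j = 0.
  by move=> cij; rewrite wc// /w' (negbTE cij) addr0.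
exists (fun i j => w i j + w' i j), a2, b2; split; last first.
  move=> i j cij; apply: ww'c; apply: contra cij => /eqP cij.
  by apply/eqP; apply: cS.
split.
- by split=> // i j; apply: addr_ge0.
- split=> i; rewrite big_split /= /a2 /b2 1?wa 1?wb; ring.
(* So far [w] couples only inside the cells of level [K], so the coupled mass cancels from the
   excess of such a cell. *)
have mabE g : \sum_(i | c K i == g) a i - \sum_(i | c K i == g) b i =
    ma g - mb g.
  under eq_bigr do rewrite wa.
  under [X in _ - X]eq_bigr do rewrite wb.
  rewrite !big_split /=.
  suff -> : \sum_(i | c K i == g) \sum_j w i j =
      \sum_(j | c K j == g) \sum_i w i j by rewrite /ma /mb; ring.
  rewrite exchange_big /= [RHS]big_mkcond /=; apply: eq_bigr => j _.
  case: ifPn => [/eqP cj|cj].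
    rewrite big_mkcond /=; apply: eq_bigr => i _; case: ifPn => // ci.
    by rewrite wc// cj.
  by rewrite big1// => i /eqP ci; rewrite wc// ci eq_sym.
have ma2 g : \sum_(i | c K i == g) a2 i <= Num.max 0 (ma g - mb g).
  have -> : \sum_(i | c K i == g) a2 i = ma g * (1 - mb g / mm g).
    rewrite /ma mulr_suml; apply: eq_bigr => i /eqP ci.
    by rewrite /a2 w'r ci; ring.
  rewrite le_max /mm; have [mab|mab] := leP (ma g) (mb g).
    have [mbg|mbg] := eqVneq (mb g) 0.
      suff -> : ma g = 0 by rewrite mul0r lexx.
      by apply/eqP; rewrite eq_le ma0 andbT -mbg.
    by rewrite divff// subrr mulr0 lexx.
  have mag : ma g != 0 by rewrite gt_eqF// (le_lt_trans (mb0 g)).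
  by apply/orP; right; rewrite mulrBr mulr1 mulrCA divff// mulr1.
have mb2 g : \sum_(i | c K i == g) b2 i <= Num.max 0 (mb g - ma g).
  have -> : \sum_(i | c K i == g) b2 i = mb g * (1 - ma g / mm g).
    rewrite /mb mulr_suml; apply: eq_bigr => i /eqP ci.
    by rewrite /b2 w'c ci; ring.
  rewrite le_max /mm; have [mab|mab] := leP (mb g) (ma g).
    have [mbg|mbg] := eqVneq (ma g) 0.
      suff -> : mb g = 0 by rewrite mul0r lexx.
      by apply/eqP; rewrite eq_le mb0 andbT -mbg.
    by rewrite divff// subrr mulr0 lexx.
  have mag : mb g != 0 by rewrite gt_eqF// (le_lt_trans (ma0 g)).
  by apply/orP; right; rewrite mulrBr mulr1 mulrCA divff// mulr1.
move=> k g; rewrite ltnS leq_eqVlt => /predU1P[->|kK].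
  split.
    rewrite mabE; apply: le_trans (ma2 g); apply: ler_sum => i /eqP ci.
    rewrite big1 ?add0r// => j; rewrite eq_sym -ci; exact: ww'c.
  rewrite -opprB mabE opprB; apply: le_trans (mb2 g).
  apply: ler_sum => i /eqP ci.
  by rewrite big1 ?add0r// => j; rewrite -ci; exact: ww'c.
(* In a finer cell the new step only turns leftover mass into coupled mass, part of which leaves the
   cell: leaving plus left over cannot increase. *)
have [t1 t2] := tight k g kK; split.
  apply: le_trans t1; apply: ler_sum => i _; rewrite big_split /= -addrA lerD2l.
  rewrite /a2 addrCA -[leRHS]addr0 lerD2l subr_le0.
  by rewrite big_mkcond /=; apply: ler_sum => j _; case: ifP.
apply: le_trans t2; apply: ler_sum => j _; rewrite big_split /= -addrA lerD2l.
rewrite /b2 addrCA -[leRHS]addr0 lerD2l subr_le0.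
by rewrite big_mkcond /=; apply: ler_sum => i _; case: ifP.
Qed.

Lemma tree_coupling (c : nat -> I -> J) (K : nat) a b :
  (forall k i j, c k i = c k j -> c k.+1 i = c k.+1 j) ->
  (forall i j, c K i = c K j) ->
  (forall i, 0 <= a i) -> (forall i, 0 <= b i) -> \sum_i a i = \sum_i b i ->
  exists w : I -> I -> R,
  [/\ forall i j, 0 <= w i j, forall i, \sum_j w i j = a i,
      forall j, \sum_i w i j = b j &
      forall k g, (k < K)%N ->
        \sum_(i | c k i == g) \sum_(j | c k j != g) w i j
        + \sum_(j | c k j == g) \sum_(i | c k i != g) w i j <=
        `|\sum_(i | c k i == g) a i - \sum_(i | c k i == g) b i|].
Proof.
move=> cS cK a0 b0 ab.
(* The greedy run goes one level past the root: in the root cell the excess is 0, so tightness there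
   kills all leftovers. *)
have [w [a' [b' [[[w0 ab'0] [wa wb] tight] _]]]] :=
  @greedy_coupling c K.+1 a b cS a0 b0.
have z i : a' i = 0 /\ b' i = 0.
  have [] := tight K (c K i) (ltnSn K).
  have cE j : c K j == c K i by apply/eqP.
  have allE (f : I -> R) : \sum_(j | c K j == c K i) f j = \sum_j f j.
    by apply: eq_bigl => j; rewrite cE.
  rewrite !allE ab subrr maxxx => h1 h2; split; apply/eqP; rewrite eq_le.
    rewrite (proj1 (ab'0 i)) andbT; apply: le_trans h1.
    rewrite (bigD1 i)//= big1 ?add0r; last by move=> j; rewrite cE.
    rewrite lerDl; apply: sumr_ge0 => j _; apply: addr_ge0.
      by apply: sumr_ge0.
    by case: (ab'0 j).
  rewrite (proj2 (ab'0 i)) andbT; apply: le_trans h2.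
  rewrite (bigD1 i)//= big1 ?add0r; last by move=> j; rewrite cE.
  rewrite lerDl; apply: sumr_ge0 => j _; apply: addr_ge0.
    by apply: sumr_ge0.
  by case: (ab'0 j).
exists w; split=> //.
- by move=> i; rewrite wa (proj1 (z i)) addr0.
- by move=> i; rewrite wb (proj2 (z i)) addr0.
move=> k g kK; have [] := tight k g (leq_trans kK (leqnSn K)).
under eq_bigr do rewrite (proj1 (z _)) addr0.
under [X in _ -> X <= _ -> _]eq_bigr do rewrite (proj2 (z _)) addr0.
set x := \sum_(i | c k i == g) a i; set y := \sum_(i | c k i == g) b i.
move=> h1 h2; apply: le_trans (lerD h1 h2) _.
have [xy|xy] := leP x y.
  have -> : Num.max 0 (x - y) = 0 by apply/max_idPl; lra.
  have -> : Num.max 0 (y - x) = y - x by apply/max_idPr; lra.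
  by rewrite ler0_norm; lra.
have -> : Num.max 0 (y - x) = 0 by apply/max_idPl; lra.
have -> : Num.max 0 (x - y) = x - y by apply/max_idPr; lra.
by rewrite gtr0_norm; lra.
Qed.

(** A pair separated at depth [k] pays for both of its cells. After exchanging the sums, [kappa k g]
    multiplies the mass leaving [g] plus the mass entering it. *)
Lemma tree_flow_le (c : nat -> I -> J) (K : nat) a b w (kappa : nat -> J -> R) :
  (forall k g, 0 <= kappa k g) ->
  (forall k g, (k < K)%N ->
    \sum_(i | c k i == g) \sum_(j | c k j != g) w i j
    + \sum_(j | c k j == g) \sum_(i | c k i != g) w i j <=
    `|\sum_(i | c k i == g) a i - \sum_(i | c k i == g) b i|) ->
  \sum_i \sum_j w i j * \sum_(k < K | c k i != c k j)
    (kappa k (c k i) + kappa k (c k j)) <=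
  \sum_(k < K) \sum_g kappa k g *
    `|\sum_(i | c k i == g) a i - \sum_(i | c k i == g) b i|.
Proof.
move=> kappa0 flow.
have sumE (k : nat) (F : J -> I -> R) :
    \sum_i F (c k i) i = \sum_g \sum_(i | c k i == g) F g i.
  rewrite (exchange_big_dep predT)//=; apply: eq_bigr => i _.
  by rewrite (bigD1 (c k i))//= big1 ?addr0// => g; case: eqVneq => // ->; rewrite eqxx.
rewrite [leLHS](_ : _ = \sum_(k < K) \sum_i \sum_(j | c k j != c k i)
    w i j * (kappa k (c k i) + kappa k (c k j))); last first.
  rewrite [RHS]exchange_big /=; apply: eq_bigr => i _.
  rewrite [RHS](exchange_big_dep predT)//=; apply: eq_bigr => j _; rewrite mulr_sumr.
  by apply: eq_bigl => k; rewrite eq_sym.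
apply: ler_sum => k _.
rewrite [leLHS](_ : _ = \sum_g kappa k g *
   (\sum_(i | c k i == g) \sum_(j | c k j != g) w i j
    + \sum_(j | c k j == g) \sum_(i | c k i != g) w i j)).
  by apply: ler_sum => g _; apply: ler_wpM2l => //; exact: flow.
under [RHS]eq_bigr do rewrite mulrDr 2!mulr_sumr.
rewrite big_split /= -(sumE k (fun g i => kappa k g * \sum_(j | c k j != g) w i j)).
rewrite -(sumE k (fun g j => kappa k g * \sum_(i | c k i != g) w i j)).
under [X in _ = _ + X]eq_bigr do rewrite mulr_sumr.
rewrite [X in _ = _ + X](exchange_big_dep predT)//= -big_split /=.
apply: eq_bigr => i _; rewrite mulr_sumr.
rewrite [X in _ = _ + X](eq_bigl (fun j => c k j != c k i)); last first.
  by move=> j; rewrite eq_sym.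
by rewrite -big_split /=; apply: eq_bigr => j _; rewrite mulrDr; congr (_ + _); rewrite mulrC.
Qed.

End TreeCoupling.

(** * Deviations under a finite product law *)

Section ProductLaw.
Context {R : realType} {I : finType} (N : nat) (a : I -> R).
Hypothesis a0 : forall i, 0 <= a i.
Hypothesis a1 : \sum_i a i = 1.

Definition product_law (S : {pred {ffun 'I_N -> I}}) : R :=
  \sum_(t | t \in S) \prod_k a (t k).

Lemma product_law_le (S S' : {pred {ffun 'I_N -> I}}) :
  {subset S <= S'} -> product_law S <= product_law S'.
Proof.
move=> SS'; rewrite /product_law [leLHS]big_mkcond [leRHS]big_mkcond.
apply: ler_sum => t _; case: ifPn => [/SS' ->//|_].
by case: ifP => // _; apply: prodr_ge0.
Qed.

Lemma product_lawT : product_law predT = 1.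
Proof.
rewrite /product_law -(bigA_distr_bigA (fun _ i => a i)) /=.
by rewrite big1.
Qed.

Lemma product_law_bigU (T : finType) (D : {pred T})
    (S : T -> {pred {ffun 'I_N -> I}}) :
  product_law [pred t : {ffun 'I_N -> I} | [exists u in D, t \in S u]] <=
    \sum_(u in D) product_law (S u).
Proof.
under [leRHS]eq_bigr do rewrite /product_law big_mkcond.
rewrite exchange_big /= /product_law [leLHS]big_mkcond /=.
apply: ler_sum => t _; rewrite inE; case: existsP => [[u /andP[uD tu]]|_].
  rewrite (bigD1 u)//= tu lerDl; apply: sumr_ge0 => u' _.
  by case: ifP => // _; apply: prodr_ge0.
by apply: sumr_ge0 => u' _; case: ifP => // _; apply: prodr_ge0.
Qed.

Lemma product_lawU (S S' : {pred {ffun 'I_N -> I}}) :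
  product_law [predU S & S'] <= product_law S + product_law S'.
Proof.
rewrite /product_law [leLHS]big_mkcond [X in _ <= X + _]big_mkcond.
rewrite [X in _ <= _ + X]big_mkcond -big_split; apply: ler_sum => t _ /=.
have p0 : 0 <= \prod_k a (t k) by apply: prodr_ge0.
by rewrite !inE; case: (t \in S); case: (t \in S') => /=; lra.
Qed.

Lemma product_law_coord (k : 'I_N) (A : {pred I}) :
  product_law [pred t : {ffun 'I_N -> I} | t k \in A] = \sum_(i in A) a i.
Proof.
pose F (j : 'I_N) i : R := a i * (if j == k then (i \in A)%:R else 1).
transitivity (\prod_j \sum_i F j i).
  rewrite bigA_distr_bigA /product_law big_mkcond /=; apply: eq_bigr => t _.
  rewrite big_split /= [X in _ * X](bigD1 k)//= eqxx [X in _ * (_ * X)]big1 ?mulr1; last first.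
    by move=> j /negbTE ->.
  by rewrite inE; case: (t k \in A); rewrite ?mulr1 ?mulr0.
rewrite (bigD1 k)//= [X in _ * X]big1 ?mulr1; last first.
  move=> j jk; rewrite -[RHS]a1; apply: eq_bigr => i _.
  by rewrite /F (negbTE jk) mulr1.
rewrite [RHS]big_mkcond; apply: eq_bigr => i _; rewrite /F eqxx.
by case: (i \in A); rewrite ?mulr1 ?mulr0.
Qed.

Lemma chernoff (h : I -> R) (y lam : R) : 0 <= lam ->
  product_law [pred t : {ffun 'I_N -> I} | y < \sum_k h (t k)] <=
    expR (- (lam * y)) * (\sum_i a i * expR (lam * h i)) ^+ N.
Proof.
move=> lam0.
have -> : (\sum_i a i * expR (lam * h i)) ^+ N =
    \sum_(t : {ffun 'I_N -> I}) \prod_k (a (t k) * expR (lam * h (t k))).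
  rewrite -(bigA_distr_bigA (fun _ i => a i * expR (lam * h i))) /=.
  by rewrite prodr_const card_ord.
rewrite mulr_sumr /product_law [leLHS]big_mkcond; apply: ler_sum => t _.
have p0 : 0 <= \prod_k a (t k) by apply: prodr_ge0.
rewrite big_split /= -expR_sum mulrCA -expRD inE; case: ifPn => [yt|_].
  rewrite -{1}[\prod_k a (t k)]mulr1; apply: ler_wpM2l => //.
  by rewrite -expR0 ler_expR -mulr_sumr -mulrN -mulrDr mulr_ge0//; lra.
by rewrite mulr_ge0// expR_ge0.
Qed.

End ProductLaw.

(** Since [exp u <= 1 / (1 - u)], it suffices that [(1 - u) (1 + u + 2 u^2) = 1 + u^2 (1 - 2 u) >=
    1]. No lower bound on [u] is required, so signed variables are covered. *)
Lemma expR_le_quadratic {R : realType} (u : R) :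
  u <= 1 / 2 -> expR u <= 1 + u + 2 * u ^+ 2.
Proof.
move=> u2; have := expR_ge1Dx (- u); rewrite expRN => h.
rewrite -[leLHS]invrK -[leRHS]invrK lef_pV2 ?posrE ?invr_gt0 ?expR_gt0//; last first.
  by nra.
apply: le_trans h; rewrite -[leLHS]mul1r ler_pdivrMr; last by nra.
by nra.
Qed.

Section Deviations.
Context {R : realType} {I : finType} (N : nat) (a : I -> R).
Hypothesis a0 : forall i, 0 <= a i.
Hypothesis a1 : \sum_i a i = 1.

(** The parameter [B] widens the Gaussian range from [y <= v] to [y <= B v], at the price of a
    factor [B] in the exponent. *)
Lemma bernstein (h : I -> R) (y v B : R) :
  (forall i, `|h i| <= 1) -> \sum_i a i * (h i) ^+ 2 <= v ->
  0 < v -> 1 <= B -> 0 <= y -> y <= B * v ->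
  product_law N a
    [pred t : {ffun 'I_N -> I} | N%:R * (\sum_i a i * h i + y) < \sum_k h (t k)] <=
    expR (- (N%:R * y ^+ 2 / (8 * B * v))).
Proof.
move=> h1 hv v0 B1 y0 yB.
have B0 : 0 < B by lra.
have Bv0 : 0 < B * v by apply: mulr_gt0.
(* The minimiser of [2 lam^2 B v - lam y], with value [- y^2 / (8 B v)]. The range of [y] gives
   [lam <= 1/4], as the quadratic bound on the exponential demands. *)
pose lam := y / (4 * (B * v)).
have lam0 : 0 <= lam by rewrite /lam divr_ge0// ltW//; lra.
have lamE : lam * (4 * (B * v)) = y by rewrite /lam divfK//; apply: lt0r_neq0; lra.
have lam2 : lam <= 1 / 4 by rewrite /lam ler_pdivrMr; lra.
apply: le_trans (chernoff _ _ a0 h _ _ lam0) _.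
set e := \sum_i a i * h i.
have mgf : \sum_i a i * expR (lam * h i) <= expR (lam * e + 2 * lam ^+ 2 * v).
  apply: le_trans (expR_ge1Dx _).
  apply: (@le_trans _ _ (\sum_i (a i + lam * (a i * h i) +
      2 * lam ^+ 2 * (a i * (h i) ^+ 2)))).
    apply: ler_sum => i _.
    have -> : a i + lam * (a i * h i) + 2 * lam ^+ 2 * (a i * (h i) ^+ 2) =
       a i * (1 + lam * h i + 2 * (lam * h i) ^+ 2) by ring.
    apply: ler_wpM2l => //; apply: expR_le_quadratic.
    have := h1 i; rewrite ler_norml => /andP[_ hi].
    by nra.
  rewrite !big_split /= a1 -!mulr_sumr -/e addrA lerD2l.
  by apply: ler_wpM2l => //; rewrite mulr_ge0// exprn_ge0.
have mgf0 : 0 <= \sum_i a i * expR (lam * h i).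
  by apply: sumr_ge0 => i _; rewrite mulr_ge0// expR_ge0.
apply: (@le_trans _ _ (expR (- (lam * (N%:R * (e + y)))) *
    expR (N%:R * (lam * e + 2 * lam ^+ 2 * v)))).
  rewrite ler_pM2l ?expR_gt0// expRM_natl.
  by rewrite lerXn2r// nnegrE ?expR_ge0.
rewrite -expRD ler_expR.
have N0 : 0 <= N%:R :> R by [].
have -> : - (lam * (N%:R * (e + y))) + N%:R * (lam * e + 2 * lam ^+ 2 * v) =
  - (N%:R * (lam * y - 2 * lam ^+ 2 * v)) by ring.
rewrite lerN2 -mulrA ler_wpM2l// -lamE.
have -> : (lam * (4 * (B * v))) ^+ 2 / (8 * B * v) = 2 * lam ^+ 2 * B * v.
  by field; rewrite !lt0r_neq0.
have : 0 <= lam ^+ 2 by apply: exprn_ge0.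
have : v <= B * v by nra.
set l2 := lam ^+ 2; have -> : lam * (lam * (4 * (B * v))) = 4 * l2 * (B * v).
  by rewrite /l2; ring.
nra.
Qed.

(* The deviation is the maximum over the sets [S] of cells counted with a plus sign
   of signed sums, each controlled by [bernstein]. *)
Lemma partition_deviation {J : finType} (c : I -> J) (G : {set J}) (y v B : R) :
  (0 < N)%N -> \sum_(i | c i \in G) a i <= v ->
  0 < v -> 1 <= B -> 0 <= y -> y <= B * v ->
  product_law N a
    [pred t : {ffun 'I_N -> I} | y < \sum_(j in G) `|\sum_(i | c i == j) a i
                   - N%:R^-1 * \sum_k (c (t k) == j)%:R|] <=
    2 ^+ #|G| * expR (- (N%:R * y ^+ 2 / (8 * B * v))).
Proof.
move=> N0 av v0 B1 y0 yB.
pose h (S : {set J}) i : R := if c i \in G then (-1) ^+ (c i \notin S) else 0.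
have h1 S i : `|h S i| <= 1.
  rewrite /h; case: ifP; rewrite ?normr0 ?ler01// => _.
  by rewrite normrX normrN1 expr1n.
have h2 S : \sum_i a i * (h S i) ^+ 2 <= v.
  apply: le_trans av; rewrite [leRHS]big_mkcond; apply: ler_sum => i _.
  rewrite /h; case: ifP => _; last by rewrite expr0n mulr0.
  by rewrite sqrr_sign mulr1.
have NR : 0 < N%:R :> R by rewrite ltr0n.
pose ev S := [pred t : {ffun 'I_N -> I} |
  N%:R * (\sum_i a i * h S i + y) < \sum_k h S (t k)].
apply: (@le_trans _ _ (\sum_(S in powerset G) product_law N a (ev S))).
  apply: le_trans (product_law_bigU _ _ a0 _ _ ev).
  apply: product_law_le => // t; rewrite !inE => yt.
  pose b j : R := N%:R^-1 * \sum_k (c (t k) == j)%:R.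
  pose m j : R := \sum_(i | c i == j) a i.
  pose S := [set j in G | m j <= b j].
  apply/existsP; exists S; rewrite powersetE inE; apply/andP; split.
    by apply/fintype.subsetP => j; rewrite inE => /andP[].
  suff hE : \sum_(j in G) `|m j - b j| =
      N%:R^-1 * \sum_k h S (t k) - \sum_i a i * h S i.
    have : y < N%:R^-1 * \sum_k h S (t k) - \sum_i a i * h S i by rewrite -hE.
    rewrite ltrBrDr => yh; rewrite mulrC -ltr_pdivlMr// mulrC.
    by rewrite addrC.
  have hs i : h S i = \sum_(j in G) (c i == j)%:R * (-1) ^+ (j \notin S).
    rewrite /h; case: ifPn => ci.
      rewrite (bigD1 (c i))//= eqxx mul1r big1 ?addr0// => j /andP[_ jc].
      by rewrite eq_sym (negbTE jc) mul0r.
    rewrite big1// => j jG; case: eqP => [cj|_]; last by rewrite mul0r.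
    by move: ci; rewrite cj jG.
  under [X in _ * X]eq_bigr do rewrite hs.
  under [X in _ - X]eq_bigr do rewrite hs mulr_sumr.
  rewrite exchange_big /= mulr_sumr [X in _ - X]exchange_big /= -sumrB.
  apply: eq_bigr => j jG.
  have -> : \sum_i a i * ((c i == j)%:R * (-1) ^+ (j \notin S)) =
      m j * (-1) ^+ (j \notin S).
    rewrite /m mulr_suml [RHS]big_mkcond; apply: eq_bigr => i _.
    by case: eqP => _; rewrite ?mul1r// mul0r mulr0.
  rewrite -mulr_suml mulrA -/(b j) -mulrBl inE jG /=.
  have [mb|mb] := leP (m j) (b j); first by rewrite expr0 mulr1 ler0_norm; lra.
  by rewrite expr1 gtr0_norm; lra.
rewrite -natrX -card_powerset.
rewrite mulr_natl -sumr_const; apply: ler_sum => S _.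
exact: bernstein.
Qed.

(* With [T] the right-hand side up to the constant, the Chernoff parameter
   [2 ln (1 / T) / (N x)] balances the truncation level [N x / 4] of [Z]. *)
Lemma heavy_tail (Z : I -> R) (x s K0 : R) :
  (0 < N)%N -> 0 < x -> 1 < s -> 0 <= K0 ->
  (forall i, 0 <= Z i <= N%:R * x / 4) ->
  \sum_i a i * Z i <= x / 4 -> \sum_i a i * Z i `^ s <= K0 ->
  product_law N a [pred t : {ffun 'I_N -> I} | N%:R * x < \sum_k Z (t k)] <=
    expR (K0 * (8 * s) `^ s) * (N%:R * (N%:R * x) `^ (- s)).
Proof.
move=> N0 x0 s1 K00 Z01 EZ EZs.
have NR : 0 < N%:R :> R by rewrite ltr0n.
have Nx0 : 0 < N%:R * x by apply: mulr_gt0.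
set T := N%:R * (N%:R * x) `^ (- s).
have T0 : 0 < T by rewrite mulr_gt0// powR_gt0.
have K1 : 0 <= K0 * (8 * s) `^ s by rewrite mulr_ge0// powR_ge0.
(* For [T >= 1] the right-hand side is at least 1; from here on [ln T < 0]. *)
have [T1|T1] := leP 1 T.
  apply: (@le_trans _ _ 1).
    by rewrite -(product_lawT N a a1); apply: product_law_le.
  by rewrite mulr_ege1// -{1}expR0 ler_expR.
pose L := - ln T.
have L0 : 0 < L by rewrite /L oppr_gt0 ln_lt0// T0.
have TE : T = expR (- L) by rewrite /L opprK lnK.
pose lam := 2 * L / (N%:R * x).
have lam0 : 0 < lam by rewrite divr_gt0// mulr_gt0.
have lamNx : lam * (N%:R * x) = 2 * L by rewrite divfK// gt_eqF.
apply: le_trans (chernoff _ _ a0 Z _ _ (ltW lam0)) _.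
have s0 : 0 < s by lra.
pose W := (2 * lam) `^ s * expR (L / 2) * K0.
have lamZ i : lam * Z i <= L / 2.
  have /andP[_ Zi] := Z01 i.
  by have := ler_wpM2l (ltW lam0) Zi; rewrite mulrA lamNx; lra.
have mgf : \sum_i a i * expR (lam * Z i) <= expR (lam * x / 2 + W).
  apply: le_trans (expR_ge1Dx _).
  apply: (@le_trans _ _ (\sum_i (a i + 2 * lam * (a i * Z i) +
      (2 * lam) `^ s * expR (L / 2) * (a i * Z i `^ s)))).
    apply: ler_sum => i _; have /andP[Zi0 _] := Z01 i.
    have -> : a i + 2 * lam * (a i * Z i) +
       (2 * lam) `^ s * expR (L / 2) * (a i * Z i `^ s) =
       a i * (1 + 2 * (lam * Z i) +
         expR (L / 2) * ((2 * lam) `^ s * Z i `^ s)) by ring.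
    apply: ler_wpM2l => //; rewrite -powRM//; last lra.
    have lZ0 : 0 <= lam * Z i by rewrite mulr_ge0// ltW.
    (* Small values: [1 + u + 2 u^2 <= 1 + 2 u]. Large values: [exp (lam Z) <= exp (L / 2)] by
       truncation, and [1 <= (2 lam Z)^s] brings in the moment of order [s]. *)
    have [lZ|lZ] := leP (lam * Z i) (1 / 2).
      apply: le_trans (expR_le_quadratic _ lZ) _.
      rewrite -[leLHS]addr0 lerD ?mulr_ge0 ?expR_ge0 ?powR_ge0//.
      by nra.
    apply: (@le_trans _ _ (expR (L / 2) * 1)).
      by rewrite mulr1 ler_expR.
    apply: (@le_trans _ _ (expR (L / 2) * (2 * lam * Z i) `^ s)); last by lra.
    rewrite ler_pM2l ?expR_gt0//.
    have h1 : 1 <= 2 * lam * Z i by lra.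
    apply: (@le_trans _ _ (1 `^ s)); first by rewrite powR1.
    by apply: ge0_ler_powR; rewrite ?nnegrE; lra.
  rewrite !big_split /= a1 -!mulr_sumr -addrA lerD2l lerD//.
    have := ler_wpM2l (ltW lam0) EZ; lra.
  by apply: ler_wpM2l EZs; rewrite mulr_ge0 ?powR_ge0 ?expR_ge0.
have mgf0 : 0 <= \sum_i a i * expR (lam * Z i).
  by apply: sumr_ge0 => i _; rewrite mulr_ge0// expR_ge0.
apply: (@le_trans _ _ (expR (- (lam * (N%:R * x))) *
    expR (N%:R * (lam * x / 2 + W)))).
  rewrite ler_pM2l ?expR_gt0// expRM_natl.
  by rewrite lerXn2r// nnegrE ?expR_ge0.
rewrite TE -!expRD ler_expR lamNx.
have NlamE : N%:R * (lam * x / 2) = L.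
  by have := lamNx; rewrite mulrCA => h; lra.
suff : N%:R * W <= K0 * (8 * s) `^ s by rewrite mulrDr NlamE; lra.
rewrite /W mulrCA mulrC -mulrA [leLHS]mulrCA [leLHS]mulrC.
have -> : N%:R * ((2 * lam) `^ s * expR (L / 2)) =
    T * (4 * L) `^ s * expR (L / 2).
  rewrite /T /lam.
  have -> : 2 * (2 * L / (N%:R * x)) = 4 * L * (N%:R * x)^-1 by ring.
  have Nx1 : 0 <= (N%:R * x)^-1 by rewrite invr_ge0 ltW.
  have L40 : 0 <= 4 * L by lra.
  have -> : (4 * L * (N%:R * x)^-1) `^ s = (4 * L) `^ s * (N%:R * x) `^ (- s).
    by rewrite (powRM _ L40 Nx1) -(powR_inv1 (ltW Nx0)) -powRrM mulN1r.
  by ring.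
rewrite mulrC; apply: ler_wpM2l => //.
(* What remains is [(4 L exp (- L / (2 s)))^s]. With [t = L / (2 s)] its base is
   [8 s t exp (- t) <= 8 s], the origin of [(8 s)^s]. *)
rewrite TE mulrAC -expRD.
have -> : - L + L / 2 = (- (L / (2 * s))) * s by field; lra.
rewrite expRM -powRM ?expR_ge0//; last lra.
apply: ge0_ler_powR; rewrite ?nnegrE ?mulr_ge0 ?expR_ge0//; try lra.
rewrite expRN mulrC ler_pdivrMr ?expR_gt0//.
have := expR_ge1Dx (L / (2 * s)) => h.
have : L = 2 * s * (L / (2 * s)) by field; lra.
by nra.
Qed.

End Deviations.

(** * Geometric sums of powers of two *)

Section PowersOfTwo.
Context {R : realType}.
Implicit Types (s t x y z : R).

Lemma powR2_gt0 t : 0 < 2 `^ t :> R. Proof. exact: powR_gt0. Qed.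

Lemma powR2D s t : 2 `^ (s + t) = 2 `^ s * 2 `^ t :> R.
Proof. by rewrite powRD// pnatr_eq0 implybT. Qed.

Lemma ler_powR2 s t : s <= t -> 2 `^ s <= 2 `^ t :> R.
Proof. by move=> st; rewrite ler_powR// ler1n. Qed.

(** At [1 / 2] the bound of [expR_le_quadratic] is exactly 2. *)
Lemma ln2_ge_half : 1 / 2 <= ln 2 :> R.
Proof.
rewrite -ler_expR lnK ?posrE//.
by apply: le_trans (expR_le_quadratic _ _) _; lra.
Qed.

Lemma powR2_ge_linear t : 0 <= t -> 1 + t / 2 <= 2 `^ t :> R.
Proof.
move=> t0; have ln2 := ln2_ge_half.
rewrite /powR pnatr_eq0 /=; apply: le_trans (expR_ge1Dx _); nra.
Qed.

Lemma powR2N_lt1 t : 0 < t -> 2 `^ (- t) < 1 :> R.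
Proof.
move=> t0; rewrite powRN invf_lt1 ?powR2_gt0//.
have := powR2_ge_linear t (ltW t0); lra.
Qed.

Lemma sum_geometric_le z (n : nat) : 0 <= z -> z < 1 ->
  \sum_(i < n) z ^+ i <= (1 - z)^-1.
Proof.
move=> z0 z1; rewrite -[leRHS]mul1r ler_pdivlMr; last lra.
rewrite mulrC -[X in X <= _]opprK -mulNr opprB -subrX1 opprB.
by rewrite lerBlDr lerDl exprn_ge0.
Qed.

Lemma sum_powR2_le g (n : nat) : 0 < g ->
  \sum_(i < n) (1 - 2 `^ (- g)) * 2 `^ (- (g * i%:R)) <= 1 :> R.
Proof.
move=> g0; have z1 := powR2N_lt1 g g0.
rewrite -mulr_sumr -ler_pdivlMl ?subr_gt0// mulr1.
rewrite (eq_bigr (fun i : 'I_n => (2 `^ (- g)) ^+ i)).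
  by apply: sum_geometric_le => //; exact: powR_ge0.
by move=> i _; rewrite -powR_mulrn ?powR_ge0// -powRrM mulNr.
Qed.

Lemma sum_powR2_rev_le g (n : nat) : 0 < g ->
  \sum_(i < n) (1 - 2 `^ (- g)) * 2 `^ (- (g * (n.-1%:R - i%:R))) <= 1 :> R.
Proof.
move=> g0; rewrite (reindex_inj rev_ord_inj) /=.
rewrite (eq_bigr (fun i : 'I_n => (1 - 2 `^ (- g)) * 2 `^ (- (g * i%:R)))).
  exact: sum_powR2_le.
move=> i _; congr (_ * 2 `^ (- (_ * _))).
case: n i => [[]//|n] i /=; rewrite subSS natrB -1?ltnS//; ring.
Qed.

(* 2 ^ (d l + delta n) >= 1 + (d l + delta n) / 2 makes the double sum geometric. *)
Lemma sum_doubly_exponential_le (A delta D : R) (M : nat) (ell : nat -> nat) :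
  2 <= A -> 0 < delta -> 1 <= D ->
  \sum_(n < M) \sum_(l < (ell n).+1)
    expR (- (A / 2 * (2 `^ (D * l%:R) * 2 `^ (delta * n%:R)))) <=
  (1 - expR (- (1 / 2)))^-1 * (1 - expR (- (delta / 2)))^-1 * expR (- (A / 2)).
Proof.
move=> A2 delta0 D1.
have geo t (n : nat) : 0 < t ->
    \sum_(i < n) expR (- (t * i%:R)) <= (1 - expR (- t))^-1.
  move=> t0; rewrite (eq_bigr (fun i : 'I_n => (expR (- t)) ^+ i)).
    by apply: sum_geometric_le; rewrite ?expR_ge0// -expR0 ltr_expR; lra.
  by move=> i _; rewrite -expRM_natl; congr expR; ring.
have G0 t : 0 < t -> 0 <= (1 - expR (- t))^-1.
  by move=> t0; rewrite invr_ge0 subr_ge0 -[leRHS]expR0 ler_expR; lra.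
apply: (@le_trans _ _ (\sum_(n < M) (1 - expR (- (1 / 2)))^-1 *
    (expR (- (delta / 2 * n%:R)) * expR (- (A / 2))))); last first.
  have h2 : 0 < 1 / 2 :> R by lra.
  rewrite -mulr_sumr -mulr_suml -!mulrA ler_wpM2l ?(G0 _ h2)//.
  by rewrite ler_wpM2r ?expR_ge0// geo// divr_gt0.
apply: ler_sum => n _.
apply: (@le_trans _ _ (\sum_(l < (ell n).+1) expR (- (1 / 2 * l%:R)) *
    (expR (- (delta / 2 * n%:R)) * expR (- (A / 2))))).
  apply: ler_sum => l _; rewrite -!expRD ler_expR -powR2D.
  have l0 : 0 <= l%:R :> R by exact: ler0n.
  have n0 : 0 <= n%:R :> R by exact: ler0n.
  have t0 : 0 <= D * l%:R + delta * n%:R by rewrite addr_ge0// mulr_ge0// ltW//; lra.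
  have := powR2_ge_linear _ t0; set E := 2 `^ _.
  have Dl : l%:R <= D * l%:R by rewrite ler_peMl.
  have dn : 0 <= delta * n%:R by rewrite mulr_ge0// ltW.
  set dn' := delta * n%:R in dn t0 *; set Dl' := D * l%:R in Dl t0 *.
  have -> : delta / 2 * n%:R = dn' / 2 by rewrite /dn'; ring.
  move=> HE; suff : A / 2 + (l%:R + dn') / 2 <= A / 2 * E by lra.
  nra.
rewrite -mulr_suml ler_wpM2r ?mulr_ge0 ?expR_ge0//; apply: geo; lra.
Qed.

(** Take the least [l] with [r 2^(p l) >= 1]; by minimality the previous level is below 1. The first
    inequality will make the finest cells affordable, the second will keep the thresholds in the
    range of [bernstein] with [B = 2^p]. *)
Lemma level_exists (p r : R) : 0 < p -> 0 < r -> r <= 1 ->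
  exists l : nat, 1 <= r * 2 `^ (p * l%:R) /\
    forall l' : nat, (l' <= l)%N -> r * 2 `^ (p * l'%:R) <= 2 `^ p.
Proof.
move=> p0 r0 r1.
have ex : exists l : nat, 1 <= r * 2 `^ (p * l%:R).
  exists (Num.truncn (2 / (p * r))).+1.
  rewrite mulrC -ler_pdivrMr// mul1r.
  have h : 2 / (p * r) < (Num.truncn (2 / (p * r))).+1%:R :> R.
    by rewrite truncnS_gt.
  set n := (Num.truncn (2 / (p * r))).+1 in h *.
  have pn0 : 0 <= p * n%:R :> R by rewrite mulr_ge0// ltW.
  apply: le_trans (powR2_ge_linear _ pn0).
  move: h; rewrite ltr_pdivrMr ?mulr_gt0// => h.
  suff : r^-1 <= p * n%:R / 2 by lra.
  rewrite -[leLHS]mul1r ler_pdivrMr//; lra.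
exists (ex_minn ex); case: ex_minnP => l l1 lmin; split=> // l' l'l.
have [|l'0] := posnP l'.
  move=> ->; rewrite mulr0 powRr0 mulr1; apply: le_trans r1 _.
  by have := powR2_ge_linear p (ltW p0); lra.
have -> : p * l'%:R = p + p * (l'.-1)%:R.
  by rewrite -{1}(prednK l'0) -natr1; ring.
rewrite powR2D mulrCA -[leRHS]mulr1 ler_pM2l ?powR2_gt0// leNgt; apply/negP => h.
by have := lmin _ (ltW h); rewrite leqNgt prednK// ?l'l// => /negP; apply; exact: l'l.
Qed.

(** Isolates the target rate [r^s]. On the levels in use the last base is at most [2^p], so for
    [s >= 2] its power of exponent [2 - s] is bounded below. *)
Lemma powR_base_split (p s r l : R) : 0 < r ->
  r ^+ 2 * 2 `^ (2 * p * l) = r `^ s * 2 `^ (s * p * l) * (r * 2 `^ (p * l)) `^ (2 - s).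
Proof.
move=> r0; rewrite powRM ?powR_ge0 ?(ltW r0)// -powRrM.
rewrite mulrACA -powR2D -powRD ?(gt_eqF r0) ?implybT//.
rewrite -powR_mulrn ?(ltW r0)//; congr (_ `^ _ * 2 `^ _); ring.
Qed.

Lemma exponent_lower (p s r l : R) : 0 < r -> 2 <= s -> r * 2 `^ (p * l) <= 2 `^ p ->
  2 `^ (- (p * (s - 2))) * (r `^ s * 2 `^ (s * p * l)) <= r ^+ 2 * 2 `^ (2 * p * l).
Proof.
move=> r0 s2 rl; rewrite (powR_base_split p s r l r0) [leLHS]mulrC.
rewrite ler_wpM2l ?mulr_ge0 ?powR_ge0//.
have -> : - (p * (s - 2)) = p * (2 - s) by ring.
rewrite powRrM (_ : 2 - s = - (s - 2)); last by ring.
rewrite !powRN lef_pV2 ?posrE ?powR_gt0 ?mulr_gt0 ?powR2_gt0//.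
apply: ge0_ler_powR; rewrite ?nnegrE ?mulr_ge0 ?powR_ge0 ?(ltW r0)//; lra.
Qed.

End PowersOfTwo.

Local Open Scope classical_set_scope.
Local Open Scope ring_scope.

(** * Transport cost and its measurability *)

Lemma ge0_integral_mrestr d (T : measurableType d) (R : realType)
    (nu : {measure set T -> \bar R}) (D : set T) (mD : measurable D)
    (f : T -> \bar R) :
  measurable_fun setT f -> (forall x, 0 <= f x)%E ->
  (\int[mrestr nu mD]_x f x = \int[nu]_(x in D) f x)%E.
Proof.
move=> mf f0; rewrite -(setUv D) ge0_integral_setU//=.
- rewrite [X in (_ + X)%E](_ : _ = 0%E) ?adde0.
    apply: eq_measure_integral => A mA AD.
    by rewrite -[in RHS](setIidl AD).
  rewrite (eq_measure_integral mzero) ?integral_measure_zero// => A mA AD.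
  transitivity (nu (A `&` D)) => //; rewrite (_ : A `&` D = set0) ?measure0//.
  by apply/seteqP; split => x // [/AD].
- exact: measurableC.
- exact: measurable_funTS.
- by rewrite disj_set2E setICr.
Qed.

Section Mixture.
Context d1 d2 (Y : measurableType d1) (Z : measurableType d2) (R : realType).
Context (nu : {measure set Y -> \bar R}) (U : finType) (c : U -> R).
Context (D : U -> set Y) (g : U -> Y -> Z).
Hypothesis c0 : forall u, 0 <= c u.
Hypothesis mD : forall u, measurable (D u).
Hypothesis mg : forall u, measurable_fun setT (g u).

(** The law is the sum of the images under [g u] of [nu] restricted to [D u], with weights [c u].
    The couplings constructed below have this form: [D u] is a fibre or a label class, and [g u]
    sets the second coordinate to a sample point. *)
Lemma mixture : (\sum_u (c u)%:E * nu (D u) = 1)%E ->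
  exists pi : probability Z R,
    (forall S, measurable S ->
       pi S = \sum_u (c u)%:E * nu (D u `&` g u @^-1` S))%E /\
    (forall f : Z -> \bar R, measurable_fun setT f -> (forall z, 0 <= f z)%E ->
       \int[pi]_z f z = \sum_u (c u)%:E * \int[nu]_(y in D u) f (g u y))%E.
Proof.
move=> sum1.
(* An element of [U] is the default value of [nth]; it exists because an empty sum is not 1. *)
have [u0 _] : exists u0 : U, true.
  apply/not_existsP => noU; move: sum1; rewrite big1; last by move=> u; case: (noU u).
  by move=> /eqP; rewrite eq_sym onee_eq0.
pose ix (k : nat) : U := nth u0 (enum U) k.
have sumE (F : U -> \bar R) : (\sum_(k < #|U|) F (ix k) = \sum_u F u)%E.
  rewrite -[RHS]big_enum /= (big_nth u0) big_mkord -cardE.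
  by [].
pose m0 (k : nat) : {measure set Z -> \bar R} :=
  mscale (NngNum (c0 (ix k))) (pushforward (mrestr nu (mD (ix k))) (g (ix k))).
pose m := m0 (fun k => mg (ix k)).
have mE S : msum m #|U| S = (\sum_u (c u)%:E * nu (D u `&` g u @^-1` S))%E.
  rewrite -[RHS]sumE /msum; apply: eq_bigr => k _.
  by rewrite /m /m0 /= /mscale /= /pushforward /mrestr setIC.
have m1 : msum m #|U| setT = 1%E.
  by rewrite mE -sum1; apply: eq_bigr => u _; rewrite preimage_setT setIT.
pose pi : probability Z R :=
  HB.pack (msum m #|U|) (Measure_isProbability.Build _ _ _ (msum m #|U|) m1).
exists pi; split; first by move=> S _; rewrite -mE.
move=> f mf f0; rewrite /pi /= ge0_integral_measure_sum// -[RHS]sumE.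
apply: eq_bigr => k _; rewrite ge0_integral_mscale//=; congr (_ * _)%E.
rewrite ge0_integral_pushforward//= preimage_setT ge0_integral_mrestr//.
exact: measurableT_comp.
Qed.

End Mixture.

(** Applied to indicators, this shows that the first marginal of a [mixture] is dominated by the law
    it should equal; [probability_le_eq] then concludes. *)
Lemma weighted_integral_le d (T : measurableType d) (R : realType)
    (nu : {measure set T -> \bar R}) (U : finType) (c : U -> R)
    (D : U -> set T) (f : T -> \bar R) :
  (forall u, 0 <= c u) -> (forall u, measurable (D u)) ->
  (forall z, \sum_u c u * \1_(D u) z <= 1) ->
  measurable_fun setT f -> (forall z, 0 <= f z)%E ->
  (\sum_u (c u)%:E * \int[nu]_(z in D u) f z <= \int[nu]_z f z)%E.
Proof.
move=> c0 mD cD1 mf f0.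
have mfD i : measurable_fun setT (fun z => (\1_(D i) z)%:E * f z)%E.
  apply: emeasurable_funM => //; apply/measurable_EFinP.
  exact: measurable_indic.
have fD0 i z : (0 <= (\1_(D i) z)%:E * f z)%E.
  by apply: mule_ge0 => //; rewrite lee_fin.
rewrite (_ : (\sum_u _)%E =
    (\int[nu]_z (\sum_u (c u)%:E * ((\1_(D u) z)%:E * f z)))%E); last first.
  rewrite ge0_integral_sum//; last 2 first.
  - by move=> i; apply: measurable_funeM.
  - by move=> i z _; apply: mule_ge0 => //; rewrite lee_fin.
  apply: eq_bigr => i _; rewrite ge0_integralZl//; last by rewrite lee_fin.
  congr (_ * _)%E; rewrite [LHS]integral_mkcond; apply: eq_integral => z _.
  by rewrite patchE indicE; case: ifP => _; rewrite ?mul1e ?mul0e.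
apply: ge0_le_integral => //.
- by move=> z _; apply: sume_ge0 => i _; apply: mule_ge0 => //; rewrite lee_fin.
- by apply: emeasurable_sum => i; apply: measurable_funeM.
- move=> z _; under eq_bigr do rewrite muleA.
  rewrite -ge0_sume_distrl; last by move=> i _; rewrite -EFinM lee_fin mulr_ge0.
  rewrite -[leRHS]mul1e; apply: lee_wpmul2r => //.
  under eq_bigr do rewrite -EFinM.
  by rewrite sumEFin lee_fin.
Qed.

(** Both total masses are 1, so domination on the complement of [A] is the reverse inequality on
    [A]. *)
Lemma probability_le_eq d d' (T : measurableType d) (T' : measurableType d')
    (R : realType) (mu : probability T R) (pi : probability T' R)
    (f : T' -> T) : measurable_fun setT f ->
  (forall A, measurable A -> pi (f @^-1` A) <= mu A)%E ->
  forall A, measurable A -> pi (f @^-1` A) = mu A.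
Proof.
move=> mf le1 A mA.
have mfA : measurable (f @^-1` A) by rewrite -[X in measurable X]setTI; exact: mf.
apply/eqP; rewrite eq_le le1//=.
have := le1 _ (measurableC mA); rewrite preimage_setC !probability_setC//.
rewrite -(fineK (fin_num_measure mu A mA)).
rewrite -(fineK (fin_num_measure pi _ mfA)) -!EFinB !lee_fin; lra.
Qed.

Section EuclideanSpace.
Context {R : realType} {d : nat}.
Implicit Types x y z : 'rV[R]_d.

Lemma continuous_measurable_Rd (f : 'rV[R]_d -> R) :
  continuous f -> measurable_fun setT (f : Rd R d -> R).
Proof.
move=> cf; apply: (measurability _ (RGenOpens.measurableE R)) => _ [_ [a [b ->] <-]].
rewrite setTI; apply: sub_sigma_algebra.
by apply: open_comp; [move=> ? _; exact: cf|exact: interval_open].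
Qed.

Lemma measurable_coord (i : 'I_d) :
  measurable_fun setT (fun x : Rd R d => (x : 'rV[R]_d) ord0 i).
Proof. by apply: continuous_measurable_Rd => x; exact: coord_continuous. Qed.

Lemma measurable_sup_norm :
  measurable_fun setT (fun x : Rd R d => `|x : 'rV[R]_d|).
Proof. by apply: continuous_measurable_Rd; exact: norm_continuous. Qed.

Lemma measurable_cost_coord (p : R) (dT : measure_display)
    (T : measurableType dT) (u : 'I_d -> T -> R) :
  (forall i, measurable_fun setT (u i)) ->
  measurable_fun setT
    (fun t => ((Num.sqrt (\sum_(i < d) (u i t) ^+ 2)) `^ p)%:E).
Proof.
move=> mu; apply/measurable_EFinP.
apply: (measurableT_comp (measurable_powR p)).
apply: (measurableT_comp (continuous_measurable_fun (@sqrt_continuous R))).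
by apply: measurable_sum => i; exact: measurable_funX.
Qed.

Lemma measurable_enorm_powR (p : R) :
  measurable_fun setT (fun x : Rd R d => ((enorm (x : 'rV[R]_d)) `^ p)%:E).
Proof. by apply: measurable_cost_coord; exact: measurable_coord. Qed.

Lemma measurable_cost (p : R) :
  measurable_fun setT (fun z : Rd R d * Rd R d =>
    ((enorm (z.1 - z.2 : 'rV[R]_d)) `^ p)%:E).
Proof.
rewrite /enorm.
apply: (@measurable_cost_coord p _ _ (fun i (z : Rd R d * Rd R d) =>
  (z.1 - z.2 : 'rV[R]_d) ord0 i)) => i.
rewrite (_ : (fun _ => _) = (fun z : Rd R d * Rd R d =>
  (z.1 : 'rV[R]_d) ord0 i - (z.2 : 'rV[R]_d) ord0 i)); last first.
  by apply/funext => z; rewrite !mxE.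
apply: measurable_funB.
  exact: (measurableT_comp (measurable_coord i) measurable_fst).
exact: (measurableT_comp (measurable_coord i) measurable_snd).
Qed.

Lemma measurable_costr (p : R) (y : 'rV[R]_d) :
  measurable_fun setT (fun x : Rd R d =>
    ((enorm (x - y : 'rV[R]_d)) `^ p)%:E).
Proof.
apply: (@measurable_cost_coord p _ _ (fun i (x : Rd R d) =>
  (x - y : 'rV[R]_d) ord0 i)) => i.
rewrite (_ : (fun _ => _) = (fun x : Rd R d =>
  (x : 'rV[R]_d) ord0 i - y ord0 i)); last first.
  by apply/funext => x; rewrite !mxE.
by apply: measurable_funB => //; exact: measurable_coord.
Qed.

Lemma enorm_ge0 x : 0 <= enorm x. Proof. exact: sqrtr_ge0. Qed.

Lemma enorm_sqr x : enorm x ^+ 2 = \sum_(i < d) (x ord0 i) ^+ 2.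
Proof. by rewrite sqr_sqrtr//; apply: sumr_ge0 => i _; exact: sqr_ge0. Qed.

Lemma coord_le_sup_norm x i : `|x ord0 i| <= `|x|.
Proof.
rewrite [leRHS]/Num.Def.normr/= mx_normrE.
by apply/bigmax_geP; right => /=; exists (ord0, i).
Qed.

Lemma coord_le_enorm x i : `|x ord0 i| <= enorm x.
Proof.
rewrite -sqrtr_sqr; apply: ler_wsqrtr; rewrite (bigD1 i)//= lerDl.
by apply: sumr_ge0 => j _; exact: sqr_ge0.
Qed.

Lemma sup_norm_le_enorm x : `|x| <= enorm x.
Proof.
rewrite [leLHS]/Num.Def.normr/= mx_normrE.
apply: bigmax_le => [|[i j] _ /=]; first exact: enorm_ge0.
by rewrite (ord1 i); exact: coord_le_enorm.
Qed.

Lemma enorm_le_coord x (r : R) : 0 <= r -> (forall i, `|x ord0 i| <= r) ->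
  enorm x <= Num.sqrt d%:R * r.
Proof.
move=> r0 xr; rewrite -[X in _ * X]ger0_norm// -sqrtr_sqr -sqrtrM//.
apply: ler_wsqrtr; rewrite mulr_natl -[X in _ *+ X]card_ord -sumr_const.
by apply: ler_sum => i _; rewrite -real_normK ?num_real// lerXn2r ?nnegrE.
Qed.

End EuclideanSpace.

(** Squares are compared first, by [|u + v|^2 <= (1 + th) |u|^2 + (1 + 1/th) |v|^2], so all [p > 0]
    are treated alike. The error [th^2] is absorbed into the factor when [|y - x|^2 >= th], and into
    the additive [eta] otherwise. *)
Lemma enorm_perturbation (R : realType) (d : nat) (p eta : R) :
  0 < p -> 0 < eta -> exists2 h : R, 0 < h &
  forall x x' y : 'rV[R]_d, (forall i, `|x ord0 i - x' ord0 i| <= h) ->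
    enorm (y - x') `^ p <= (1 + eta) * enorm (y - x) `^ p + eta.
Proof.
move=> p0 eta0.
have p20 : 0 < 2 / p by rewrite divr_gt0.
(* The three entries give [1 + 2 th <= (1 + eta)^(2/p)], [3 th <= eta^(2/p)] and [th <= 1]. *)
pose th := Num.min (((1 + eta) `^ (2 / p) - 1) / 2) (Num.min (eta `^ (2 / p) / 3) 1).
have e1 : 1 < (1 + eta) `^ (2 / p).
  apply: (@le_lt_trans _ _ (1 `^ (2 / p))); first by rewrite powR1.
  by apply: gt0_ltr_powR; rewrite ?nnegrE; lra.
have e2 : 0 < eta `^ (2 / p) by exact: powR_gt0.
have th0 : 0 < th by rewrite /th !lt_min ltr01 !divr_gt0 ?subr_gt0.
have th1 : th <= 1 by rewrite /th !ge_min lexx !orbT.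
have th2 : 1 + 2 * th <= (1 + eta) `^ (2 / p).
  have : th <= ((1 + eta) `^ (2 / p) - 1) / 2 by rewrite /th ge_min lexx.
  lra.
have th3 : 3 * th <= eta `^ (2 / p).
  have : th <= eta `^ (2 / p) / 3 by rewrite /th !ge_min lexx orbT.
  lra.
have d0 : 0 < 2 * (d.+1)%:R :> R by rewrite mulr_gt0.
have powE (z : 'rV[R]_d) : enorm z `^ p = (enorm z ^+ 2) `^ (p / 2).
  rewrite -(powR_mulrn 2 (enorm_ge0 z)) -powRrM; congr (_ `^ _); lra.
have powK (r : R) : 0 <= r -> (r `^ (2 / p)) `^ (p / 2) = r.
  move=> r0; rewrite -powRrM (_ : 2 / p * (p / 2) = 1) ?powRr1//.
  by field; rewrite gt_eqF.
have mono (u v : R) : 0 <= u -> u <= v -> u `^ (p / 2) <= v `^ (p / 2).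
  move=> u0 uv; apply: ge0_ler_powR; rewrite ?nnegrE//; first lra.
  exact: le_trans uv.
have h0 : 0 < th ^+ 3 / (2 * d.+1%:R) by rewrite divr_gt0// exprn_gt0.
exists (Num.sqrt (th ^+ 3 / (2 * d.+1%:R))); first by rewrite sqrtr_gt0.
move=> x x' y xx'.
have v2 : enorm (x - x') ^+ 2 <= th ^+ 3 / 2.
  rewrite enorm_sqr; apply: (@le_trans _ _ (\sum_(i < d) th ^+ 3 / (2 * d.+1%:R))).
    apply: ler_sum => i _; rewrite !mxE -(sqr_sqrtr (ltW h0)).
    by rewrite -[leLHS](real_normK (num_real _)); apply: lerXn2r; rewrite ?nnegrE ?sqrtr_ge0.
  rewrite sumr_const card_ord -[leLHS]mulr_natl.
  have -> : d%:R * (th ^+ 3 / (2 * d.+1%:R)) = th ^+ 3 / 2 * (d%:R / d.+1%:R).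
    by field.
  rewrite -[leRHS]mulr1 ler_wpM2l//; first by rewrite ltW// divr_gt0// exprn_gt0.
  by rewrite ler_pdivrMr// mul1r ler_nat.
pose t := enorm (y - x) ^+ 2.
have t0 : 0 <= t by exact: sqr_ge0.
have yx' : enorm (y - x') ^+ 2 <= (1 + th) * t + th ^+ 2.
  apply: (@le_trans _ _ ((1 + th) * t + (1 + th^-1) * enorm (x - x') ^+ 2)).
    rewrite /t !enorm_sqr !mulr_sumr -big_split /=; apply: ler_sum => i _.
    rewrite !mxE; set u := y ord0 i - x ord0 i; set v := x ord0 i - x' ord0 i.
    have -> : y ord0 i - x' ord0 i = u + v by rewrite /u /v; ring.
    rewrite -subr_ge0.
    have -> : (1 + th) * u ^+ 2 + (1 + th^-1) * v ^+ 2 - (u + v) ^+ 2 =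
       th * (u - v / th) ^+ 2 by field; rewrite gt_eqF.
    by rewrite mulr_ge0 ?sqr_ge0// ltW.
  rewrite lerD2l; apply: (@le_trans _ _ ((1 + th^-1) * (th ^+ 3 / 2))).
    by rewrite ler_wpM2l// addr_ge0// invr_ge0 ltW.
  have -> : (1 + th^-1) * (th ^+ 3 / 2) = (th + 1) / 2 * th ^+ 2.
    by field; rewrite gt_eqF.
  have := sqr_ge0 th; nra.
rewrite !powE -/t; have [tht|tht] := leP th t.
  apply: (@le_trans _ _ (((1 + eta) `^ (2 / p) * t) `^ (p / 2))); last first.
    rewrite powRM ?powR_ge0// powK ?lerDl ?ltW//; lra.
  by apply: mono; [exact: sqr_ge0|apply: (le_trans yx'); nra].
apply: (@le_trans _ _ ((eta `^ (2 / p)) `^ (p / 2))).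
  by apply: mono; [exact: sqr_ge0|apply: (le_trans yx'); nra].
rewrite (powK _ (ltW eta0)) lerDr mulr_ge0 ?powR_ge0//; lra.
Qed.

Section Empirical.
Context {R : realType} {d : nat}.

Lemma empiricalE (N : nat) (x : nat -> Rd R d) (A : set (Rd R d)) :
  (empirical N x : {measure set (Rd R d) -> \bar R}) A =
    (N%:R^-1 * \sum_(k < N) (x k \in A)%:R)%:E.
Proof.
rewrite /empirical /mscale /= /msum EFinM; congr (_ * _)%E.
by rewrite -sumEFin; apply: eq_bigr.
Qed.

Lemma measurable_point (x : Rd R d) : measurable [set x].
Proof.
rewrite -[X in measurable X]setCK; apply: measurableC.
by apply: sub_sigma_algebra; rewrite openC; exact/accessible_closed_set1/hausdorff_accessible/norm_hausdorff.
Qed.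

(* The mass of [pi] on the fibre over an atom [x i] is divided equally among the
   indices [j] with [x j = x i] before being moved to the [x' j]. *)
Lemma transport_cost_perturbation (mu : probability (Rd R d) R) (p eta a : R)
    (N : nat) (x x' : nat -> Rd R d) : (0 < N)%N -> 0 <= eta ->
  (forall (i : 'I_N) (y : 'rV[R]_d),
     enorm (y - x' i : 'rV[R]_d) `^ p <=
       (1 + eta) * enorm (y - x i : 'rV[R]_d) `^ p + eta) ->
  (transport_cost p mu (empirical N x) < a%:E ->
   transport_cost p mu (empirical N x') <= ((1 + eta) * a + eta)%:E)%E.
Proof.
move=> N0 eta0 xx' /ereal_inf_lt[_ [pi cpi <-] pia].
have NR : 0 < N%:R :> R by rewrite ltr0n.
pose mult (i : 'I_N) : R := \sum_(j < N) (x j == x i)%:R.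
have mult0 i : 0 < mult i.
  by rewrite /mult (bigD1 i)//= eqxx ltr_pwDl// sumr_ge0.
pose c i : R := (mult i)^-1.
have c0 i : 0 <= c i by rewrite invr_ge0 ltW.
pose D (i : 'I_N) : set (Rd R d * Rd R d)%type := snd @^-1` [set x i].
have mD i : measurable (D i).
  by rewrite -[D i]setTI; apply: measurable_snd => //; exact: measurable_point.
pose g (i : 'I_N) (z : (Rd R d * Rd R d)%type) : (Rd R d * Rd R d)%type :=
  (z.1, x' i).
have mg i : measurable_fun setT (g i).
  by apply: measurable_fun_pair; [exact: measurable_fst|exact: measurable_cst].
have piD i : ((c i)%:E * pi (D i) = (N%:R^-1)%:E)%E.
  have [_ ] := cpi _ (measurable_point (x i)); rewrite /pushforward => ->.
  rewrite empiricalE -EFinM; congr EFin.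
  rewrite (eq_bigr (fun j : 'I_N => (x j == x i)%:R)); last first.
    by move=> j _; congr (_ %:R); congr nat_of_bool; apply/idP/eqP; rewrite inE.
  by rewrite mulrCA mulVf ?mulr1// gt_eqF.
have sum1 : (\sum_i (c i)%:E * pi (D i) = 1)%E.
  under eq_bigr do rewrite piD.
  by rewrite sumEFin sumr_const card_ord -[X in X%:E]mulr_natr mulVf// gt_eqF.
have cD1 z : \sum_i c i * \1_(D i) z <= 1 :> R.
  have [[k zk]|nz] := pselect (exists k : 'I_N, z.2 = x k); last first.
    rewrite big1// => i _; rewrite indicE memNset ?mulr0// => zi.
    by apply: nz; exists i.
  rewrite (eq_bigr (fun i : 'I_N => (x i == x k)%:R * c k)); last first.
    move=> i _; rewrite indicE; have [ik|ik] := eqVneq (x i) (x k).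
      by rewrite mem_set /D /= ?ik// mulr1 mul1r /c /mult ik.
    rewrite memNset ?mulr0 ?mul0r// /D /= zk => ki; move: ik.
    by rewrite ki eqxx.
  by rewrite -mulr_suml -/(mult k) /c mulfV// gt_eqF.
have cDf f := weighted_integral_le _ _ R pi _ c D f c0 mD cD1.
have [pi' [pi'E pi'I]] := mixture _ _ _ _ R pi _ c D g c0 mD mg sum1.
have le1 A : measurable A -> (pi' (fst @^-1` A) <= mu A)%E.
  move=> mA; have mfA : measurable (fst @^-1` A : set (Rd R d * Rd R d)%type).
    by rewrite -[X in measurable X]setTI; exact: measurable_fst.
  have [<- _] := cpi A mA; rewrite /pushforward pi'E//.
  have m1 : measurable_fun setT (fun z : Rd R d * Rd R d =>
      (\1_(fst @^-1` A) z)%:E : \bar R).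
    by apply/measurable_EFinP; exact: measurable_indic.
  have := cDf (fun z : Rd R d * Rd R d => (\1_(fst @^-1` A) z)%:E) m1 (fun z => _); rewrite integral_indic// setIT => h.
  apply: le_trans (h _); last by move=> z; rewrite lee_fin.
  apply: lee_sum => i _; apply: lee_wpmul2l; first by rewrite lee_fin.
  by rewrite integral_indic// setIC.
have cpi' : coupling mu (empirical N x') pi'.
  move=> A mA.
  have mfA : measurable (fst @^-1` A : set (Rd R d * Rd R d)%type).
    by rewrite -[X in measurable X]setTI; exact: measurable_fst.
  split; last first.
    rewrite /pushforward pi'E; last first.
      by rewrite -[X in measurable X]setTI; exact: measurable_snd.
    rewrite empiricalE mulr_sumr -sumEFin; apply: eq_bigr => i _.
    rewrite EFinM -(piD i); have [xA|xA] := boolP (x' i \in A).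
      have -> : D i `&` g i @^-1` (snd @^-1` A) = D i; last by rewrite mule1.
      by apply/seteqP; split => [z []//|z Dz]; split => //=; rewrite inE in xA.
    have -> : D i `&` g i @^-1` (snd @^-1` A) = set0; last by rewrite measure0 !mule0.
    by apply/seteqP; split => z // -[_ /= zA]; rewrite notin_setE in xA.
  exact: (probability_le_eq _ _ _ _ R mu pi' fst measurable_fst le1).
apply: (@le_trans _ _ (\int[pi']_z ((enorm (z.1 - z.2 : 'rV[R]_d)) `^ p)%:E)%E).
  by apply: ereal_inf_lbound; exists pi'.
rewrite pi'I; last 2 first.
- exact: measurable_cost.
- by move=> z; rewrite lee_fin powR_ge0.
have mc := @measurable_cost R d p.
have mc' : measurable_fun setT (fun z : Rd R d * Rd R d =>
    (1 + eta)%:E * ((enorm (z.1 - z.2 : 'rV[R]_d)) `^ p)%:E + eta%:E)%E.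
  by apply: emeasurable_funD => //; exact: measurable_funeM.
have c'0 z : (0 <= (1 + eta)%:E * ((enorm (z.1 - z.2 : 'rV[R]_d)) `^ p)%:E + eta%:E)%E.
  by rewrite -EFinM -EFinD lee_fin addr_ge0// mulr_ge0 ?powR_ge0//; lra.
apply: (@le_trans _ _ (\int[pi]_z
  ((1 + eta)%:E * ((enorm (z.1 - z.2 : 'rV[R]_d)) `^ p)%:E + eta%:E))%E).
  apply: le_trans (weighted_integral_le _ _ R pi _ c D _ c0 mD cD1 mc' c'0); apply: lee_sum => i _.
  apply: lee_wpmul2l; first by rewrite lee_fin.
  apply: ge0_le_integral; first exact: mD.
  - by move=> z _; rewrite lee_fin powR_ge0.
  - apply: measurable_funTS.
    exact: (measurableT_comp (measurable_costr p (x' i)) measurable_fst).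
  - exact: measurable_funTS.
  - by move=> z Dz; rewrite -EFinM -EFinD lee_fin /= Dz; exact: xx'.
rewrite ge0_integralD//; last 2 first.
- by move=> z _; rewrite -EFinM lee_fin mulr_ge0 ?powR_ge0//; lra.
- exact: measurable_funeM.
rewrite ge0_integralZl//; last 2 first.
- by move=> z _; rewrite lee_fin powR_ge0.
- by rewrite lee_fin; lra.
rewrite integral_cst// [X in (_ + _ * X)%E](@probability_setT _ _ _ pi) mule1.
have -> : ((1 + eta) * a + eta)%:E = ((1 + eta)%:E * a%:E + eta%:E)%E by [].
rewrite leeD2r//.
by apply: lee_wpmul2l; [rewrite lee_fin; lra|exact: ltW].
Qed.

End Empirical.

(* [transport_cost] is continuous in the sample, so its superlevel sets are
   countable unions of cylinders around samples with coordinates in a grid. *)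
Lemma measurable_transport_cost (R : realType) (d : nat) (p a : R)
    (mu : probability (Rd R d) R) (dO : measure_display)
    (Omega : measurableType dO) (N : nat) (X : nat -> Omega -> Rd R d) :
  0 < p -> 0 <= a -> (0 < N)%N -> (forall i, measurable_fun setT (X i)) ->
  measurable [set w | (a%:E <
    transport_cost p mu (empirical N (fun i => X i w)))%E].
Proof.
move=> p0 a0 N0 mX.
pose eta (k : nat) : R := k.+1%:R^-1.
have eta0 k : 0 < eta k by rewrite invr_gt0.
have /choice[h hP] : forall k, exists h : R, 0 < h /\
    forall x x' y : 'rV[R]_d, (forall i, `|x ord0 i - x' ord0 i| <= h) ->
      enorm (y - x') `^ p <= (1 + eta k) * enorm (y - x) `^ p + eta k.
  by move=> k; have [h ? ?] := enorm_perturbation R d p (eta k) p0 (eta0 k); exists h.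
pose G (k : nat) (g : {ffun 'I_N -> {ffun 'I_d -> int}}) : nat -> Rd R d :=
  fun i => if insub i is Some j then \row_e (h k * (g j e)%:~R) else 0.
have GE k g (i : 'I_N) : G k g i = \row_e (h k * (g i e)%:~R).
  by rewrite /G insubT//= => iN; congr (\row_e _); apply/funext => e; congr (_ * (g _ _)%:~R); apply: val_inj.
(* If the cost at the sample is at most [a], hence below [a + eta k], its value at a grid neighbour
   is at most [b k]. A neighbour with cost above [b k] thus certifies the event. *)
pose b k := (1 + eta k) * (a + eta k) + eta k.
pose C k (g : {ffun 'I_N -> {ffun 'I_d -> int}}) (i : 'I_N) (e : 'I_d) : set Omega :=
  [set w | `|(X i w : 'rV[R]_d) ord0 e - h k * (g i e)%:~R| <= h k].
have mC k g i e : measurable (C k g i e).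
  rewrite -[X in measurable X]setTI.
  apply: measurable_fun_le => //.
  apply: (measurableT_comp (@normr_measurable R setT)).
  apply: measurable_funB => //.
  exact: (measurableT_comp (measurable_coord e) (mX i)).
have close k g w : (forall i e, C k g i e w) ->
  (forall (i : 'I_N) (y : 'rV[R]_d),
     enorm (y - G k g i : 'rV[R]_d) `^ p <=
       (1 + eta k) * enorm (y - X i w : 'rV[R]_d) `^ p + eta k) /\
  (forall (i : 'I_N) (y : 'rV[R]_d),
     enorm (y - X i w : 'rV[R]_d) `^ p <=
       (1 + eta k) * enorm (y - G k g i : 'rV[R]_d) `^ p + eta k).
  move=> Cw; split=> i y; apply: (hP k).2 => e; rewrite GE !mxE; first exact: Cw.
  by rewrite distrC; exact: Cw.
rewrite (_ : [set w | _] = \bigcup_k \bigcup_(g : {ffun 'I_N -> {ffun 'I_d -> int}})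
   (if ((b k)%:E < transport_cost p mu (empirical N (G k g)))%E then
     \bigcap_(i : 'I_N) \bigcap_(e : 'I_d) C k g i e else set0)); last first.
  apply/seteqP; split => w /=; last first.
    move=> [k _ [g _]]; case: ifP => // bk Cw.
    have [c1 _] := close k g w (fun i e => Cw i Logic.I e Logic.I).
    rewrite ltNge; apply/negP => Ta; move: bk; apply/negP; rewrite -leNgt.
    apply: transport_cost_perturbation c1 _ => //; first exact: ltW.
    by apply: le_lt_trans Ta _; rewrite lte_fin ltrDl.
  move=> aT.
  have [y ay yT] : exists2 y : R, a < y & (y%:E <= transport_cost p mu
      (empirical N (fun i => X i w)))%E.
    case: (transport_cost _ _ _) aT => [r ar|_|//]; first by exists r.
    by exists (a + 1); [rewrite ltrDl|rewrite leey].
  have [k yk] : exists k, (1 + eta k) * (b k + eta k) + eta k < y.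
    (* For [eta k <= 1] the perturbation applied twice exceeds [a] by at most [(9 + 3 a) eta k];
       [10 + 5 a] dominates this coefficient. *)
    have y0 : 0 < (y - a) / (10 + 5 * a) by apply: divr_gt0; lra.
    have [k _ /(_ k (leqnn k)) /= kP] := near_infty_natSinv_lt (PosNum y0).
    exists k; move: kP; rewrite -/(eta k) ltr_pdivlMr; last lra.
    have e1 : eta k <= 1 by rewrite /eta invf_le1// ler1n.
    have := eta0 k; rewrite /b; set e := eta k in e1 * => e0 ey.
    have : 0 <= a * e by rewrite mulr_ge0// ltW.
    have : a * e * e <= a * e by rewrite ler_piMr// mulr_ge0// ltW.
    have : e * e <= e by rewrite ler_piMr// ltW.
    have : e * e * e <= e * e by rewrite ler_piMr// mulr_ge0// ltW.
    nra.
  exists k => //.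
  pose g : {ffun 'I_N -> {ffun 'I_d -> int}} :=
    [ffun i : 'I_N => [ffun e : 'I_d => Num.floor ((X i w : 'rV[R]_d) ord0 e / h k)]].
  have Cw i e : C k g i e w.
    rewrite /C /= !ffunE; set u := (X i w : 'rV[R]_d) ord0 e.
    have hk := (hP k).1.
    have := Num.Theory.floor_itv (u / h k) => /andP[].
    rewrite ler_pdivlMr// ltr_pdivrMr// intrD mulrDl mul1r mulrC => h1 h2.
    by rewrite ger0_norm; lra.
  exists g => //; case: ifPn => [_ i _ e _|]; first exact: Cw.
  rewrite -leNgt => Tb; exfalso; have [_ c2] := close k g w Cw.
  have := transport_cost_perturbation mu p (eta k) (b k + eta k) N (G k g) (fun i => X i w) N0 (ltW (eta0 k)) c2.
  move=> /(_ (le_lt_trans Tb _)); rewrite lte_fin ltrDl => /(_ (eta0 k)) T2.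
  have := le_trans yT T2; rewrite lee_fin; lra.
apply: bigcupT_measurable => k; apply: countable_bigcupT_measurable.
  exact: countableP.
move=> g; case: ifP => // _.
apply: fin_bigcap_measurable => // i _.
by apply: fin_bigcap_measurable => // e _; exact: mC.
Qed.

Lemma measure_bigsetU_le d (T : measurableType d) (R : realType)
    (mu : {measure set T -> \bar R}) (I : Type) (r : seq I) (D : pred I)
    (F : I -> set T) : (forall i, measurable (F i)) ->
  (mu (\big[setU/set0]_(i <- r | D i) F i) <= \sum_(i <- r | D i) mu (F i))%E.
Proof.
move=> mF; elim: r => [|i r IH]; first by rewrite !big_nil measure0.
rewrite !big_cons; case: (D i) => //.
apply: le_trans (measureU2 _ (mF i) _) _; first exact: bigsetU_measurable.
by rewrite leeD2l.
Qed.

(** * Transport cost through a finite labelling *)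

Section Labels.
Context {R : realType} {d : nat} {I : finType}.
Variables (mu : probability (Rd R d) R) (lab : Rd R d -> I).
Hypothesis mlab : forall i, measurable (lab @^-1` [set i]).

Definition label_mass (i : I) : R := fine (mu (lab @^-1` [set i])).

Lemma label_massE i : (label_mass i)%:E = mu (lab @^-1` [set i]).
Proof. by rewrite fineK// fin_num_measure. Qed.

Lemma label_mass_ge0 i : 0 <= label_mass i.
Proof. by rewrite fine_ge0. Qed.

Lemma sum_label_mass : \sum_i label_mass i = 1.
Proof.
apply: EFin_inj; rewrite -sumEFin.
under eq_bigr do rewrite label_massE.
rewrite fsbig_seq ?index_enum_uniq// -measure_fin_bigcup//.
- rewrite -[RHS](probability_setT mu); congr (mu _).
  by apply/seteqP; split => // y _; exists (lab y) => //=; rewrite mem_index_enum.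
- by move=> i j _ _ [y [/= <- <-]].
Qed.

(** The event is a finite union over the label words in [S]. Independence factors the probability of
    each word, and subadditivity is all that an upper bound demands. *)
Lemma iid_product_law (dO : measure_display) (Omega : measurableType dO)
    (P : probability Omega R) (X : nat -> {RV P >-> Rd R d}) (N : nat)
    (S : {pred {ffun 'I_N -> I}}) : iid_law mu X ->
  let E := [set w | [ffun k : 'I_N => lab (X k w)] \in S] in
  measurable E /\ (P E <= (product_law N label_mass S)%:E)%E.
Proof.
move=> [law indep] E.
pose A (t : {ffun 'I_N -> I}) (k : nat) : set (Rd R d) :=
  if insub k is Some j then lab @^-1` [set t j] else setT.
have AE t (k : 'I_N) : A t k = lab @^-1` [set t k].
  by rewrite /A insubT//= => kN; congr (_ @^-1` [set t _]); apply: val_inj.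
have mA t k : measurable (A t k) by rewrite /A; case: insubP.
pose F t : set Omega := \bigcap_(k in [set` iota 0 N]) (X k @^-1` A t k).
have mF t : measurable (F t).
  apply: bigcap_measurableType => k _.
  by rewrite -[X in measurable X]setTI; exact: measurable_funPT.
have PF t : (P (F t) = (\prod_k label_mass (t k))%:E)%E.
  rewrite /F (indep _ _ (iota_uniq 0 N) (mA t)).
  rewrite (big_morph EFin (@EFinM R) (erefl : 1%:E = 1%E)).
  transitivity (\prod_(0 <= k < N) P (X k @^-1` A t k))%E.
    by rewrite /index_iota subn0.
  rewrite big_mkord; apply: eq_bigr => k _.
  by rewrite label_massE -(law k)// AE.
have EF : E = \big[setU/set0]_(t | t \in S) F t.
  apply/seteqP; split => w.
    move=> Sw; rewrite -bigcup_seq_cond.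
    exists [ffun k : 'I_N => lab (X k w)].
      by rewrite /= mem_index_enum.
    move=> k /=; rewrite mem_iota add0n => /andP[_ kN].
    by rewrite /preimage /= -[k]/(nat_of_ord (Ordinal kN)) AE /= ffunE.
  rewrite -bigcup_seq_cond => -[t /= /andP[_ tS] Ft].
  rewrite /E /= (_ : [ffun k => _] = t)//.
  apply/ffunP => k; rewrite ffunE.
  have := Ft k; rewrite /= mem_iota add0n ltn_ord => /(_ isT).
  by rewrite /preimage /= AE.
split; first by rewrite EF; exact: bigsetU_measurable.
rewrite EF; apply: le_trans (measure_bigsetU_le _ _ _ _ _ _ _ _ mF) _.
by rewrite /product_law -sumEFin; apply: lee_sum => t _; rewrite -PF.
Qed.

Lemma label_integral_le (g : I -> R) (f : Rd R d -> \bar R) :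
  (forall i, 0 <= g i) -> measurable_fun setT f -> (forall y, 0 <= f y)%E ->
  (forall y, (g (lab y))%:E <= f y)%E ->
  ((\sum_i label_mass i * g i)%:E <= \int[mu]_y f y)%E.
Proof.
move=> g0 mf f0 gf.
apply: le_trans (weighted_integral_le _ _ R mu _ (fun _ => 1)
  (fun i => lab @^-1` [set i]) f (fun=> ler01) mlab _ mf f0).
  rewrite -sumEFin; apply: lee_sum => i _; rewrite mul1e EFinM label_massE muleC.
  rewrite -integral_cst//; apply: ge0_le_integral => //.
  - by move=> y _; rewrite lee_fin.
  - exact: measurable_funTS.
  - by move=> y /= <-; exact: gf.
move=> y; under eq_bigr do rewrite mul1r indicE.
rewrite (bigD1 (lab y))//= mem_set// big1 ?addr0// => i /eqP iy.
by rewrite memNset//= => /esym.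
Qed.

(* Only the masses of pairs of label classes are prescribed: within a class the
   coupling is a product. *)
Lemma transport_cost_label_le (p : R) (N : nat) (x : nat -> Rd R d)
    (b : I -> R) (w D : I -> I -> R) (f : Rd R d -> R) : (0 < N)%N ->
  (forall j, b j = N%:R^-1 * \sum_(k < N) (lab (x k) == j)%:R) ->
  (forall i j, 0 <= w i j) -> (forall i, \sum_j w i j = label_mass i) ->
  (forall j, \sum_i w i j = b j) ->
  (forall i j, 0 <= D i j) -> measurable_fun setT f -> (forall y, 0 <= f y) ->
  (forall y (k : 'I_N), enorm ((y : 'rV[R]_d) - x k) `^ p <=
     D (lab y) (lab (x k)) + f y) ->
  (transport_cost p mu (empirical N x) <=
     (\sum_i \sum_j w i j * D i j)%:E + \int[mu]_y (f y)%:E)%E.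
Proof.
move=> N0 bE w0 wa wb D0 mf f0 costD.
have NR : 0 < N%:R :> R by rewrite ltr0n.
pose t (k : 'I_N) := lab (x k).
have bt k : 0 < b (t k).
  rewrite bE mulr_gt0 ?invr_gt0// (bigD1 k)//= eqxx ltr_pwDl//.
  exact: sumr_ge0.
have bN j : \sum_k (t k == j)%:R = N%:R * b j.
  by rewrite bE mulrA divff ?mul1r// gt_eqF.
have b0 j : 0 <= b j by rewrite -wb; apply: sumr_ge0.
have wb0 i j : b j = 0 -> w i j = 0.
  move=> bj; have := wb j; rewrite bj => /eqP.
  by rewrite psumr_eq0// => /allP/(_ i (mem_index_enum i))/eqP.
have wa0 i j : label_mass i = 0 -> w i j = 0.
  move=> ai; have := wa i; rewrite ai => /eqP.
  by rewrite psumr_eq0// => /allP/(_ j (mem_index_enum j))/eqP.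
(* The mass sent from class [i] to the sample point [k]: the points labelled [j] number [N b j] and
   share [w i j] equally. *)
pose om i k := w i (t k) / (b (t k) * N%:R).
have om0 i k : 0 <= om i k by rewrite divr_ge0// mulr_ge0// ltW.
have sum_om i (F : I -> R) : \sum_k om i k * F (t k) = \sum_j w i j * F j.
  rewrite (eq_bigr (fun k => \sum_j (t k == j)%:R * (w i j / (b j * N%:R) * F j))).
    rewrite exchange_big /=; apply: eq_bigr => j _.
    rewrite -mulr_suml bN; have [bj|bj] := eqVneq (b j) 0.
      by rewrite bj (wb0 i j bj) !(mul0r, mulr0).
    by field; rewrite bj gt_eqF.
  move=> k _; rewrite (bigD1 (t k))//= eqxx mul1r big1 ?addr0// => j.
  by rewrite eq_sym => /negbTE ->; rewrite mul0r.
have om_col k : \sum_i om i k = N%:R^-1.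
  by rewrite -mulr_suml wb; field; rewrite !gt_eqF.
pose c (u : I * 'I_N) : R := om u.1 u.2 / label_mass u.1.
have c0 u : 0 <= c u by rewrite divr_ge0// label_mass_ge0.
pose Dm (u : I * 'I_N) : set (Rd R d) := lab @^-1` [set u.1].
have mDm u : measurable (Dm u) by exact: mlab.
have ca i k : c (i, k) * label_mass i = om i k.
  rewrite /c /=; have [ai|ai] := eqVneq (label_mass i) 0.
    by rewrite ai mulr0 /om (wa0 _ _ ai) mul0r.
  by rewrite mulfVK.
pose g (u : I * 'I_N) (y : Rd R d) : (Rd R d * Rd R d)%type := (y, x u.2).
have mg u : measurable_fun setT (g u).
  by apply: measurable_fun_pair => //; exact: measurable_cst.
have sum_pair (F : I -> 'I_N -> \bar R) :
    (\sum_(u : I * 'I_N) F u.1 u.2 = \sum_i \sum_k F i k)%E.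
  by rewrite pair_big.
have cmu u : ((c u)%:E * mu (Dm u) = (om u.1 u.2)%:E)%E.
  by case: u => i k; rewrite /Dm /= -label_massE -EFinM ca.
have sum1 : (\sum_u (c u)%:E * mu (Dm u) = 1)%E.
  under eq_bigr do rewrite cmu.
  rewrite sumEFin -(pair_big predT predT (fun i k => om i k)) /= exchange_big /=.
  under eq_bigr do rewrite om_col.
  by rewrite sumr_const card_ord -[X in X%:E]mulr_natr mulVf// gt_eqF.
have cD1 y : \sum_u c u * \1_(Dm u) y <= 1 :> R.
  rewrite -(pair_big predT predT (fun i k => c (i, k) * \1_(Dm (i, k)) y)) /=.
  rewrite (bigD1 (lab y))//= [X in _ + X]big1 ?addr0; last first.
    move=> i iy; rewrite big1// => k _; rewrite indicE memNset ?mulr0//.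
    by rewrite /Dm /= => yi; move: iy; rewrite yi eqxx.
  under eq_bigr do rewrite indicE mem_set// mulr1 /c /=.
  rewrite -mulr_suml; have := sum_om (lab y) (fun=> 1).
  under eq_bigr do rewrite mulr1.
  under [X in _ = X -> _]eq_bigr do rewrite mulr1.
  rewrite wa => ->; have [->|ay] := eqVneq (label_mass (lab y)) 0.
    by rewrite mul0r.
  by rewrite divff.
have [pi [piE piI]] := mixture _ _ _ _ R mu _ c Dm g c0 mDm mg sum1.
have le1 A : measurable A -> (pi (fst @^-1` A) <= mu A)%E.
  move=> mA; have mfA : measurable (fst @^-1` A : set (Rd R d * Rd R d)%type).
    by rewrite -[X in measurable X]setTI; exact: measurable_fst.
  have m1 : measurable_fun setT (fun y : Rd R d => (\1_A y)%:E : \bar R).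
    by apply/measurable_EFinP; exact: measurable_indic.
  have := weighted_integral_le _ _ R mu _ c Dm _ c0 mDm cD1 m1 (fun z => _).
  rewrite integral_indic// setIT piE// => h.
  apply: le_trans (h _); last by move=> z; rewrite lee_fin.
  apply: lee_sum => u _; apply: lee_wpmul2l; first by rewrite lee_fin.
  by rewrite integral_indic// setIC.
have cpi : coupling mu (empirical N x) pi.
  move=> A mA; split.
    exact: (probability_le_eq _ _ _ _ R mu pi fst measurable_fst le1).
  rewrite /pushforward piE; last first.
    by rewrite -[X in measurable X]setTI; exact: measurable_snd.
  rewrite empiricalE mulr_sumr.
  under [in RHS]eq_bigr => k _ do rewrite -(om_col k) mulr_suml.
  rewrite exchange_big pair_big -sumEFin; apply: eq_bigr => -[i k] _ /=.
  rewrite [RHS]EFinM -(cmu (i, k)); have [xA|xA] := boolP (x k \in A).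
    have -> : Dm (i, k) `&` g (i, k) @^-1` (snd @^-1` A) = Dm (i, k); last by rewrite mule1.
    by apply/seteqP; split => [z []//|z Dz]; split => //=; rewrite inE in xA.
  have -> : Dm (i, k) `&` g (i, k) @^-1` (snd @^-1` A) = set0; last by rewrite measure0 !mule0.
  by apply/seteqP; split => z // -[_ /= zA]; rewrite notin_setE in xA.
apply: (@le_trans _ _ (\int[pi]_z ((enorm (z.1 - z.2 : 'rV[R]_d)) `^ p)%:E)%E).
  by apply: ereal_inf_lbound; exists pi.
rewrite piI; last 2 first.
- exact: measurable_cost.
- by move=> z; rewrite lee_fin powR_ge0.
have mfE : measurable_fun setT (fun y => (f y)%:E) by exact/measurable_EFinP.
have fE0 y : (0 <= (f y)%:E)%E by rewrite lee_fin.
apply: le_trans (leeD (lexx _)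
  (weighted_integral_le _ _ R mu _ c Dm _ c0 mDm cD1 mfE fE0)).
have -> : \sum_i \sum_j w i j * D i j =
    \sum_(u : I * 'I_N) om u.1 u.2 * D u.1 (t u.2).
  rewrite -(pair_big predT predT (fun i k => om i k * D i (t k))) /=.
  by apply: eq_bigr => i _; rewrite sum_om.
rewrite -sumEFin -big_split /=; apply: lee_sum => -[i k] _ /=.
rewrite [X in (_ <= X + _)%E]EFinM -(cmu (i, k)) -muleA -ge0_muleDr; last 2 first.
- by rewrite mule_ge0// lee_fin.
- by apply: integral_ge0 => y _.
apply: lee_wpmul2l; first by rewrite lee_fin.
rewrite muleC -integral_cst// -ge0_integralD//; last 2 first.
- by move=> y _; rewrite lee_fin.
- exact: measurable_funTS.
apply: ge0_le_integral => //.
- by move=> y _; rewrite lee_fin powR_ge0.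
- by apply: measurable_funTS; exact: measurable_costr.
- by apply: emeasurable_funD => //; exact: measurable_funTS.
- by move=> y yi; rewrite -EFinD lee_fin -[i]yi; exact: costD.
Qed.

End Labels.

Section TreeTransport.
Context {R : realType} {d : nat} {I J : finType}.
Variables (mu : probability (Rd R d) R) (lab : Rd R d -> I).
Hypothesis mlab : forall i, measurable (lab @^-1` [set i]).

(** The cost is split by who pays: [u] and [v] are charged to one endpoint through its label,
    [kappa] to the cells that separate the pair, and [f] to the point of [mu] itself, for costs not
    bounded in terms of labels. *)
Lemma transport_cost_tree_le (p : R) (N : nat) (x : nat -> Rd R d)
    (c : nat -> I -> J) (K : nat) (u v : I -> R) (kappa : nat -> J -> R)
    (f : Rd R d -> R) : (0 < N)%N ->
  (forall k i j, c k i = c k j -> c k.+1 i = c k.+1 j) ->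
  (forall i j, c K i = c K j) ->
  (forall i, 0 <= u i) -> (forall i, 0 <= v i) -> (forall k g, 0 <= kappa k g) ->
  measurable_fun setT f -> (forall y, 0 <= f y) ->
  (forall y (k : 'I_N), enorm ((y : 'rV[R]_d) - x k) `^ p <=
     u (lab y) + v (lab (x k)) + \sum_(k' < K | c k' (lab y) != c k' (lab (x k)))
       (kappa k' (c k' (lab y)) + kappa k' (c k' (lab (x k)))) + f y) ->
  (transport_cost p mu (empirical N x) <=
    (\sum_i label_mass mu lab i * u i +
     N%:R^-1 * \sum_(k < N) v (lab (x k)) +
     \sum_(k < K) \sum_g kappa k g *
       `|\sum_(i | c k i == g) label_mass mu lab i -
         N%:R^-1 * \sum_(k' < N) (c k (lab (x k')) == g)%:R|)%:E
     + \int[mu]_y (f y)%:E)%E.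
Proof.
move=> N0 cS cK u0 v0 kappa0 mf f0 cost.
have NR : 0 < N%:R :> R by rewrite ltr0n.
pose b j : R := N%:R^-1 * \sum_(k < N) (lab (x k) == j)%:R.
have b0 j : 0 <= b j by rewrite mulr_ge0 ?invr_ge0 ?ler0n// sumr_ge0.
have bsum (P : pred I) (F : I -> R) : \sum_(j | P j) b j * F j =
    N%:R^-1 * \sum_(k < N) (P (lab (x k)))%:R * F (lab (x k)).
  under eq_bigr do rewrite -mulrA mulr_suml.
  rewrite -mulr_sumr exchange_big /=; congr (_ * _); apply: eq_bigr => k _.
  rewrite big_mkcond (bigD1 (lab (x k)))//= eqxx big1 ?addr0.
    by case: ifP => _; rewrite ?mul1r// mul0r.
  by move=> j; rewrite eq_sym => /negbTE ->; rewrite mul0r if_same.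
have ab : \sum_i label_mass mu lab i = \sum_i b i.
  rewrite sum_label_mass//; have := bsum predT (fun=> 1).
  under eq_bigr do rewrite mulr1.
  move=> ->; rewrite (eq_bigr (fun=> 1)); last by move=> k _; rewrite mulr1.
  by rewrite sumr_const card_ord mulVf// gt_eqF.
have [w [w0 wa wb flow]] := tree_coupling c K _ b cS cK
  (label_mass_ge0 mu lab) b0 ab.
pose D i j := u i + v j + \sum_(k < K | c k i != c k j)
    (kappa k (c k i) + kappa k (c k j)).
have D0 i j : 0 <= D i j.
  by rewrite !addr_ge0//; apply: sumr_ge0 => k _; rewrite addr_ge0.
apply: le_trans (transport_cost_label_le mu lab mlab p N x b w D f N0 (fun=> erefl)
  w0 wa wb D0 mf f0 cost) _.
rewrite leeD2r// lee_fin.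
under eq_bigr do (under eq_bigr do rewrite /D 2!mulrDr; rewrite !big_split /=).
rewrite !big_split /=; apply: lerD; first apply: lerD.
- by apply: ler_sum => i _; rewrite -mulr_suml wa.
- rewrite exchange_big /=.
  under eq_bigr do rewrite -mulr_suml wb.
  rewrite (bsum predT) ler_pM2l ?invr_gt0//; apply: ler_sum => k _.
  by rewrite mul1r.
apply: le_trans (tree_flow_le c K _ b w kappa kappa0 flow) _.
apply: ler_sum => k _; apply: ler_sum => g _; apply: ler_wpM2l => //.
have -> // : \sum_(i | c k i == g) b i =
  N%:R^-1 * \sum_(k' < N) (c k (lab (x k')) == g)%:R.
rewrite (eq_bigr (fun i => b i * 1)); last by move=> i _; rewrite mulr1.
rewrite (bsum (fun i => c k i == g)); congr (_ * _); apply: eq_bigr => k' _.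
by rewrite mulr1.
Qed.

End TreeTransport.

Lemma grid_coord_itv (R : realFieldType) (a E W : R) : 0 < E -> 0 < W -> `|a| <= E ->
  0 <= (a / E + 1) * W <= 2 * W.
Proof.
move=> E0 W0 /ler_normlP[a1 a2].
have v1 : - 1 <= a / E by rewrite ler_pdivlMr// mulN1r lerNl.
have v2 : a / E <= 1 by rewrite ler_pdivrMr// mul1r.
by rewrite mulr_ge0 ?(ltW W0) -?lerBlDr ?sub0r//= ler_pM2r// -[leRHS]/(1 + 1) lerD2r.
Qed.

Lemma grid_coord_close (R : realFieldType) (a b E W D : R) (s t : nat) :
  0 < E -> 0 < W -> s.+1%:R <= t%:R + D -> t.+1%:R <= s%:R + D ->
  s%:R <= (a / E + 1) * W < s.+1%:R -> t%:R <= (b / E + 1) * W < t.+1%:R ->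
  `|a - b| <= E * D / W.
Proof.
move=> E0 W0 h1 h2 /andP[h3 h4] /andP[h5 h6].
have -> : a - b = ((a / E + 1) * W - (b / E + 1) * W) * (E / W).
  by field; rewrite !gt_eqF.
have -> : E * D / W = D * (E / W) by ring.
rewrite normrM [X in _ * X]ger0_norm ?divr_ge0 ?(ltW E0) ?(ltW W0)//.
rewrite ler_pM2r ?divr_gt0// ler_norml; lra.
Qed.

(** * Dyadic cells *)

Section DyadicCells.
Context {R : realType} {d : nat}.
Variables (Q L : nat).
Implicit Types y z : 'rV[R]_d.

(* The annuli [n < Q] cover the cube of radius [2 ^ Q.-1]; the index [Q] stands for
   its complement. *)
Definition annulus (y : 'rV[R]_d) : nat :=
  find (fun n : nat => `|y| <= 2 ^+ n) (iota 0 Q).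

Lemma annulus_le y : (annulus y <= Q)%N.
Proof. by rewrite -[leqRHS](size_iota 0); exact: find_size. Qed.

Lemma annulus_norm_le y : (annulus y < Q)%N -> `|y| <= 2 ^+ annulus y.
Proof.
move=> yQ; have := @nth_find _ 0%N (fun n : nat => `|y| <= 2 ^+ n) (iota 0 Q).
rewrite has_find size_iota => /(_ yQ); rewrite nth_iota//.
Qed.

Lemma annulus_norm_gt y n : (n < annulus y)%N -> 2 ^+ n < `|y|.
Proof.
move=> ny; have := before_find 0%N ny; rewrite nth_iota.
  by move/negbT; rewrite -ltNge.
exact: leq_trans ny (annulus_le y).
Qed.

Lemma annulus_geE y n : (n < Q)%N -> (n < annulus y)%N = (2 ^+ n < `|y|).
Proof.
move=> nQ; apply/idP/idP; first exact: annulus_norm_gt.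
rewrite !ltNge => /negP yn; rewrite ltnNge; apply/negP => an; apply: yn.
have aQ : (annulus y < Q)%N by exact: leq_ltn_trans nQ.
apply: le_trans (annulus_norm_le _ aQ) _.
by rewrite ler_weXn2l// ler1n.
Qed.

Definition side : nat := 2 ^ L.+1.
Definition leaf := ('I_Q.+1 * {ffun 'I_d -> 'I_side.+1})%type.

(** The interval from [- 2^n] to [2^n] is cut into [side] pieces of length [2^(n - L)]; its right
    endpoint takes the extra index [side]. The cap [minn] acts only beyond the last annulus. *)
Definition leaf_coord (n : nat) (y : 'rV[R]_d) (e : 'I_d) : nat :=
  minn side (Num.truncn ((y ord0 e / 2 ^+ n + 1) * 2 ^+ L)).

Definition leaf_label (y : Rd R d) : leaf :=
  (inord (annulus y), [ffun e => inord (leaf_coord (annulus y) y e)]).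

(* [k] counts levels from the finest one, and [cell L.+1] is the root. *)
Definition cell (k : nat) (i : leaf) : leaf :=
  if (k <= L)%N then (i.1, [ffun e => inord (i.2 e %/ 2 ^ k)]) else (ord0, [ffun=> ord0]).

Lemma label_annulus y : ((leaf_label y).1 : nat) = annulus y.
Proof. by rewrite inordK// ltnS annulus_le. Qed.

Lemma label_coord y e : ((leaf_label y).2 e : nat) = leaf_coord (annulus y) y e.
Proof. by rewrite ffunE inordK// ltnS geq_minl. Qed.

Lemma cell_coord k (i : leaf) e : (k <= L)%N ->
  ((cell k i).2 e : nat) = (i.2 e %/ 2 ^ k)%N.
Proof.
move=> kL; rewrite /cell kL ffunE inordK// ltnS.
by apply: leq_trans (leq_div _ _) _; rewrite -ltnS.
Qed.

Lemma cell_annulus k (i : leaf) : (k <= L)%N -> (cell k i).1 = i.1.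
Proof. by rewrite /cell => ->. Qed.

Lemma cell_refine k (i j : leaf) : cell k i = cell k j -> cell k.+1 i = cell k.+1 j.
Proof.
move=> ij; have [kL|kL] := ltnP k L; last by rewrite /cell ltnNge kL.
rewrite /cell kL; congr (_, _).
  by rewrite -(cell_annulus k i) ?(ltnW kL)// ij cell_annulus// ltnW.
apply/ffunP => e; rewrite !ffunE; congr inord.
by rewrite expnSr !divnMA -!(cell_coord k _ e (ltnW kL)) ij.
Qed.

Lemma cell_root (i j : leaf) : cell L.+1 i = cell L.+1 j.
Proof. by rewrite /cell ltnn. Qed.

(* The coordinate indices of a cell of annulus [n] at level [l = L - k], of side
   [2 ^ (n - l)], run from [0] to [2 ^ l.+1]. *)
Definition cells_of (n k : nat) : {set leaf} :=
  finset (fun g : leaf =>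
    ((g.1 : nat) == n) && [forall e, (g.2 e <= 2 ^ (L - k).+1)%N]).

Lemma card_cells_of n k : (#|cells_of n k| <= (2 ^ (L - k).+1).+1 ^ d)%N.
Proof.
pose A := finset (fun g : {ffun 'I_d -> 'I_side.+1} =>
    [forall e, (g e <= 2 ^ (L - k).+1)%N]).
have AE : (#|A| <= (2 ^ (L - k).+1).+1 ^ d)%N.
  pose r := finset (fun s : 'I_side.+1 => (s < (2 ^ (L - k).+1).+1)%N).
  have -> : #|A| = #|ffun_on (mem r) : simpl_pred {ffun 'I_d -> 'I_side.+1}|.
    apply: eq_card => g; rewrite inE.
    by apply/forallP/ffun_onP => h e; have := h e; rewrite inE.
  rewrite card_ffun_on card_ord.
  have r_le : (#|r| <= (2 ^ (L - k).+1).+1)%N.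
    pose h (s : 'I_side.+1) : 'I_(2 ^ (L - k).+1).+1 := inord s.
    rewrite -(@card_in_imset _ _ h); last first.
      move=> s s'; rewrite !inE => sr s'r /(congr1 (@nat_of_ord _)).
      by rewrite !inordK// => ss'; exact: val_inj.
    by rewrite -[leqRHS]card_ord; exact: max_card.
  case: (posnP d) => [->|d0]; first by rewrite !expn0.
  by rewrite leq_exp2r.
apply: leq_trans AE; rewrite -(@card_in_imset _ _ (fun g : leaf => g.2)); last first.
  move=> [g1 g2] [h1 h2]; rewrite !inE /= => /andP[/eqP gn _] /andP[/eqP hn _] ->.
  by congr (_, _); apply: val_inj; rewrite /= gn hn.
apply: subset_leq_card; apply/fintype.subsetP => _ /imsetP[g + ->].
by rewrite !inE => /andP[].
Qed.

Lemma cell_in k (i : leaf) : (k <= L)%N -> cell k i \in cells_of i.1 k.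
Proof.
move=> kL; rewrite inE cell_annulus// eqxx; apply/forallP => e.
rewrite cell_coord// -subSn ?(leq_trans kL)// expnB//; last exact: leqW.
by apply: leq_div2r; rewrite -ltnS.
Qed.

Lemma leaf_coordE y e : (annulus y < Q)%N ->
  let u := (y ord0 e / 2 ^+ annulus y + 1) * 2 ^+ L in
  (leaf_coord (annulus y) y e)%:R <= u < (leaf_coord (annulus y) y e).+1%:R.
Proof.
move=> yQ /=; set n := annulus y; set u := (_ + 1) * _.
have n0 : 0 < 2 ^+ n :> R by rewrite exprn_gt0.
have L0 : 0 < 2 ^+ L :> R by rewrite exprn_gt0.
have yn : `|y ord0 e| <= 2 ^+ n.
  exact: le_trans (coord_le_sup_norm y e) (annulus_norm_le y yQ).
have /andP[u0 uS] : 0 <= u <= side%:R.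
  by rewrite /side natrX exprS; exact: grid_coord_itv.
have /andP[t1 t2] := truncn_itv u0.
rewrite /leaf_coord -/u (minn_idPr _) ?t1//.
by rewrite -(ler_nat R); exact: le_trans uS.
Qed.

Lemma cell_diam y z k e : (annulus y < Q)%N -> annulus y = annulus z ->
  (k <= L)%N -> cell k (leaf_label y) = cell k (leaf_label z) ->
  `|y ord0 e - z ord0 e| <= 2 ^+ annulus y * 2 ^+ k / 2 ^+ L.
Proof.
move=> yQ yz kL cyz.
have := congr1 (fun g : leaf => nat_of_ord (g.2 e)) cyz.
rewrite !cell_coord// !label_coord => tyz.
have := leaf_coordE y e yQ; have := leaf_coordE z e; rewrite -yz => /(_ yQ).
move: tyz; rewrite -yz; set n := annulus y.
set s := leaf_coord n y e; set t := leaf_coord n z e => st.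
have k0 : (0 < 2 ^ k)%N by rewrite expn_gt0.
have s_lt : (s < t + 2 ^ k)%N.
  rewrite (divn_eq s (2 ^ k)) st; have := ltn_pmod s k0.
  have := leq_divM t (2 ^ k); lia.
have t_lt : (t < s + 2 ^ k)%N.
  rewrite (divn_eq t (2 ^ k)) -st; have := ltn_pmod t k0.
  have := leq_divM s (2 ^ k); lia.
move: s_lt t_lt; rewrite -!(ler_nat R) !natrD natrX.
have n0 : 0 < 2 ^+ n :> R by rewrite exprn_gt0.
have L0 : 0 < 2 ^+ L :> R by rewrite exprn_gt0.
move=> s_lt t_lt tP sP; exact: (grid_coord_close _ _ _ _ _ _ s t n0 L0 s_lt t_lt sP tP).
Qed.

Lemma measurable_annulus n : measurable [set y : Rd R d | annulus y = n].
Proof.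
have mge m : measurable [set y : Rd R d | (m < annulus y)%N].
  have [mQ|mQ] := ltnP m Q; last first.
    rewrite (_ : [set _ | _] = set0)//; apply/seteqP; split=> // y /= my.
    by have := leq_trans my (annulus_le y); rewrite ltnNge mQ.
  rewrite (_ : [set _ | _] = ~` [set y : Rd R d | `|y : 'rV[R]_d| <= 2 ^+ m]).
    apply: measurableC; rewrite -[X in measurable X]setTI.
    by apply: measurable_fun_le => //; exact: measurable_sup_norm.
  by apply/seteqP; split=> y /=; rewrite annulus_geE// ltNge => /negP.
case: n => [|n].
  rewrite (_ : [set _ | _] = ~` [set y : Rd R d | (0 < annulus y)%N]).
    exact: measurableC.
  by apply/seteqP; split=> y /=; [move=> ->|move/negP; rewrite -eqn0Ngt => /eqP].
rewrite (_ : [set _ | _] = [set y : Rd R d | (n < annulus y)%N] `\`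
    [set y : Rd R d | (n.+1 < annulus y)%N]); first exact: measurableD.
apply/seteqP; split=> y /=; first by move=> ->; rewrite ltnn.
by move=> [h1 /negP]; rewrite -leqNgt => h2; apply/eqP; rewrite eqn_leq h2.
Qed.

Lemma measurable_leaf_label (i : leaf) :
  measurable ((leaf_label : Rd R d -> leaf) @^-1` [set i]).
Proof.
have mcoord n e m : measurable [set y : Rd R d | (m < leaf_coord n y e)%N].
  have [mS|mS] := ltnP m side; last first.
    rewrite (_ : [set _ | _] = set0)//; apply/seteqP; split=> // y /= my.
    by have := leq_trans my (geq_minl _ _); rewrite ltnNge mS.
  rewrite (_ : [set _ | _] = [set y : Rd R d |
      m.+1%:R <= ((y : 'rV[R]_d) ord0 e / 2 ^+ n + 1) * 2 ^+ L]).
    rewrite -[X in measurable X]setTI; apply: measurable_fun_le => //.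
    apply: measurable_funM => //; apply: measurable_funD => //.
    by apply: measurable_funM => //; exact: measurable_coord.
  apply/seteqP; split=> y /=; by rewrite leq_min mS truncn_gt_nat.
have mcoordE n e m : measurable [set y : Rd R d | leaf_coord n y e = m].
  case: m => [|m].
    rewrite (_ : [set _ | _] = ~` [set y : Rd R d | (0 < leaf_coord n y e)%N]).
      exact: measurableC.
    by apply/seteqP; split=> y /=; [move=> ->|move/negP; rewrite -eqn0Ngt => /eqP].
  rewrite (_ : [set _ | _] = [set y : Rd R d | (m < leaf_coord n y e)%N] `\`
      [set y : Rd R d | (m.+1 < leaf_coord n y e)%N]); first exact: measurableD.
  apply/seteqP; split=> y /=; first by move=> ->; rewrite ltnn.
  by move=> [h1 /negP]; rewrite -leqNgt => h2; apply/eqP; rewrite eqn_leq h2.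
rewrite (_ : _ @^-1` _ = [set y : Rd R d | annulus y = i.1] `&`
   \bigcap_(e in [set: 'I_d]) [set y : Rd R d | leaf_coord i.1 y e = i.2 e]).
  apply: measurableI; first exact: measurable_annulus.
  by apply: fin_bigcap_measurable.
apply/seteqP; split=> y /=.
  move=> <-; rewrite label_annulus; split=> // e _ /=.
  by rewrite label_coord.
move=> [yi1 yi2]; case: i yi1 yi2 => i1 i2 /= yi1 yi2; congr (_, _).
  by apply: val_inj; rewrite /= -yi1 inordK// ltnS annulus_le.
apply/ffunP => e; apply: val_inj; rewrite ffunE /= inordK ?ltnS ?geq_minl//.
by rewrite -yi2// yi1.
Qed.

End DyadicCells.

(** * The cost of a pair of points, charged to its cells *)

Section CostBound.
Context {R : realType} {d : nat}.
Variables (p : R) (M Q L : nat) (ell : nat -> nat).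
Hypothesis p0 : 0 < p.
Hypothesis MQ : (M <= Q)%N.
Hypothesis ellL : forall n, (n < M)%N -> (ell n <= L)%N.
Implicit Types y z : 'rV[R]_d.

Let lab := (@leaf_label R d Q L).

(** The factor [sqrt d] compares the Euclidean and sup norms, and 2 bounds the distance of two
    points by the larger norm. *)
Definition cost_const : R := (2 * Num.sqrt d%:R) `^ p.
Local Notation kap := cost_const.

Lemma cost_const_ge0 : 0 <= kap. Proof. exact: powR_ge0. Qed.

Lemma powR2_nat (n : nat) : (2 ^+ n) `^ p = 2 `^ (p * n%:R) :> R.
Proof. by rewrite -powR_mulrn// -powRrM mulrC. Qed.

Lemma cost_near (v : 'rV[R]_d) (r : R) : 0 <= r ->
  (forall e, `|v ord0 e| <= r) -> enorm v `^ p <= kap * r `^ p.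
Proof.
move=> r0 vr.
have s0 : 0 <= Num.sqrt d%:R :> R by exact: sqrtr_ge0.
rewrite /cost_const -powRM ?mulr_ge0//.
apply: ge0_ler_powR; rewrite ?nnegrE ?enorm_ge0 ?mulr_ge0 ?(ltW p0)//.
apply: le_trans (enorm_le_coord v r r0 vr) _.
by rewrite ler_wpM2r// ler_peMl// ler1n.
Qed.

(** The point of larger norm pays alone, so [p < 1] and [p > 1] need no separate inequality. *)
Lemma cost_far y z : enorm (y - z) `^ p <= kap * `|y| `^ p + kap * `|z| `^ p.
Proof.
wlog yz : y z / `|z| <= `|y|.
  move=> H; have [zy|yz] := leP `|z| `|y|; first exact: H.
  have -> : enorm (y - z) = enorm (z - y).
    by congr Num.sqrt; apply: eq_bigr => e _; rewrite !mxE -sqrrN opprB.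
  by rewrite [leRHS]addrC; apply: H; exact: ltW.
have s0 : 0 <= Num.sqrt d%:R :> R by exact: sqrtr_ge0.
apply: (@le_trans _ _ (kap * `|y| `^ p)); last first.
  by rewrite lerDl mulr_ge0 ?powR_ge0.
rewrite /cost_const -powRM ?mulr_ge0//.
apply: ge0_ler_powR; rewrite ?nnegrE ?enorm_ge0 ?mulr_ge0 ?(ltW p0)//.
have yz2 e : `|(y - z) ord0 e| <= 2 * `|y|.
  rewrite !mxE; apply: le_trans (ler_normB _ _) _.
  have := coord_le_sup_norm y e; have := coord_le_sup_norm z e; lra.
by apply: le_trans (enorm_le_coord _ _ _ yz2) _; rewrite ?mulr_ge0//; lra.
Qed.

Definition coarse_weight (i : @leaf d Q L) : R :=
  if (M <= i.1 < Q)%N then kap * 2 `^ (p * (i.1 : nat)%:R) else 0.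

Definition fine_weight (i : @leaf d Q L) : R :=
  if (i.1 < M)%N then kap * 2 `^ (p * ((i.1 : nat)%:R - (ell i.1)%:R)) else 0.

(** The [+ 1] is for the side of the parent cell, which is what bounds the distance of two points
    separated at depth [k] but not at [k.+1]. *)
Definition cell_weight (k : nat) (g : @leaf d Q L) : R :=
  if (g.1 < M)%N && (L - k <= ell g.1)%N then
    kap * 2 `^ (p * ((g.1 : nat)%:R - (L - k)%:R + 1)) else 0.

Definition far_weight (y : Rd R d) : R :=
  if annulus Q y == Q then kap * `|y : 'rV[R]_d| `^ p else 0.

Lemma coarse_weight_ge0 i : 0 <= coarse_weight i.
Proof. by rewrite /coarse_weight; case: ifP => // _; rewrite mulr_ge0 ?powR_ge0. Qed.

Lemma fine_weight_ge0 i : 0 <= fine_weight i.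
Proof. by rewrite /fine_weight; case: ifP => // _; rewrite mulr_ge0 ?powR_ge0. Qed.

Lemma cell_weight_ge0 k g : 0 <= cell_weight k g.
Proof. by rewrite /cell_weight; case: ifP => // _; rewrite mulr_ge0 ?powR_ge0. Qed.

Lemma far_weight_ge0 y : 0 <= far_weight y.
Proof. by rewrite /far_weight; case: ifP => // _; rewrite mulr_ge0 ?powR_ge0. Qed.

Lemma cost_single y :
  kap * `|y| `^ p <=
    coarse_weight (lab y) + far_weight y + cell_weight L (cell Q L L (lab y)).
Proof.
have c1 := coarse_weight_ge0 (lab y).
have c2 := far_weight_ge0 y.
have c3 := cell_weight_ge0 L (cell Q L L (lab y)).
have yle : (annulus Q y < Q)%N -> kap * `|y| `^ p <= kap * 2 `^ (p * (annulus Q y)%:R).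
  move=> yQ; rewrite ler_wpM2l ?cost_const_ge0// -powR2_nat.
  apply: ge0_ler_powR; rewrite ?nnegrE ?exprn_ge0 ?(ltW p0)//.
  exact: annulus_norm_le.
have := annulus_le Q y; rewrite leq_eqVlt => /predU1P[yQ|yQ].
  apply: (@le_trans _ _ (far_weight y)); last by lra.
  by rewrite /far_weight yQ eqxx.
apply: (le_trans (yle yQ)); have [yM|yM] := ltnP (annulus Q y) M.
  apply: (@le_trans _ _ (cell_weight L (cell Q L L (lab y)))); last by lra.
  rewrite /cell_weight cell_annulus// label_annulus yM subnn leq0n /=.
  rewrite ler_wpM2l ?cost_const_ge0// ler_powR ?ler1n// ler_pM2l//; lra.
apply: (@le_trans _ _ (coarse_weight (lab y))); last by lra.
by rewrite /coarse_weight label_annulus yM yQ.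
Qed.

(** Points in different annuli are separated at depth [L], so each pays for its own norm; in a
    common far annulus the single-point weights suffice. In a common near annulus, either the cells
    at level [ell n] agree and [fine_weight] pays, or the coarsest separation pays for the side of
    the parent cell. *)
Lemma cost_le_weights y z : (annulus Q z < Q)%N ->
  enorm (y - z) `^ p <=
    (fine_weight (lab y) + coarse_weight (lab y)) + coarse_weight (lab z) +
    \sum_(k < L.+1 | cell Q L k (lab y) != cell Q L k (lab z))
      (cell_weight k (cell Q L k (lab y)) + cell_weight k (cell Q L k (lab z)))
    + far_weight y.
Proof.
have lin1 (e ky kz cy fy wy cz wz s' fw : R) : e <= ky + kz ->
    ky <= cy + fy + wy -> kz <= cz + 0 + wz -> wy + wz <= s' -> 0 <= fw ->
    e <= fw + cy + cz + s' + fy by lra.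
have lin2 (e ky kz cy fy cz s' fw : R) : e <= ky + kz ->
    ky <= cy + fy + 0 -> kz <= cz + 0 + 0 -> 0 <= s' -> 0 <= fw ->
    e <= fw + cy + cz + s' + fy by lra.
have lin3 (e b fw cy cz s' fy : R) : e <= b -> b <= fw -> 0 <= cy -> 0 <= cz ->
    0 <= s' -> 0 <= fy -> e <= fw + cy + cz + s' + fy by lra.
have lin5 (a b c' : R) : a - (b - (c' + 1)) <= a - (b - c') + 1 by lra.
have lin6 (a b c' : R) : a + b - c' <= a - (c' - b) by lra.
have lin4 (e b w fw cy cz s' fy : R) : e <= b -> b + w <= s' -> 0 <= w ->
    0 <= fw -> 0 <= cy -> 0 <= cz -> 0 <= fy -> e <= fw + cy + cz + s' + fy by lra.
move=> zQ; set s := \sum_(k < L.+1 | _) _.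
have c1 := coarse_weight_ge0 (lab y).
have c2 := coarse_weight_ge0 (lab z).
have c3 := fine_weight_ge0 (lab y).
have c4 := far_weight_ge0 y.
have s0 : 0 <= s by apply: sumr_ge0 => k _; rewrite addr_ge0 ?cell_weight_ge0.
have s_ge k : (k <= L)%N -> cell Q L k (lab y) != cell Q L k (lab z) ->
    cell_weight k (cell Q L k (lab y)) + cell_weight k (cell Q L k (lab z)) <= s.
  move=> kL kyz; rewrite /s (bigD1 (Ordinal (kL : (k < L.+1)%N)))//= lerDl.
  by apply: sumr_ge0 => k' _; rewrite addr_ge0 ?cell_weight_ge0.
have fz : far_weight z = 0 by rewrite /far_weight ltn_eqF.
have far := cost_far y z.
have Hy := cost_single y; have Hz := cost_single z.
have [yz|yz] := eqVneq (annulus Q y) (annulus Q z); last first.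
  have := s_ge L (leqnn L); move=> H.
  have : cell Q L L (lab y) != cell Q L L (lab z).
    apply: contra yz => /eqP /(congr1 (fun g : @leaf d Q L => nat_of_ord g.1)).
    by rewrite !cell_annulus// !label_annulus => ->.
  move=> /H {}H.
  by rewrite fz in Hz; exact: lin1 far Hy Hz H c3.
have [yM|yM] := leqP M (annulus Q y).
  have w0 u : (M <= annulus Q u)%N -> cell_weight L (cell Q L L (lab u)) = 0.
    by move=> Mu; rewrite /cell_weight cell_annulus// label_annulus ltnNge Mu.
  rewrite fz w0 -?yz// in Hz; rewrite w0// in Hy.
  exact: lin2 far Hy Hz s0 c3.
set n := annulus Q y in yM yz.
have nQ : (n < Q)%N by rewrite yz.
have diam k : (k <= L)%N -> cell Q L k (lab y) = cell Q L k (lab z) ->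
    enorm (y - z) `^ p <= kap * 2 `^ (p * (n%:R - (L - k)%:R)).
  move=> kL kyz.
  have := cost_near (y - z) (2 ^+ n * 2 ^+ k / 2 ^+ L).
  rewrite divr_ge0 ?mulr_ge0 ?exprn_ge0// => /(_ isT) H.
  apply: le_trans (H _) _.
    by move=> e; rewrite !mxE; exact: (cell_diam Q L y z k e).
  rewrite ler_wpM2l ?cost_const_ge0//.
  rewrite [p * _]mulrC powRrM; apply: ge0_ler_powR; rewrite ?nnegrE ?powR_ge0 ?(ltW p0)//.
  rewrite -!powR_mulrn// -powRD ?pnatr_eq0 ?implybT// -powRB ?pnatr_eq0 ?implybT//.
  by rewrite ler_powR ?ler1n// natrB//; exact: lin6.
have ln := ellL n yM.
have [kyz|kyz] := eqVneq (cell Q L (L - ell n) (lab y)) (cell Q L (L - ell n) (lab z)).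
  have H := diam _ (leq_subr _ _) kyz.
  apply: lin3 H _ c1 c2 s0 c4.
  by rewrite subKn// /fine_weight label_annulus -/n yM.
have [k [kl kL kyz' kS]] : exists k, [/\ (L - ell n <= k)%N, (k <= L)%N,
    cell Q L k (lab y) != cell Q L k (lab z) &
    (k < L)%N -> cell Q L k.+1 (lab y) = cell Q L k.+1 (lab z)].
  pose Pk k := (k <= L)%N && (cell Q L k (lab y) != cell Q L k (lab z)).
  have exP : exists k, Pk k by exists (L - ell n)%N; rewrite /Pk leq_subr.
  have boundP k : Pk k -> (k <= L)%N by case/andP.
  case: (ex_maxnP exP boundP) => k /andP[kL kyz'] kmax.
  exists k; split=> //.
    by apply: kmax; rewrite /Pk leq_subr.
  move=> kL'; apply/eqP; apply: contraT => neq.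
  by have := kmax k.+1; rewrite /Pk kL' neq ltnn => /(_ isT).
have H := s_ge k kL kyz'.
have w1 : cell_weight k (cell Q L k (lab y)) = kap * 2 `^ (p * (n%:R - (L - k)%:R + 1)).
  rewrite /cell_weight cell_annulus// label_annulus -/n yM /=.
  by rewrite leq_subLR addnC -leq_subLR kl.
have w2 := cell_weight_ge0 k (cell Q L k (lab z)).
rewrite w1 in H.
suff e_le : enorm (y - z) `^ p <= kap * 2 `^ (p * (n%:R - (L - k)%:R + 1)).
  exact: lin4 e_le H w2 c3 c1 c2 c4.
have [kL'|kL'] := ltnP k L.
  apply: le_trans (diam k.+1 kL' (kS kL')) _.
  rewrite ler_wpM2l ?cost_const_ge0// ler_powR ?ler1n// ler_pM2l//.
  by rewrite !natrB// -natr1; exact: lin5.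
(* Here the parent is the root, which has no side in this annulus; the norms of the two points bound
   their distance instead. *)
have -> : k = L by apply/eqP; rewrite eqn_leq kL.
rewrite subnn subr0.
have H1 : forall u : 'rV[R]_d, annulus Q u = n -> forall e, `|u ord0 e| <= 2 ^+ n.
  move=> u un e; apply: le_trans (coord_le_sup_norm u e) _.
  by rewrite -un; apply: annulus_norm_le; rewrite un.
have := cost_near (y - z) (2 ^+ n.+1); rewrite exprn_ge0// => /(_ isT) H2.
apply: le_trans (H2 _) _.
  move=> e; rewrite !mxE; apply: le_trans (ler_normB _ _) _.
  by rewrite exprS mulr_natl mulr2n lerD ?H1.
by rewrite powR2_nat natr1.
Qed.

End CostBound.

(** * Deviation for fixed multiscale thresholds *)

Section Moments.
Context {R : realType} {d : nat}.
Variables (p q m : R) (mu : probability (Rd R d) R).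
Hypothesis p0 : 0 < p.
Hypothesis pq : p < q.
Hypothesis mom : moment q mu = m%:E.

(** The factor [2^q] reflects [|y| > 2^(n - 1)] in annulus [n >= 1], and the 1 covers annulus 0. The
    absolute value makes the constant positive for every [m]. *)
Definition moment_const : R := 2 `^ q * (1 + `|m|).
Local Notation K0 := moment_const.

Lemma moment_const_ge0 : 0 <= K0.
Proof. by rewrite mulr_ge0 ?powR_ge0// addr_ge0. Qed.

Let q0 : 0 < q. Proof. exact: lt_trans pq. Qed.

Lemma powR2_ge1 (t : R) : 0 <= t -> 1 <= 2 `^ t.
Proof. by move=> t0; rewrite -[leLHS](powRr0 2) ler_powR// ler1n. Qed.

Lemma integral_moment :
  (\int[mu]_y (2 `^ q * (1 + enorm (y : 'rV[R]_d) `^ q))%:E = K0%:E)%E.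
Proof.
have m0 : 0 <= m.
  rewrite -lee_fin -mom; apply: integral_ge0 => y _.
  by rewrite lee_fin powR_ge0.
under eq_integral do rewrite EFinM EFinD.
have mE := measurable_enorm_powR q.
rewrite ge0_integralZl//; last 2 first.
- by apply: emeasurable_funD => //; exact: mE.
- by move=> y _; rewrite -EFinD lee_fin addr_ge0 ?powR_ge0.
rewrite ge0_integralD//; last first.
  by move=> y _; rewrite lee_fin powR_ge0.
rewrite integral_cst// [X in (_ * (_ * X + _))%E](@probability_setT _ _ _ mu) mule1.
by rewrite -/(moment q mu) mom /moment_const ger0_norm.
Qed.

Lemma pow_annulus_le (Q : nat) (y : 'rV[R]_d) :
  2 `^ (q * (annulus Q y)%:R) <= 2 `^ q * (1 + enorm y `^ q).
Proof.
have [y0|] := eqVneq (annulus Q y) 0%N.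
  rewrite y0 mulr0 powRr0 mulr_ege1 ?powR2_ge1 ?(ltW q0)//.
  by rewrite lerDl powR_ge0.
rewrite -lt0n; move an : (annulus Q y) => n; case: n an => // n an _.
rewrite -[n.+1%:R]natr1 mulrDr mulr1 powRD ?pnatr_eq0 ?implybT// mulrC.
rewrite ler_wpM2l ?powR_ge0// -powR2_nat.
apply: (@le_trans _ _ (enorm y `^ q)); last by rewrite lerDr.
apply: ge0_ler_powR; rewrite ?nnegrE ?exprn_ge0 ?enorm_ge0 ?(ltW q0)//.
apply: le_trans (sup_norm_le_enorm y); apply: ltW.
by apply: (@annulus_norm_gt R d Q); rewrite an.
Qed.

Section FixedLabels.
Variables (Q L : nat).
Let lab := (@leaf_label R d Q L).
Let a := label_mass mu lab.

Let a0 i : 0 <= a i. Proof. exact: label_mass_ge0. Qed.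

Lemma sum_mass_annulus_le :
  \sum_i a i * 2 `^ (q * (i.1 : nat)%:R) <= K0.
Proof.
rewrite -lee_fin -integral_moment.
apply: (label_integral_le mu lab (measurable_leaf_label Q L)
  (fun i => 2 `^ (q * (i.1 : nat)%:R))).
- by move=> i; exact: powR_ge0.
- apply/measurable_EFinP; apply: measurable_funM => //.
  apply: measurable_funD => //; apply/measurable_EFinP.
  exact: measurable_enorm_powR.
- by move=> y; rewrite lee_fin mulr_ge0 ?addr_ge0 ?powR_ge0.
- by move=> y; rewrite lee_fin label_annulus pow_annulus_le.
Qed.

Lemma mass_annulus_le (n : nat) :
  \sum_(i : @leaf d Q L | (i.1 : nat) == n) a i <= K0 * 2 `^ (- (q * n%:R)).
Proof.
rewrite powRN ler_pdivlMr ?powR_gt0// mulr_suml.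
apply: le_trans sum_mass_annulus_le; rewrite [leLHS]big_mkcond.
apply: ler_sum => i _; case: ifP => [/eqP ->//|_].
by rewrite mulr_ge0 ?powR_ge0.
Qed.

(** The truncated variable fed to [heavy_tail]; truncation at [Q] is harmless as long as no sample
    point lies there. *)
Definition coarse_power (M : nat) (i : @leaf d Q L) : R :=
  if (M <= i.1 < Q)%N then 2 `^ (p * (i.1 : nat)%:R) else 0.

Lemma coarse_power_ge0 M i : 0 <= coarse_power M i.
Proof. by rewrite /coarse_power; case: ifP => // _; exact: powR_ge0. Qed.

Lemma sum_coarse_power_le M :
  \sum_i a i * coarse_power M i <= K0 * 2 `^ (- ((q - p) * M%:R)).
Proof.
rewrite powRN ler_pdivlMr ?powR_gt0// mulr_suml.
apply: le_trans sum_mass_annulus_le; apply: ler_sum => i _.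
rewrite -mulrA ler_wpM2l// /coarse_power; case: ifP => [/andP[Mi _]|_].
  rewrite -powRD ?pnatr_eq0 ?implybT// ler_powR ?ler1n//.
  have : M%:R <= (i.1 : nat)%:R :> R by rewrite ler_nat.
  move: (M%:R : R) ((i.1 : nat)%:R : R) => u v uv; have := pq; nra.
by rewrite mul0r powR_ge0.
Qed.

Lemma sum_coarse_power_moment_le M :
  \sum_i a i * coarse_power M i `^ (q / p) <= K0.
Proof.
apply: le_trans sum_mass_annulus_le; apply: ler_sum => i _.
rewrite ler_wpM2l// /coarse_power; case: ifP => _.
  rewrite -powRrM (_ : p * _ * (q / p) = q * (i.1 : nat)%:R)//.
  by field; rewrite gt_eqF.
by rewrite powR0 ?powR_ge0// mulf_neq0// ?invr_eq0 gt_eqF.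
Qed.

End FixedLabels.

Lemma measurable_far_weight (Q : nat) :
  measurable_fun setT (far_weight p Q : Rd R d -> R).
Proof.
rewrite (_ : far_weight p Q = (fun y : Rd R d =>
  \1_[set y : Rd R d | annulus Q y = Q] y * (@cost_const R d p * `|y : 'rV[R]_d| `^ p))).
  apply: measurable_funM.
    apply: measurable_indic; exact: measurable_annulus.
  apply: measurable_funM => //.
  exact: (measurableT_comp (measurable_powR p) measurable_sup_norm).
apply/funext => y; rewrite /far_weight indicE; case: eqP => yQ.
  by rewrite mem_set// mul1r.
by rewrite memNset// mul0r.
Qed.

Lemma far_integral_le (M Q : nat) : (M <= Q)%N ->
  (\int[mu]_y (far_weight p Q y)%:E <=
    (@cost_const R d p * (K0 * 2 `^ (- ((q - p) * M%:R))))%:E)%E.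
Proof.
move=> MQ; rewrite mulrCA mulrC EFinM -integral_moment.
have mE := measurable_enorm_powR q.
have mf : measurable_fun setT (fun y : Rd R d =>
    (2 `^ q * (1 + enorm (y : 'rV[R]_d) `^ q))%:E).
  apply/measurable_EFinP; apply: measurable_funM => //.
  by apply: measurable_funD => //; apply/measurable_EFinP.
set C := @cost_const R d p * 2 `^ (- ((q - p) * M%:R)).
have C0 : 0 <= C by rewrite mulr_ge0 ?powR_ge0.
rewrite -ge0_integralZl//; last first.
  by move=> y _; rewrite lee_fin mulr_ge0 ?addr_ge0 ?powR_ge0.
have far y : far_weight p Q y <= C * (2 `^ q * (1 + enorm (y : 'rV[R]_d) `^ q)).
  rewrite /far_weight; case: eqP => [yQ|_]; last first.
    by rewrite !mulr_ge0 ?addr_ge0 ?powR_ge0.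
  rewrite /C -mulrA ler_wpM2l ?cost_const_ge0//.
  set b := enorm _ `^ q.
  have ynorm : `|y : 'rV[R]_d| `^ q <= b.
    apply: ge0_ler_powR; rewrite ?nnegrE ?enorm_ge0 ?(ltW q0)//.
    exact: sup_norm_le_enorm.
  have b0 : 0 <= b by exact: powR_ge0.
  (* For [Q = 0] there is no inner radius bounding the norm from below, but then [M = 0] and no
     decay is claimed. *)
  have [Q0|Q0] := posnP Q.
    have -> : M = 0%N by apply/eqP; rewrite -leqn0 -Q0.
    rewrite mulr0 oppr0 powRr0 mul1r.
    apply: (@le_trans _ _ (1 + b)).
      have [y1|y1] := leP `|y : 'rV[R]_d| 1.
        apply: (@le_trans _ _ 1); last by rewrite lerDl.
        apply: (@le_trans _ _ (1 `^ p)); last by rewrite powR1.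
        by apply: ge0_ler_powR; rewrite ?nnegrE ?(ltW p0).
      apply: (@le_trans _ _ b); last by rewrite lerDr.
      by apply: le_trans ynorm; rewrite ler_powR// ltW.
    by rewrite ler_peMl ?addr_ge0// powR2_ge1// ltW.
  have y_gt : 2 `^ (Q.-1)%:R < `|y : 'rV[R]_d|.
    by rewrite powR_mulrn//; apply: (@annulus_norm_gt R d Q); rewrite yQ ltn_predL.
  have y0 : 0 < `|y : 'rV[R]_d| by apply: lt_trans y_gt; exact: powR_gt0.
  have -> : `|y : 'rV[R]_d| `^ p = `|y : 'rV[R]_d| `^ (- (q - p)) * `|y : 'rV[R]_d| `^ q.
    by rewrite -powRD ?(gt_eqF y0) ?implybT//; congr (_ `^ _); ring.
  apply: (@le_trans _ _ (2 `^ (- ((q - p) * M%:R)) * 2 `^ q * b)); last first.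
    by rewrite -mulrA ler_wpM2l ?powR_ge0// ler_wpM2l ?powR_ge0// lerDr.
  apply: ler_pM; rewrite ?powR_ge0//.
  apply: (@le_trans _ _ ((2 `^ (Q.-1)%:R) `^ (- (q - p)))).
    rewrite !powRN lef_pV2 ?posrE ?powR_gt0//.
    apply: ge0_ler_powR; rewrite ?nnegrE ?powR_ge0 ?subr_ge0 ?(ltW pq)//.
    exact: ltW.
  rewrite -powRrM -powRD ?pnatr_eq0 ?implybT// ler_powR ?ler1n//.
  have : M%:R <= (Q.-1)%:R + 1 :> R by rewrite natr1 prednK// ler_nat.
  move: (M%:R : R) ((Q.-1)%:R : R) => u v uv.
  have pq' := pq; have p0' := p0; nra.
apply: ge0_le_integral => //.
- by move=> y _; rewrite lee_fin far_weight_ge0.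
- apply/measurable_EFinP; exact: measurable_far_weight.
- exact: measurable_funeM.
- by move=> y _; rewrite -EFinM lee_fin far.
Qed.

End Moments.

Section MultiscaleDeviation.
Context {R : realType} {d : nat}.
Variables (p q m : R) (mu : probability (Rd R d) R).
Hypothesis p0 : 0 < p.
Hypothesis pq : p < q.
Hypothesis mom : moment q mu = m%:E.
Local Notation K0 := (moment_const q m).
Local Notation kap := (@cost_const R d p).

Variables (M Q L N : nat) (ell : nat -> nat) (x B : R).
Variables (y : nat -> nat -> R) (v : nat -> R).
Hypothesis MQ : (M <= Q)%N.
Hypothesis ellL : forall n, (n < M)%N -> (ell n <= L)%N.
Hypothesis N0 : (0 < N)%N.
Hypothesis x0 : 0 < x.
Hypothesis tail_mean : K0 * 2 `^ (- ((q - p) * M%:R)) <= x / 4.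
Hypothesis tail_bound : forall n, (M <= n < Q)%N -> 2 `^ (p * n%:R) <= N%:R * x / 4.
Hypothesis v0 : forall n, 0 < v n.
Hypothesis v_mass : forall n, (n < M)%N -> K0 * 2 `^ (- (q * n%:R)) <= v n.
Hypothesis y0 : forall n l, 0 <= y n l.
Hypothesis B1 : 1 <= B.
Hypothesis y_le : forall n l, (n < M)%N -> (l <= ell n)%N -> y n l <= B * v n.
Hypothesis fine_le :
  \sum_(n < M) 2 `^ (p * (n%:R - (ell n)%:R)) * v n <= x.
Hypothesis cells_le :
  \sum_(n < M) \sum_(k < L.+1 | (L - k <= ell n)%N)
    2 `^ (p * (n%:R - (L - k)%:R)) * y n (L - k) <= x.

Let lab := (@leaf_label R d Q L).
Let a := label_mass mu lab.
Let NR : 0 < N%:R :> R. Proof. by rewrite ltr0n. Qed.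

Let a0 i : 0 <= a i. Proof. exact: label_mass_ge0. Qed.

Let a1 : \sum_i a i = 1.
Proof. exact: (sum_label_mass mu lab (measurable_leaf_label Q L)). Qed.

Definition cell_deviation (n k : nat) (t : {ffun 'I_N -> @leaf d Q L}) : R :=
  \sum_(g in cells_of Q L n k) `|\sum_(i | cell Q L k i == g) a i
     - N%:R^-1 * \sum_(j < N) (cell Q L k (t j) == g)%:R|.

Definition bad_out (t : {ffun 'I_N -> @leaf d Q L}) : bool :=
  [exists j : 'I_N, ((t j).1 : nat) == Q].
Definition bad_tail (t : {ffun 'I_N -> @leaf d Q L}) : bool :=
  N%:R * x < \sum_(j < N) coarse_power p Q L M (t j).
Definition bad_cells (t : {ffun 'I_N -> @leaf d Q L}) : bool :=
  [exists nk : 'I_M * 'I_L.+1, (L - nk.2 <= ell nk.1)%N &&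
     (y nk.1 (L - nk.2) < cell_deviation nk.1 nk.2 t)].

Definition bad_event : {pred {ffun 'I_N -> @leaf d Q L}} :=
  [predU bad_out & [predU bad_tail & bad_cells]].

(** Origin of [3 + 2^p]: finest cells 1, far mean of [mu] up to [Q] 1/4, far empirical moment 1,
    cells [2^p] because of the [+ 1] in [cell_weight], and [mu] beyond [Q] 1/4. *)
Let lin (s1 s2 s3 s4 s5 k e X : R) : 0 <= k -> 0 <= X ->
  s1 <= k * X -> s2 <= k * (X / 4) -> s3 <= k * X -> s4 <= k * (e * X) ->
  s5 <= k * (X / 4) -> s1 + s2 + s3 + s4 + s5 <= k * (3 + e) * X.
Proof. by move=> k0 X0; have := mulr_ge0 k0 X0; lra. Qed.

Lemma good_transport_cost_le (X : nat -> Rd R d) :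
  [ffun j : 'I_N => lab (X j)] \notin bad_event ->
  (transport_cost p mu (empirical N X) <= (kap * (3 + 2 `^ p) * x)%:E)%E.
Proof.
rewrite !inE !negb_or => /and3P[out tail cells].
have XQ (j : 'I_N) : (annulus Q (X j) < Q)%N.
  rewrite ltn_neqAle annulus_le andbT.
  move: out; rewrite negb_exists => /forallP/(_ j).
  by rewrite ffunE label_annulus.
pose u (i : @leaf d Q L) := fine_weight p M Q L ell i + coarse_weight p M Q L i.
have u0 i : 0 <= u i.
  exact: (addr_ge0 (fine_weight_ge0 p M Q L ell i) (coarse_weight_ge0 p M Q L i)).
have := transport_cost_tree_le mu lab (measurable_leaf_label Q L) p N X
  (cell Q L) L.+1 u (coarse_weight p M Q L) (cell_weight p M Q L ell)
  (far_weight p Q) N0 (cell_refine Q L) (cell_root Q L) u0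
  (coarse_weight_ge0 p M Q L) (cell_weight_ge0 p M Q L ell)
  (measurable_far_weight p Q) (far_weight_ge0 p Q).
move=> /(_ (fun z j => cost_le_weights p M Q L ell p0 ellL z (X j) (XQ j))) H.
apply: (le_trans H) => {H}.
apply: le_trans (leeD (lexx _) (far_integral_le p q m mu p0 pq mom M Q MQ)) _.
rewrite -EFinD lee_fin.
have coarseE (i : @leaf d Q L) : coarse_weight p M Q L i = kap * coarse_power p Q L M i.
  by rewrite /coarse_weight /coarse_power; case: ifP; rewrite ?mulr0.
have kap0 : 0 <= kap by exact: cost_const_ge0.
under eq_bigr do rewrite /u mulrDr.
rewrite big_split /=; apply: lin => //; first exact: ltW.
- apply: (@le_trans _ _ (\sum_(n < M) kap * (2 `^ (p * (n%:R - (ell n)%:R)) * v n))); last first.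
    by rewrite -mulr_sumr ler_wpM2l.
  apply: (@le_trans _ _ (\sum_(n < M) \sum_(i : @leaf d Q L | (i.1 : nat) == n)
      a i * (kap * 2 `^ (p * (n%:R - (ell n)%:R))))); last first.
    apply: ler_sum => n _; rewrite -mulr_suml mulrC -mulrA.
    rewrite ler_wpM2l// ler_wpM2l ?powR_ge0//.
    exact: le_trans (mass_annulus_le p q m mu p0 pq mom Q L n) (v_mass n (ltn_ord n)).
  rewrite (exchange_big_dep predT)//=; apply: ler_sum => i _.
  rewrite /fine_weight; case: ifPn => [iM|_].
    rewrite (bigD1 (Ordinal iM))//= lerDl; apply: sumr_ge0 => n _.
    by rewrite mulr_ge0// mulr_ge0 ?powR_ge0.
  by rewrite mulr0; apply: sumr_ge0 => n _; rewrite mulr_ge0// mulr_ge0 ?powR_ge0.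
- under eq_bigr do rewrite coarseE mulrCA.
  rewrite -mulr_sumr ler_wpM2l//.
  exact: le_trans (sum_coarse_power_le p q m mu p0 pq mom Q L M) tail_mean.
- under eq_bigr do rewrite coarseE.
  rewrite -mulr_sumr mulrCA ler_wpM2l// mulrC ler_pdivrMr//.
  move: tail; rewrite /bad_tail -leNgt mulrC; apply: le_trans.
  by apply: ler_sum => j _; rewrite ffunE.
- apply: (@le_trans _ _ (kap * (2 `^ p * \sum_(n < M) \sum_(k < L.+1 | (L - k <= ell n)%N)
    2 `^ (p * (n%:R - (L - k)%:R)) * y n (L - k)))); last first.
    by rewrite ler_wpM2l// ler_wpM2l ?powR_ge0.
  rewrite [X in _ * (_ * X)](exchange_big_dep predT)//= 2!mulr_sumr; apply: ler_sum => k _.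
  have kL : (k <= L)%N by rewrite -ltnS.
  rewrite 2!mulr_sumr.
  pose D (g : @leaf d Q L) : R := `|\sum_(i | cell Q L k i == g) a i -
     N%:R^-1 * \sum_(j < N) (cell Q L k (lab (X j)) == g)%:R|.
  have D0 (g : @leaf d Q L) : g \notin cells_of Q L g.1 k -> D g = 0.
    move=> gn; have ng i : (cell Q L k i == g) = false.
      apply/negP => /eqP ig; move: gn; rewrite -ig cell_annulus//.
      by move/negP; apply; exact: cell_in.
    rewrite /D big_pred0// big1 ?mulr0 ?subrr ?normr0// => j _.
    by rewrite ng.
  apply: (@le_trans _ _ (\sum_(n < M | (L - k <= ell n)%N) \sum_(g in cells_of Q L n k)
     kap * 2 `^ (p * (n%:R - (L - k)%:R + 1)) * D g)); last first.
    apply: ler_sum => n ln; rewrite -mulr_sumr -mulrA ler_wpM2l//.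
    rewrite mulrDr mulr1 powRD ?pnatr_eq0 ?implybT// [_ * 2 `^ p]mulrC -mulrA.
    rewrite ler_wpM2l ?powR_ge0// ler_wpM2l ?powR_ge0//.
    move: cells; rewrite negb_exists => /forallP/(_ (n, k)) /=.
    rewrite ln /= -leNgt; apply: le_trans; rewrite /cell_deviation.
    apply: ler_sum => g _; rewrite /D le_eqVlt; apply/orP; left; apply/eqP.
    by congr (`|_ - _ * _|); apply: eq_bigr => j _; rewrite ffunE.
  rewrite (exchange_big_dep predT)//=; apply: ler_sum => g _.
  rewrite -/(D g); have Dg0 : 0 <= D g by exact: normr_ge0.
  have S0 (P : pred 'I_M) : 0 <= \sum_(n < M | P n)
     kap * 2 `^ (p * (n%:R - (L - k)%:R + 1)) * D g.
    by apply: sumr_ge0 => n _; rewrite !mulr_ge0 ?powR_ge0.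
  rewrite /cell_weight; case: ifPn => [/andP[gM gl]|_]; last by rewrite mul0r; apply: S0.
  have [gc|gc] := boolP (g \in cells_of Q L g.1 k); last first.
    apply: (@le_trans _ _ 0); last exact: S0.
    by rewrite (D0 g gc) mulr0.
  rewrite (bigD1 (Ordinal gM)) ?gl ?gc//= lerDl.
  by apply: sumr_ge0 => n _; rewrite !mulr_ge0 ?powR_ge0.
- by rewrite ler_wpM2l.
Qed.

Lemma bad_event_le :
  product_law N a bad_event <=
    N%:R * (K0 * 2 `^ (- (q * Q%:R))) +
    (expR (K0 * (8 * (q / p)) `^ (q / p)) * (N%:R * (N%:R * x) `^ (- (q / p))) +
    \sum_(n < M) \sum_(k < L.+1 | (L - k <= ell n)%N)
      2 ^+ ((2 ^ (L - k).+1).+1 ^ d) *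
        expR (- (N%:R * (y n (L - k)) ^+ 2 / (8 * B * v n)))).
Proof.
apply: le_trans (product_lawU N a a0 _ _) _; apply: lerD.
  pose outQ (j : 'I_N) : {pred {ffun 'I_N -> @leaf d Q L}} :=
    [pred t : {ffun 'I_N -> @leaf d Q L} |
      t j \in [pred i : @leaf d Q L | (i.1 : nat) == Q]].
  apply: (@le_trans _ _ (\sum_(j < N) product_law N a (outQ j))).
    apply: le_trans (product_law_bigU N a a0 'I_N predT outQ).
    exact: product_law_le.
  set Y := K0 * _.
  have -> : N%:R * Y = \sum_(j < N) Y by rewrite sumr_const card_ord mulr_natl.
  apply: ler_sum => j _; rewrite (product_law_coord N a a1).
  apply: le_trans (mass_annulus_le p q m mu p0 pq mom Q L Q).
  by rewrite le_eqVlt; apply/orP; left; apply/eqP; apply: eq_bigl => i; rewrite inE.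
apply: le_trans (product_lawU N a a0 _ _) _; apply: lerD.
  apply: (heavy_tail N a a0 a1 (coarse_power p Q L M)) => //.
  - by rewrite ltr_pdivlMr// mul1r.
  - exact: moment_const_ge0.
  - move=> i; rewrite coarse_power_ge0 /coarse_power; case: ifP => [ii|_].
      exact: tail_bound.
    by rewrite divr_ge0// mulr_ge0// ltW.
  - exact: le_trans (sum_coarse_power_le p q m mu p0 pq mom Q L M) tail_mean.
  - exact: (sum_coarse_power_moment_le p q m mu p0 pq mom Q L M).
rewrite pair_big_dep /=.
apply: le_trans (product_law_bigU N a a0 _ (fun nk : 'I_M * 'I_L.+1 => (L - nk.2 <= ell nk.1)%N)
  (fun nk => [pred t | y nk.1 (L - nk.2) < cell_deviation nk.1 nk.2 t])) _.
apply: ler_sum => -[n k] /= ln.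
have kL : (k <= L)%N by rewrite -ltnS.
apply: le_trans (partition_deviation N a a0 a1 (cell Q L k) (cells_of Q L n k)
  (y n (L - k)) (v n) B N0 _ (v0 n) B1 (y0 _ _) (y_le n _ (ltn_ord n) ln)) _.
  apply: le_trans (v_mass n (ltn_ord n)).
  apply: le_trans (mass_annulus_le p q m mu p0 pq mom Q L n).
  rewrite [leLHS]big_mkcond [leRHS]big_mkcond; apply: ler_sum => i _.
  rewrite inE cell_annulus//; case: eqP => //= _; by case: ifP.
rewrite ler_pM2r ?expR_gt0// ler_weXn2l ?ler1n//.
exact: card_cells_of.
Qed.

(* [y n l] is the discrepancy allowed over the cells of annulus [n] at level [l], and
   [v n] bounds the mass of the annulus. *)
Lemma multiscale_deviation (dO : measure_display) (Omega : measurableType dO)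
    (P : probability Omega R) (X : nat -> {RV P >-> Rd R d}) : iid_law mu X ->
  (P [set w | (kap * (3 + 2 `^ p) * x)%:E <
       transport_cost p mu (empirical N (fun i => X i w))]%E <=
    (N%:R * (K0 * 2 `^ (- (q * Q%:R))) +
    (expR (K0 * (8 * (q / p)) `^ (q / p)) * (N%:R * (N%:R * x) `^ (- (q / p))) +
    \sum_(n < M) \sum_(k < L.+1 | (L - k <= ell n)%N)
      2 ^+ ((2 ^ (L - k).+1).+1 ^ d) *
        expR (- (N%:R * (y n (L - k)) ^+ 2 / (8 * B * v n)))))%:E)%E.
Proof.
move=> iid.
have [mE PE] := iid_product_law mu lab (measurable_leaf_label Q L) _ _ P X N bad_event iid.
apply: le_trans (le_trans PE _); last by rewrite lee_fin; exact: bad_event_le.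
apply: le_measure; rewrite ?inE//.
  apply: (measurable_transport_cost _ _ _ _ _ _ _ _ (fun i w => X i w)) => //.
  by rewrite !mulr_ge0 ?cost_const_ge0 ?addr_ge0 ?powR_ge0 ?(ltW x0).
move=> w /= xT; apply: contraT => good; move: xT.
by rewrite ltNge (good_transport_cost_le _ good).
Qed.

End MultiscaleDeviation.

Lemma sum_levels (V : nmodType) (F : nat -> V) (L e : nat) : (e <= L)%N ->
  \sum_(k < L.+1 | (L - k <= e)%N) F (L - k)%N = \sum_(l < e.+1) F l.
Proof.
move=> eL; rewrite (reindex_inj rev_ord_inj) /=.
rewrite (big_ord_widen L.+1 F)//; apply: eq_big => [l|l _].
  by rewrite subSS subKn -1?ltnS.
by rewrite subSS subKn -1?ltnS.
Qed.

(** * Choice of the thresholds *)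

Section Core.
Context {R : realType} (d : nat).
Variables (p q m : R).
Hypothesis d0 : (0 < d)%N.
Hypothesis p0 : 0 < p.
Hypothesis pq : p < q.

Definition scale_const : R := @cost_const R d p * (3 + 2 `^ p).
(** The factor 4 turns the first half of [crossover] into [tail_mean], whose right-hand side is a
    quarter of the threshold. *)
Definition mass_const : R := 4 * moment_const q m.
(** The first summand pays for sample points beyond [Q], where [2^(p Q)] is at least a quarter of
    [N x / scale_const]; the second comes from [heavy_tail]. The last factor undoes the rescaling of
    [x]. *)
Definition tail_const : R :=
  (moment_const q m * 4 `^ (q / p) +
   expR (moment_const q m * (8 * (q / p)) `^ (q / p))) * scale_const `^ (q / p).
Definition gauss_const (delta : R) : R :=
  (1 - expR (- (1 / 2)))^-1 * (1 - expR (- (delta / 2)))^-1.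

Local Notation K0 := (moment_const q m).
Local Notation K := mass_const.

Lemma moment_const_gt0 : 0 < K0.
Proof. by rewrite mulr_gt0 ?powR_gt0// ltr_pwDl. Qed.

Lemma mass_const_gt0 : 0 < K.
Proof. by rewrite mulr_gt0// moment_const_gt0. Qed.

Lemma scale_const_gt0 : 0 < scale_const.
Proof.
rewrite mulr_gt0 ?ltr_pwDl ?powR_ge0//.
by rewrite /cost_const powR_gt0// mulr_gt0// sqrtr_gt0 ltr0n.
Qed.

Lemma tail_const_gt0 : 0 < tail_const.
Proof.
rewrite mulr_gt0 ?powR_gt0 ?scale_const_gt0// ltr_pwDr ?expR_gt0//.
by rewrite mulr_ge0 ?powR_ge0// ltW// moment_const_gt0.
Qed.

Lemma gauss_const_gt0 (delta : R) : 0 < delta -> 0 < gauss_const delta.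
Proof.
by move=> delta0; rewrite mulr_gt0// invr_gt0 subr_gt0 -[ltRHS]expR0 ltr_expR; lra.
Qed.

(* [M] is the first annulus beyond which the mean of [|y|^p] is negligible against [x]. *)
Definition crossover (x : R) (M : nat) : Prop :=
  K <= 2 `^ ((q - p) * M%:R) * (x / scale_const) /\
  forall n, (n < M)%N -> 2 `^ ((q - p) * n%:R) * (x / scale_const) < K.

Lemma powR2_exceeds (t z : R) : 0 < t -> exists n : nat, z <= 2 `^ (t * n%:R).
Proof.
move=> t0; exists (Num.truncn (2 * `|z| / t)).+1; set n := (Num.truncn (2 * `|z| / t)).+1.
have h : 2 * `|z| / t < n%:R by rewrite truncnS_gt.
have tn0 : 0 <= t * n%:R :> R by rewrite mulr_ge0// ltW.
apply: le_trans (powR2_ge_linear _ tn0).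
move: h; rewrite ltr_pdivrMr// => h; have := ler_norm z.
by rewrite mulrC in h; lra.
Qed.

Lemma crossover_exists (x : R) : 0 < x -> exists M, crossover x M.
Proof.
move=> x0; have x10 : 0 < x / scale_const by rewrite divr_gt0// scale_const_gt0.
have ex : exists M : nat, K <= 2 `^ ((q - p) * M%:R) * (x / scale_const).
  have [n nP] := @powR2_exceeds (q - p) (K / (x / scale_const)) ltac:(by rewrite subr_gt0).
  by exists n; rewrite -ler_pdivrMr.
exists (ex_minn ex); case: ex_minnP => M MK Mmin; split=> // n nM.
by rewrite ltNge; apply/negP => /Mmin; rewrite leqNgt nM.
Qed.

Lemma crossover_gt0 (x : R) M : crossover x M -> (0 < M)%N -> x < K * scale_const.
Proof.
move=> [_ H] /H; rewrite mulr0 powRr0 mul1r ltr_pdivrMr//.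
exact: scale_const_gt0.
Qed.

(** Here [r n] is the discrepancy allowed in annulus [n], rescaled, over its mass bound. The last
    hypothesis puts each Bernstein exponent above [A 2^(d l + delta n)]. Half of that absorbs the
    sign patterns of at most [3^d 2^(d l)] cells, whence [A >= 2 3^d]; the other half is summed over
    [n] and [l]. *)
Lemma deviation_core (mu : probability (Rd R d) R) (dO : measure_display)
    (Omega : measurableType dO) (P : probability Omega R)
    (X : nat -> {RV P >-> Rd R d}) (N M : nat) (x A delta : R) (w : nat -> R)
    (ell : nat -> nat) (u : nat -> nat -> R) :
  moment q mu = m%:E -> iid_law mu X -> (0 < N)%N -> 0 < x -> crossover x M ->
  let r n := x / scale_const * w n * 2 `^ ((q - p) * n%:R) / K in
  (forall n, (n < M)%N -> 0 < w n) -> \sum_(n < M) w n <= 1 ->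
  (forall n, (n < M)%N -> 1 <= r n * 2 `^ (p * (ell n)%:R) /\
     forall l, (l <= ell n)%N -> r n * 2 `^ (p * l%:R) <= 2 `^ p) ->
  (forall n l, 0 <= u n l) ->
  (forall n, (n < M)%N -> \sum_(l < (ell n).+1) u n l <= 1) ->
  2 * 3 ^+ d <= A -> 0 < delta ->
  (forall n l, (n < M)%N -> (l <= ell n)%N ->
     A * (2 `^ (d%:R * l%:R) * 2 `^ (delta * n%:R)) <=
     N%:R * (K * 2 `^ (- (q * n%:R))) * (r n ^+ 2 * 2 `^ (2 * p * l%:R)) *
       u n l ^+ 2 / (8 * 2 `^ p)) ->
  (P [set w | x%:E < transport_cost p mu (empirical N (fun i => X i w))]%E <=
   (tail_const * (N%:R * (N%:R * x) `^ (- (q / p))) +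
    gauss_const delta * expR (- (A / 2)) * (0 < M)%:R)%:E)%E.
Proof.
move=> mom iid N0 x0 [MK Mlt] r w0 w1 ellP u0 u1 A0 delta0 expo.
have NR : 0 < N%:R :> R by rewrite ltr0n.
have sc := scale_const_gt0.
set x1 := x / scale_const in MK Mlt r ellP expo *.
have x10 : 0 < x1 by rewrite divr_gt0.
have xE : x = scale_const * x1 by rewrite /x1 mulrC divfK// gt_eqF.
clearbody x1.
have K00 := moment_const_gt0; have KK := mass_const_gt0.
have KK0 : K0 <= K by rewrite /mass_const; lra.
have rho0 : 0 < q - p by rewrite subr_gt0.
have q0 : 0 < q by apply: lt_trans pq.
pose v n : R := K * 2 `^ (- (q * n%:R)).
have v0 n : 0 < v n by rewrite mulr_gt0// powR_gt0.
have w_le1 n : (n < M)%N -> w n <= 1.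
  move=> nM; apply: le_trans w1; rewrite (bigD1 (Ordinal nM))//= lerDl.
  by apply: sumr_ge0 => i _; exact/ltW/w0.
have u_le1 n l : (n < M)%N -> (l <= ell n)%N -> u n l <= 1.
  move=> nM ln; apply: le_trans (u1 n nM).
  by rewrite (bigD1 (Ordinal (ln : (l < (ell n).+1)%N)))//= lerDl sumr_ge0.
have rv n : x1 * w n * 2 `^ (- (p * n%:R)) = r n * v n.
  have -> : - (p * n%:R) = (q - p) * n%:R + - (q * n%:R) by ring.
  rewrite powR2D /r /v; field; exact: lt0r_neq0.
pose wM n := if (n < M)%N then w n else 0.
have wM0 n : 0 <= wM n by rewrite /wM; case: ifP => // /w0/ltW.
(* Chosen so that [2^(p (n - l)) y n l = x1 w n u n l]: the shares then add up to at most [x1]. The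
   variant [wM] vanishes from [M] on, where [w] may be negative. *)
pose y n l : R := x1 * wM n * 2 `^ (- (p * n%:R)) * 2 `^ (p * l%:R) * u n l.
have y0 n l : 0 <= y n l.
  by rewrite /y !mulr_ge0 ?powR_ge0 ?(ltW x10) ?wM0 ?u0.
have yE n l : (n < M)%N -> y n l = v n * (r n * 2 `^ (p * l%:R)) * u n l.
  by move=> nM; rewrite /y /wM nM rv; ring.
(* Before [M'] one sample point contributes at most the truncation level of [heavy_tail]; from [M']
   on, a union bound over the sample is within the tail term. *)
have [M' M'P] : exists M', N%:R * x1 / 4 < 2 `^ (p * M'%:R) /\
    forall n, (n < M')%N -> 2 `^ (p * n%:R) <= N%:R * x1 / 4.
  have ex : exists n : nat, N%:R * x1 / 4 < 2 `^ (p * n%:R).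
    have [n nP] := powR2_exceeds p (N%:R * x1 / 4 + 1) p0.
    by exists n; apply: lt_le_trans nP; rewrite ltrDl.
  exists (ex_minn ex); case: ex_minnP => M' M'x M'min; split=> // n nM'.
  by rewrite leNgt; apply/negP => /M'min; rewrite leqNgt nM'.
pose Q := maxn M M'.
pose L := (\max_(n < M) ell n)%N.
have ellL n : (n < M)%N -> (ell n <= L)%N.
  by move=> nM; exact: (leq_bigmax (Ordinal nM)).
have tail_mean : K0 * 2 `^ (- ((q - p) * M%:R)) <= x1 / 4.
  rewrite powRN ler_pdivrMr ?powR_gt0// [leRHS]mulrC mulrA; move: MK.
  by rewrite /mass_const; set z := 2 `^ _ * x1; lra.
have tail_bound n : (M <= n < Q)%N -> 2 `^ (p * n%:R) <= N%:R * x1 / 4.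
  move=> /andP[Mn nQ]; apply: M'P.2; move: nQ; rewrite /Q leq_max ltnNge Mn.
  exact.
have v_mass n : (n < M)%N -> K0 * 2 `^ (- (q * n%:R)) <= v n.
  by move=> _; apply: ler_wpM2r; [exact: powR_ge0|exact: KK0].
have B1 : 1 <= 2 `^ p :> R.
  by apply: le_trans (powR2_ge_linear p (ltW p0)); rewrite lerDl divr_ge0// ltW.
have y_le n l : (n < M)%N -> (l <= ell n)%N -> y n l <= 2 `^ p * v n.
  move=> nM ln; rewrite yE// -[leRHS]mulr1 [2 `^ p * _]mulrC.
  have r0 : 0 <= r n.
    by rewrite /r !mulr_ge0 ?powR_ge0 ?invr_ge0 ?(ltW x10) ?(ltW (w0 n nM)) ?(ltW KK).
  have vn := ltW (v0 n); apply: ler_pM; last exact: u_le1.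
  - exact: mulr_ge0 vn (mulr_ge0 r0 (powR_ge0 _ _)).
  - exact: u0.
  - by apply: ler_wpM2l vn _ _ _; apply: (ellP n nM).2.
have fine_le : \sum_(n < M) 2 `^ (p * (n%:R - (ell n)%:R)) * v n <= x1.
  apply: (@le_trans _ _ (\sum_(n < M) x1 * w n)); last first.
    by rewrite -mulr_sumr -[leRHS]mulr1 ler_wpM2l// ltW.
  apply: ler_sum => n _.
  have nM := ltn_ord n.
  have [r1 _] := ellP n nM.
  have -> : x1 * w n = r n * v n * 2 `^ (p * n%:R).
    by rewrite -rv -mulrA -powR2D addNr powRr0 mulr1.
  have -> : p * (n%:R - (ell n)%:R) = p * n%:R + - (p * (ell n)%:R) by ring.
  have r2 : 2 `^ (- (p * (ell n)%:R)) <= r n.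
    by rewrite powRN -[leLHS]mul1r ler_pdivrMr ?powR_gt0.
  rewrite powR2D -mulrA mulrC; apply: ler_wpM2r; first exact: powR_ge0.
  by apply: ler_wpM2r r2; exact: ltW.
have cells_le : \sum_(n < M) \sum_(k < L.+1 | (L - k <= ell n)%N)
    2 `^ (p * (n%:R - (L - k)%:R)) * y n (L - k)%N <= x1.
  apply: (@le_trans _ _ (\sum_(n < M) x1 * w n)); last first.
    by rewrite -mulr_sumr -[leRHS]mulr1 ler_wpM2l// ltW.
  apply: ler_sum => n _; have nM := ltn_ord n.
  have /= -> := (sum_levels _ (fun l => 2 `^ (p * (n%:R - l%:R)) * y n l) L _ (ellL n nM)).
  rewrite (eq_bigr (fun l : 'I_(ell n).+1 => x1 * w n * u n l)); last first.
    move=> l _; rewrite /y /wM nM !mulrA.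
    have -> : p * (n%:R - l%:R) = - - (p * n%:R) + - (p * l%:R) by ring.
    rewrite powR2D !powRN invrK; field; rewrite !lt0r_neq0 ?powR_gt0//.
  by rewrite -mulr_sumr -[leRHS]mulr1 ler_wpM2l ?u1// mulr_ge0 ?ltW ?w0.
have := multiscale_deviation p q m mu p0 pq mom M Q L N ell x1 (2 `^ p) y v
  (leq_maxl _ _) ellL N0 x10 tail_mean tail_bound v0 v_mass y0 B1 y_le fine_le cells_le
  _ _ P X iid.
rewrite -/scale_const -xE => H; apply: (le_trans H); rewrite lee_fin {H}.
rewrite addrA; apply: lerD.
  have s0 : 0 < q / p by rewrite divr_gt0.
  have TE : (N%:R * x1) `^ (- (q / p)) = scale_const `^ (q / p) * (N%:R * x) `^ (- (q / p)).
    rewrite xE !powRN mulrCA (powRM _ (ltW sc)) ?mulr_ge0 ?(ltW NR) ?(ltW x10)//.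
    by rewrite invfM mulrA divff ?mul1r// gt_eqF// powR_gt0.
  rewrite TE; set T := (N%:R * x) `^ _.
  have -> : tail_const * (N%:R * T) =
     N%:R * (K0 * (4 `^ (q / p) * (scale_const `^ (q / p) * T))) +
     expR (K0 * (8 * (q / p)) `^ (q / p)) * (N%:R * (scale_const `^ (q / p) * T)).
    by rewrite /tail_const; ring.
  rewrite lerD2r ler_wpM2l ?ler0n// ler_wpM2l ?(ltW K00)// /T -TE.
  have -> : 2 `^ (- (q * Q%:R)) = (2 `^ (p * Q%:R)) `^ (- (q / p)) :> R.
    by rewrite -powRrM; congr (_ `^ _); field; exact: lt0r_neq0.
  have [M'1 _] := M'P.
  have Q1 : N%:R * x1 / 4 <= 2 `^ (p * Q%:R).
    apply: (le_trans (ltW M'1)); apply: ler_powR2; rewrite ler_wpM2l ?(ltW p0)//.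
    by rewrite ler_nat leq_maxr.
  have Nx4 : 0 < N%:R * x1 / 4 by rewrite divr_gt0// mulr_gt0.
  apply: (@le_trans _ _ ((N%:R * x1 / 4) `^ (- (q / p)))).
    rewrite !powRN lef_pV2 ?posrE ?powR_gt0//.
    by apply: ge0_ler_powR; rewrite ?nnegrE ?powR_ge0 ?(ltW s0) ?(ltW Nx4).
  have Nx10 : 0 <= N%:R * x1 by rewrite mulr_ge0// ltW.
  have i40 : 0 <= 4^-1 :> R by rewrite invr_ge0.
  have i4 : 4^-1 `^ (- (q / p)) = 4 `^ (q / p) :> R.
    have n4 : 0 <= 4 :> R by [].
    by rewrite -(powR_inv1 n4) -powRrM mulN1r opprK.
  by rewrite (powRM _ Nx10 i40) i4 mulrC.
have [M0|M0] := posnP M.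
  by rewrite mulr0 big1// => n; have := ltn_ord n; rewrite {2}M0.
rewrite mulr1; have [A2 d1] : 2 <= A /\ 1 <= d%:R :> R.
  by rewrite ler1n d0; split=> //; apply: le_trans A0; rewrite ler_peMr// exprn_ege1// ler1n.
apply: le_trans (sum_doubly_exponential_le A delta d%:R M ell A2 delta0 d1).
apply: ler_sum => n _; have nM := ltn_ord n.
have /= -> := (sum_levels _ (fun l => 2 ^+ ((2 ^ l.+1).+1 ^ d) *
  expR (- (N%:R * y n l ^+ 2 / (8 * 2 `^ p * v n)))) L _ (ellL n nM)).
apply: ler_sum => l _; have ln : (l <= ell n)%N by rewrite -ltnS.
set W := 2 `^ (d%:R * l%:R) * 2 `^ (delta * n%:R).
have e2 : 2 <= expR 1 :> R by apply: le_trans (expR_ge1Dx 1); lra.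
apply: (@le_trans _ _ (expR ((2 ^ l.+1).+1 ^ d)%:R * expR (- (A * W)))).
  apply: ler_pM; rewrite ?exprn_ge0 ?expR_ge0//.
    by rewrite -[X in expR X]mulr1 expRM_natl lerXn2r ?nnegrE ?expR_ge0.
  rewrite ler_expR lerN2 (le_trans (expo n l nM ln))// yE//.
  rewrite le_eqVlt; apply/orP; left; apply/eqP.
  have -> : 2 `^ (2 * p * l%:R) = (2 `^ (p * l%:R)) ^+ 2 :> R.
    rewrite -[RHS](powR_mulrn 2 (powR_ge0 _ _)) -powRrM; congr (_ `^ _); ring.
  by rewrite -/(v n); field; rewrite !lt0r_neq0 ?powR_gt0.
rewrite -expRD ler_expR.
have AW : A * W = A / 2 * W + A / 2 * W by field.
suff : ((2 ^ l.+1).+1 ^ d)%:R <= A / 2 * W by rewrite AW; set z := A / 2 * W => ?; lra.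
have W1 : (3 ^ d * 2 ^ (d * l))%:R <= 3 ^+ d * W.
  rewrite natrM !natrX ler_wpM2l ?exprn_ge0// /W -powR_mulrn// natrM.
  rewrite -[leLHS]mulr1 ler_wpM2l ?powR_ge0//.
  by rewrite -[leLHS](powRr0 2) ler_powR2// mulr_ge0// ltW.
apply: (@le_trans _ _ (3 ^ d * 2 ^ (d * l))%:R).
  rewrite ler_nat [(d * l)%N]mulnC expnM -expnMn leq_exp2r// expnS.
  by rewrite (mulSn 2) -[X in (X <= _)%N]add1n leq_add2r expn_gt0.
apply: (le_trans W1); rewrite ler_wpM2r ?mulr_ge0 ?powR_ge0//; lra.
Qed.

End Core.

(** * Sharing the discrepancy of an annulus among its levels *)

Section LevelWeights.
Context {R : realType} (d : nat) (p : R).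
Hypothesis p0 : 0 < p.

(* [u l] is the share of level [l] in the discrepancy allowed in an annulus, and [r] is the
   ratio of that discrepancy, rescaled, to the mass of the annulus; [phi] is the resulting
   rate. *)
Definition level_weights (phi : R -> R) : Prop :=
  exists2 c : R, 0 < c & forall r : R, 0 < r -> r <= 1 ->
  exists (ell : nat) (u : nat -> R),
  [/\ 1 <= r * 2 `^ (p * ell%:R),
      forall l, (l <= ell)%N -> r * 2 `^ (p * l%:R) <= 2 `^ p,
      forall l, 0 <= u l, \sum_(l < ell.+1) u l <= 1 &
      forall l, (l <= ell)%N ->
        c * (phi r * 2 `^ (d%:R * l%:R)) <= r ^+ 2 * 2 `^ (2 * p * l%:R) * u l ^+ 2].

Lemma powR2_sqr (t : R) : 2 `^ (2 * t) = (2 `^ t) ^+ 2 :> R.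
Proof. by rewrite -powR_mulrn ?powR_ge0// -powRrM mulrC. Qed.

(** Since [s p > d], the coarse levels are the critical ones. Shares decaying like [2^(- g l)] have
    squares that consume exactly the surplus [2^((s p - d) l)]. *)
Lemma level_weights_supercritical (s : R) : 2 <= s -> d%:R < s * p ->
  level_weights (fun r => r `^ s).
Proof.
move=> s2 sp; pose g := (s * p - d%:R) / 2.
have g0 : 0 < g by rewrite divr_gt0// subr_gt0.
have z0 : 0 < 1 - 2 `^ (- g) :> R by rewrite subr_gt0; exact: powR2N_lt1.
exists (2 `^ (- (p * (s - 2))) * (1 - 2 `^ (- g)) ^+ 2).
  by rewrite mulr_gt0 ?powR_gt0 ?exprn_gt0.
move=> r r0 r1; have [ell [l1 l2]] := level_exists p r p0 r0 r1.
exists ell, (fun l => (1 - 2 `^ (- g)) * 2 `^ (- (g * l%:R))); split=> //.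
- by move=> l; rewrite mulr_ge0 ?powR_ge0 ?(ltW z0).
- exact: sum_powR2_le.
move=> l ll; have low := exponent_lower p s r l%:R r0 s2 (l2 l ll).
have -> : 2 `^ (d%:R * l%:R) = 2 `^ (s * p * l%:R) * (2 `^ (- (g * l%:R))) ^+ 2 :> R.
  by rewrite -powR2_sqr -powR2D; congr (_ `^ _); rewrite /g; field.
set e := 2 `^ (- (g * l%:R)); set z := 1 - 2 `^ (- g).
have := ler_wpM2r (sqr_ge0 (z * e)) low; congr (_ <= _); ring.
Qed.

(** Now the finest level is critical, so the shares decay away from it. At distance [t = ell - l]
    the factor [(r 2^(p l))^(2 - s)] gains [2^((d - 2p) t)], half of which pays for the squared
    shares. *)
Lemma level_weights_subcritical (s : R) : 2 < s -> d%:R = s * p ->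
  level_weights (fun r => r `^ s).
Proof.
move=> s2 sp; pose g := (d%:R - 2 * p) / 4.
have g0 : 0 < g by rewrite divr_gt0// subr_gt0 sp ltr_pM2r.
have z0 : 0 < 1 - 2 `^ (- g) :> R by rewrite subr_gt0; exact: powR2N_lt1.
exists (2 `^ (- (p * (s - 2))) * (1 - 2 `^ (- g)) ^+ 2).
  by rewrite mulr_gt0 ?powR_gt0 ?exprn_gt0.
move=> r r0 r1; have [ell [l1 l2]] := level_exists p r p0 r0 r1.
exists ell, (fun l => (1 - 2 `^ (- g)) * 2 `^ (- (g * (ell%:R - l%:R)))); split=> //.
- by move=> l; rewrite mulr_ge0 ?powR_ge0 ?(ltW z0).
- exact: (sum_powR2_rev_le g ell.+1).
move=> l ll; rewrite (powR_base_split p s r l%:R r0) -sp.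
have rl : r * 2 `^ (p * l%:R) <= 2 `^ (p - p * (ell%:R - l%:R)).
  have -> : p * l%:R = p * ell%:R + - (p * (ell%:R - l%:R)) by ring.
  by rewrite !powR2D mulrA ler_wpM2r ?powR_ge0// l2.
have low : 2 `^ (- (p * (s - 2))) <=
    (r * 2 `^ (p * l%:R)) `^ (2 - s) * (2 `^ (- (g * (ell%:R - l%:R)))) ^+ 2.
  rewrite -powR2_sqr.
  have h : 2 `^ ((p - p * (ell%:R - l%:R)) * (2 - s)) <= (r * 2 `^ (p * l%:R)) `^ (2 - s).
    rewrite (powRrM _ _ (2 - s)) -(opprB s 2) !powRN lef_pV2 ?posrE ?powR_gt0 ?mulr_gt0 ?powR2_gt0//.
    apply: ge0_ler_powR; rewrite ?nnegrE ?mulr_ge0 ?powR_ge0 ?(ltW r0)//.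
    by rewrite subr_ge0 ltW.
  apply: le_trans (ler_wpM2r (powR_ge0 _ _) h).
  rewrite -powR2D; apply: ler_powR2.
  have lle : 0 <= ell%:R - l%:R :> R by rewrite subr_ge0 ler_nat.
  have := mulr_ge0 (ltW g0) lle; have := p0; rewrite /g sp.
  move: (ell%:R - l%:R) => t; clear -s2; move=> p0 h; nra.
set e := 2 `^ (- (g * _)) in low *; set z := 1 - 2 `^ (- g).
have D0 : 0 <= r `^ s * 2 `^ (d%:R * l%:R) * z ^+ 2.
  by rewrite mulr_ge0 ?sqr_ge0// mulr_ge0 ?powR_ge0.
have := ler_wpM2l D0 low; congr (_ <= _); ring.
Qed.

(** For [d = 2p] all levels cost the same, so the shares are equal. The logarithm is the number of
    levels, which [r 2^(p ell) <= 2^p] and [ln 2 >= 1/2] bound by [(2p + 4)/p] times [1 - ln r]. *)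
Lemma level_weights_critical : d%:R = 2 * p ->
  level_weights (fun r => (r / (1 - ln r)) ^+ 2).
Proof.
move=> dp; exists ((p / (2 * p + 4)) ^+ 2).
  by rewrite exprn_gt0// divr_gt0// addr_gt0// mulr_gt0.
move=> r r0 r1; have [ell [l1 l2]] := level_exists p r p0 r0 r1.
exists ell, (fun=> ell.+1%:R^-1); split=> //.
- by rewrite sumr_const card_ord -[leLHS]mulr_natr mulVf.
move=> l ll; have -> : 2 `^ (2 * p * l%:R) = 2 `^ (d%:R * l%:R) :> R by rewrite dp.
have lnr : ln r <= 0 by exact: ln_le0.
have ln2_ge := @ln2_ge_half R.
have ell_le : ell.+1%:R <= (2 * p + 4) / p * (1 - ln r) :> R.
  have : ln (r * 2 `^ (p * ell%:R)) <= ln (2 `^ p) :> R.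
    by rewrite ler_ln ?l2// posrE ?mulr_gt0 ?powR2_gt0.
  rewrite lnM ?posrE ?powR2_gt0// !ln_powR -natr1 => h.
  rewrite mulrAC ler_pdivlMr//.
  have e0 : 0 <= ell%:R :> R by [].
  have pe : 0 <= p * ell%:R by rewrite mulr_ge0// ltW.
  have := p0; move: lnr ln2_ge h pe; move: (ln r) (ln 2) => a b; clear -R.
  move=> a0 b0 h pe pp.
  have [small|big] := leP (p * ell%:R) p; first nra.
  nra.
have o1 : 0 < 1 - ln r by rewrite subr_gt0 (le_lt_trans lnr).
have P4 : 0 < 2 * p + 4 by rewrite addr_gt0// mulr_gt0.
have low : p / (2 * p + 4) / (1 - ln r) <= ell.+1%:R^-1.
  have -> : p / (2 * p + 4) / (1 - ln r) = ((2 * p + 4) / p * (1 - ln r))^-1.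
    by field; rewrite !lt0r_neq0.
  by rewrite lef_pV2 ?posrE// !mulr_gt0 ?invr_gt0.
have low2 : (p / (2 * p + 4) / (1 - ln r)) ^+ 2 <= ell.+1%:R^-1 ^+ 2.
  by rewrite lerXn2r ?nnegrE ?invr_ge0// ltW// !divr_gt0.
have D0 : 0 <= r ^+ 2 * 2 `^ (d%:R * l%:R) by rewrite mulr_ge0 ?sqr_ge0 ?powR_ge0.
have := ler_wpM2l D0 low2; congr (_ <= _); ring.
Qed.

End LevelWeights.

(** * From shares to a deviation bound *)

Section RateDeviation.
Context {R : realType} (d : nat).
Variables (p q m : R).
Hypothesis d0 : (0 < d)%N.
Hypothesis p0 : 0 < p.
Hypothesis pq : p < q.
Local Notation K := (mass_const q m).
Local Notation sc := (scale_const d p).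

(* [w n] is the share of annulus [n] in the allowed discrepancy. *)
Definition annulus_weights (phi psi : R -> R) : Prop :=
  exists c delta : R, [/\ 0 < c, 0 < delta &
  forall (x : R) (M : nat), 0 < x -> (0 < M)%N -> crossover d p q m x M ->
  exists w : nat -> R, [/\ forall n, (n < M)%N -> 0 < w n, \sum_(n < M) w n <= 1 &
    forall n, (n < M)%N -> c * psi x * 2 `^ (delta * n%:R) <=
      K * 2 `^ (- (q * n%:R)) * phi (x / sc * w n * 2 `^ ((q - p) * n%:R) / K)]].

(** Before the crossover the allowed discrepancy is below the mass bound even for a full share; this
    is what makes [level_weights] applicable. *)
Lemma annulus_ratio_le1 (x : R) (M n : nat) (w : R) :
  crossover d p q m x M -> (n < M)%N -> 0 <= w <= 1 -> 0 < x ->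
  x / sc * w * 2 `^ ((q - p) * n%:R) / K <= 1.
Proof.
move=> [_ Mlt] nM /andP[w0 w1] x0.
have KK := mass_const_gt0 q m; have sc0 := scale_const_gt0 d p d0.
rewrite ler_pdivrMr// mul1r -mulrA mulrCA.
apply: le_trans (ltW (Mlt n nM)); rewrite [leRHS]mulrC -[leRHS]mul1r.
by rewrite ler_wpM2r// !mulr_ge0 ?powR_ge0 ?invr_ge0 ?ltW.
Qed.

(** The two kinds of shares multiply: every Bernstein exponent exceeds [A 2^(d l + delta n)] with
    [A] proportional to [N psi x]. The indicator appears because a near annulus exists only for [x]
    below [K sc]. *)
Lemma deviation_of_weights (phi psi : R -> R) :
  level_weights d p phi -> annulus_weights phi psi ->
  deviation_bound d p q m (fun c N x =>
    expR (- (c * (N%:R * psi x))) * (x < K * sc)%R%:R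
    + N%:R * (N%:R * x) `^ (- (q / p))).
Proof.
move=> [c1 c10 levels] [c2 [delta [c20 delta0 annuli]]].
have KK := mass_const_gt0 q m; have sc0 := scale_const_gt0 d p d0.
have tc := tail_const_gt0 d p q m d0.
have gc := gauss_const_gt0 delta delta0.
have p8 : 0 < 8 * 2 `^ p :> R by rewrite mulr_gt0// powR_gt0.
pose c3 := c2 * (c1 / (8 * 2 `^ p)).
have c30 : 0 < c3 by rewrite mulr_gt0// divr_gt0.
pose A0 : R := 2 * 3 ^+ d.
exists (c3 / 2), (tail_const d p q m + gauss_const delta + expR (A0 / 2)).
split; first by rewrite divr_gt0.
  by rewrite !addr_gt0// expR_gt0.
move=> mu mom dO Omega P X iid N x N0 x0.
have NR : 0 < N%:R :> R by rewrite ltr0n.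
have [M Mx] := crossover_exists d p q m d0 pq x x0.
have T0 : 0 <= N%:R * (N%:R * x) `^ (- (q / p)) by rewrite mulr_ge0 ?powR_ge0// ltW.
set T := N%:R * (N%:R * x) `^ (- (q / p)) in T0 *.
have E0 := expR_gt0 (A0 / 2).
have [M0|M0] := posnP M.
  rewrite M0 in Mx.
  have H := deviation_core d p q m d0 p0 pq mu dO Omega P X N 0 x A0 1 (fun=> 1)
    (fun=> 0%N) (fun _ _ => 0) mom iid N0 x0 Mx.
  apply: le_trans (H _ _ _ _ _ _ _ _) _ => //.
  - by rewrite big_ord0.
  - rewrite lee_fin mulr0 addr0 -/T mulrDr -[leLHS]add0r lerD//.
      by rewrite !mulr_ge0 ?expR_ge0// !addr_ge0// ltW.
    by rewrite ler_wpM2r// -addrA lerDl addr_ge0// ltW.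
have xK : x < K * sc by exact: crossover_gt0 Mx M0.
rewrite xK mulr1; set A := N%:R * (c3 * psi x).
have -> : c3 / 2 * (N%:R * psi x) = A / 2 by rewrite /A; field.
(* If [A] is too small to absorb the sign patterns, the factor [exp (A0 / 2)] in the constant
   already makes the bound exceed 1. *)
have [A1|A1] := leP A0 A; last first.
  apply: (@le_trans _ _ 1%E).
    apply: probability_le1; apply: measurable_transport_cost => //.
    exact: ltW.
  rewrite lee_fin; apply: (@le_trans _ _ (expR (A0 / 2) * expR (- (A / 2)))).
    by rewrite -expRD -expR0 ler_expR subr_ge0 ler_wpM2r// ltW.
  apply: ler_pM; rewrite ?expR_ge0//; last by rewrite lerDl.
  by rewrite lerDr addr_ge0// ltW.
have [w [w0 w1 wP]] := annuli x M x0 M0 Mx.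
pose r n := x / sc * w n * 2 `^ ((q - p) * n%:R) / K.
have r0 n : (n < M)%N -> 0 < r n.
  by move=> nM; rewrite /r !mulr_gt0 ?invr_gt0 ?powR_gt0 ?w0.
have r1 n : (n < M)%N -> r n <= 1.
  move=> nM; apply: (annulus_ratio_le1 x M n (w n) Mx nM _ x0).
  rewrite ltW ?w0//=; apply: le_trans w1; rewrite (bigD1 (Ordinal nM))//= lerDl.
  by apply: sumr_ge0 => i _; exact/ltW/w0.
have /choice[e eP] : forall n, exists e : nat * (nat -> R), (n < M)%N ->
  [/\ 1 <= r n * 2 `^ (p * e.1%:R),
      forall l, (l <= e.1)%N -> r n * 2 `^ (p * l%:R) <= 2 `^ p,
      forall l, 0 <= e.2 l, \sum_(l < e.1.+1) e.2 l <= 1 &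
      forall l, (l <= e.1)%N -> c1 * (phi (r n) * 2 `^ (d%:R * l%:R)) <=
        r n ^+ 2 * 2 `^ (2 * p * l%:R) * e.2 l ^+ 2].
  move=> n; have [nM|nM] := ltnP n M; last by exists (0%N, fun=> 0).
  by have [ell [u H]] := levels (r n) (r0 n nM) (r1 n nM); exists (ell, u).
pose u n l := if (n < M)%N then (e n).2 l else 0.
have H := deviation_core d p q m d0 p0 pq mu dO Omega P X N M x A delta w
    (fun n => (e n).1) u mom iid N0 x0 Mx w0 w1.
apply: le_trans (H _ _ _ A1 delta0 _) _ => {H}.
- by move=> n nM; have [? ? _ _ _] := eP n nM.
- by move=> n l; rewrite /u; case: ifP => // nM; have [_ _ ? _ _] := eP n nM.
- by move=> n nM; rewrite /u nM; have [_ _ _ ? _] := eP n nM.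
- move=> n l nM ln; rewrite /u nM; have [_ _ _ _ /(_ l ln) H] := eP n nM.
  rewrite -/(r n).
  have v0 : 0 < K * 2 `^ (- (q * n%:R)) by rewrite mulr_gt0// powR_gt0.
  have D0 : 0 < 2 `^ (d%:R * l%:R) :> R by exact: powR_gt0.
  have wn := wP n nM; rewrite -/(r n) in wn.
  have c18 : 0 <= c1 / (8 * 2 `^ p) * 2 `^ (d%:R * l%:R) * N%:R.
    by rewrite !mulr_ge0 ?invr_ge0 ?(ltW c10) ?(ltW p8) ?(ltW D0).
  have V0 : 0 <= N%:R * (K * 2 `^ (- (q * n%:R))) / (8 * 2 `^ p).
    by rewrite divr_ge0 ?(ltW p8)// mulr_ge0 ?(ltW v0).
  have step2 := ler_wpM2l V0 H; move: (ler_wpM2l c18 wn).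
  rewrite [leRHS](_ : _ = N%:R * (K * 2 `^ (- (q * n%:R))) / (8 * 2 `^ p) *
    (c1 * (phi (r n) * 2 `^ (d%:R * l%:R)))); last by ring.
  move=> /le_trans/(_ step2); congr (_ <= _); last by ring.
  by rewrite /A /c3; ring.
rewrite M0 mulr1 lee_fin -/T.
have eA := expR_ge0 (- (A / 2)).
rewrite mulrDr addrC; apply: lerD; apply: ler_wpM2r => //.
  by rewrite addrAC lerDr addr_ge0// ltW.
by rewrite -addrA lerDl addr_ge0// ltW.
Qed.

End RateDeviation.

(** * Sharing the threshold among the annuli *)

Section AnnulusWeights.
Context {R : realType} (d : nat).
Variables (p q m : R).
Hypothesis d0 : (0 < d)%N.
Hypothesis p0 : 0 < p.
Hypothesis pq : p < q.
Local Notation K := (mass_const q m).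
Local Notation sc := (scale_const d p).

Lemma annulus_power (s a x t y : R) : 0 <= a -> 0 <= x ->
  K * 2 `^ (- y) * (a * x * 2 `^ t) `^ s = K * a `^ s * x `^ s * 2 `^ (s * t - y).
Proof.
move=> a0 x0; rewrite (powRM _ (mulr_ge0 a0 x0) (powR_ge0 _ _)) (powRM _ a0 x0).
by rewrite -powRrM [t * s]mulrC powR2D; ring.
Qed.

(** The exponents grow like [2^((s (q - p) - q) n)]. Half of this growth pays for the decreasing
    shares, the other half, [s e], is the [delta] of the definition. *)
Lemma annulus_weights_light (s : R) : 0 < s -> q < s * (q - p) ->
  annulus_weights d p q m (fun r => r `^ s) (fun x => x `^ s).
Proof.
move=> s0 sq; pose e := (s * (q - p) - q) / (2 * s).
have KK := mass_const_gt0 q m; have sc0 := scale_const_gt0 d p d0.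
have e0 : 0 < e by rewrite divr_gt0 ?subr_gt0// mulr_gt0.
have z0 : 0 < 1 - 2 `^ (- e) :> R by rewrite subr_gt0; exact: powR2N_lt1.
set z := 1 - 2 `^ (- e) in z0; pose a := z / (sc * K).
have a0 : 0 < a by rewrite divr_gt0// mulr_gt0.
exists (K * a `^ s), (s * e); split; [by rewrite mulr_gt0 ?powR_gt0|exact: mulr_gt0|].
move=> x M x0 M0 Mx; exists (fun n => z * 2 `^ (- (e * n%:R))); split.
- by move=> n _; rewrite mulr_gt0 ?powR_gt0.
- exact: sum_powR2_le.
move=> n nM.
have -> : x / sc * (z * 2 `^ (- (e * n%:R))) * 2 `^ ((q - p) * n%:R) / K =
    a * x * 2 `^ ((q - p) * n%:R - e * n%:R).
  by rewrite powR2D /a; field; rewrite !lt0r_neq0.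
rewrite annulus_power ?(ltW a0) ?(ltW x0)// le_eqVlt; apply/orP; left; apply/eqP.
congr (_ * 2 `^ _).
by rewrite /e; field; exact: lt0r_neq0.
Qed.

(** As in [annulus_weights_light] with [s = 2]; in addition the ratio is at least [a x], so its
    logarithm is controlled by [ln (2 + 1/x)] uniformly in [n]. *)
Lemma annulus_weights_light_log : q < 2 * (q - p) ->
  annulus_weights d p q m (fun r => (r / (1 - ln r)) ^+ 2)
    (fun x => (x / ln (2 + x^-1)) ^+ 2).
Proof.
move=> sq; pose e := (2 * (q - p) - q) / 4.
have KK := mass_const_gt0 q m; have sc0 := scale_const_gt0 d p d0.
have e0 : 0 < e by rewrite divr_gt0 ?subr_gt0.
have z0 : 0 < 1 - 2 `^ (- e) :> R by rewrite subr_gt0; exact: powR2N_lt1.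
set z := 1 - 2 `^ (- e) in z0; pose a := z / (sc * K).
have a0 : 0 < a by rewrite divr_gt0// mulr_gt0.
pose B := 3 + 2 * `|ln a|.
have B0 : 0 < B by rewrite ltr_pwDl// mulr_ge0.
exists (K * (a / B) ^+ 2), (2 * e); split.
- by rewrite mulr_gt0// exprn_gt0// divr_gt0.
- exact: mulr_gt0.
move=> x M x0 M0 Mx; exists (fun n => z * 2 `^ (- (e * n%:R))); split.
- by move=> n _; rewrite mulr_gt0 ?powR_gt0.
- exact: sum_powR2_le.
move=> n nM.
have r1 := annulus_ratio_le1 d p q m d0 x M n (z * 2 `^ (- (e * n%:R))) Mx nM.
have rE : x / sc * (z * 2 `^ (- (e * n%:R))) * 2 `^ ((q - p) * n%:R) / K =
    a * x * 2 `^ ((q - p) * n%:R - e * n%:R).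
  by rewrite powR2D /a; field; rewrite !lt0r_neq0.
rewrite rE in r1 *; set t := (q - p) * n%:R - e * n%:R in r1 *.
have {r1} : a * x * 2 `^ t <= 1.
  apply: r1 => //; rewrite mulr_ge0 ?powR_ge0 ?(ltW z0)//=.
  rewrite mulr_ile1 ?powR_ge0 ?(ltW z0)//; first by rewrite lerBlDr lerDl powR_ge0.
  by rewrite -[leRHS](powRr0 2) ler_powR2// oppr_le0 mulr_ge0// ltW.
have t0 : 0 <= t.
  rewrite /t -mulrBl mulr_ge0// (_ : q - p - e = (q - p) / 2 + q / 4); last by rewrite /e; field.
  by rewrite addr_ge0// divr_ge0 ?subr_ge0// ltW// (lt_trans p0).
have E1 : 1 <= 2 `^ t :> R by rewrite -[leLHS](powRr0 2) ler_powR2.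
have -> : K * (a / B) ^+ 2 * (x / ln (2 + x^-1)) ^+ 2 * 2 `^ (2 * e * n%:R) =
    K * 2 `^ (- (q * n%:R)) * (a * x * 2 `^ t / (B * ln (2 + x^-1))) ^+ 2.
  have -> : 2 * e * n%:R = - (q * n%:R) + 2 * t by rewrite /t /e; field.
  by rewrite powR2D powR2_sqr [(B * _)^-1]invfM; ring.
set r := a * x * 2 `^ t => r1.
have ax0 : 0 < a * x by rewrite mulr_gt0.
have r0 : 0 < r by rewrite mulr_gt0 ?powR_gt0.
have ln2_ge := @ln2_ge_half R.
have L2 : ln 2 <= ln (2 + x^-1) by rewrite ler_ln ?posrE ?addr_gt0 ?invr_gt0// lerDl invr_ge0 ltW.
have Lx : - ln x <= ln (2 + x^-1).
  by rewrite -lnV ?posrE// ler_ln ?posrE ?addr_gt0 ?invr_gt0// lerDr.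
have lnr : 1 - ln r <= B * ln (2 + x^-1).
  apply: (@le_trans _ _ (1 - ln (a * x))).
    by rewrite lerD2l lerN2 ler_ln ?posrE// ler_peMr// ltW.
  rewrite lnM ?posrE// /B; have := ler_norm (- ln a); rewrite normrN.
  move: Lx L2 ln2_ge; move: (ln (2 + _)) (ln 2) (ln x) (ln a) => u v y b; clear -R.
  move=> h1 h2 h3 h4; have := normr_ge0 b; nra.
have lnr1 : 0 < 1 - ln r by rewrite subr_gt0 (le_lt_trans (ln_le0 r1)).
rewrite ler_wpM2l ?mulr_ge0 ?powR_ge0 ?(ltW KK)//.
rewrite lerXn2r ?nnegrE ?divr_ge0 ?(ltW r0) ?(ltW lnr1)//.
  by rewrite (le_trans (ltW lnr1)).
by rewrite ler_wpM2l ?(ltW r0)// lef_pV2 ?posrE// (lt_le_trans lnr1).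
Qed.

(* The weights increase outwards, at the cost of a power of [x] only, since
   [2 ^ ((q - p) M)] is comparable with [1 / x]. *)
Lemma annulus_weights_heavy (s eta : R) : 0 < s -> 0 < eta -> s * (q - p) < q + eta ->
  annulus_weights d p q m (fun r => r `^ s) (fun x => x `^ ((q + eta) / (q - p))).
Proof.
(* With [e = f / s] the exponent of 2 becomes [eta n - f (M - 1)]: growth at rate [eta], minus a
   loss that depends on [M] only. *)
move=> s0 eta0 sq; pose f := q + eta - s * (q - p); pose e := f / s.
have f0 : 0 < f by rewrite subr_gt0.
have KK := mass_const_gt0 q m; have sc0 := scale_const_gt0 d p d0.
have rho0 : 0 < q - p by rewrite subr_gt0.
have e0 : 0 < e by rewrite divr_gt0.
have z0 : 0 < 1 - 2 `^ (- e) :> R by rewrite subr_gt0; exact: powR2N_lt1.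
set z := 1 - 2 `^ (- e) in z0; pose a := z / (sc * K).
have a0 : 0 < a by rewrite divr_gt0// mulr_gt0.
have scK : 0 < sc * K by exact: mulr_gt0.
exists (K * a `^ s * (sc * K)^-1 `^ (f / (q - p))), eta; split=> //.
  by rewrite !mulr_gt0 ?powR_gt0 ?invr_gt0.
move=> x M x0 M0 Mx; exists (fun n => z * 2 `^ (- (e * (M.-1%:R - n%:R)))); split.
- by move=> n _; rewrite mulr_gt0 ?powR_gt0.
- exact: sum_powR2_rev_le.
move=> n nM.
have -> : x / sc * (z * 2 `^ (- (e * (M.-1%:R - n%:R)))) * 2 `^ ((q - p) * n%:R) / K =
    a * x * 2 `^ ((q - p) * n%:R - e * (M.-1%:R - n%:R)).
  by rewrite powR2D /a; field; rewrite !lt0r_neq0.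
rewrite annulus_power ?(ltW a0) ?(ltW x0)//.
have -> : s * ((q - p) * n%:R - e * (M.-1%:R - n%:R)) - q * n%:R =
    eta * n%:R + (- ((q - p) * M.-1%:R)) * (f / (q - p)).
  by rewrite /e /f; field; rewrite !lt0r_neq0.
rewrite powR2D (powRrM 2 (- _)).
(* Minimality of the crossover bounds the loss by a power of [x]. The total power [s + f / (q - p)]
   no longer depends on [s]. *)
have Mlt : x / (sc * K) <= 2 `^ (- ((q - p) * M.-1%:R)).
  have [_ /(_ M.-1)] := Mx; rewrite ltn_predL M0 => /(_ isT)/ltW h.
  rewrite powRN -[leRHS]mul1r ler_pdivlMr ?powR2_gt0//.
  by rewrite invfM mulrA mulrAC ler_pdivrMr// mul1r mulrC.
have h : (x / (sc * K)) `^ (f / (q - p)) <=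
    (2 `^ (- ((q - p) * M.-1%:R))) `^ (f / (q - p)).
  by apply: ge0_ler_powR; rewrite ?nnegrE ?powR_ge0 ?divr_ge0 ?(ltW f0) ?(ltW x0) ?(ltW rho0) ?(ltW scK).
have -> : (q + eta) / (q - p) = s + f / (q - p) by rewrite /f; field; exact: lt0r_neq0.
rewrite [x `^ (s + _)]powRD ?(gt_eqF x0) ?implybT//.
move: h; rewrite (powRM _ (ltW x0)) ?invr_ge0 ?(ltW scK)// => h.
have D0 : 0 <= K * a `^ s * x `^ s * 2 `^ (eta * n%:R).
  by rewrite !mulr_ge0 ?powR_ge0 ?(ltW KK).
move: (ler_wpM2l D0 h); congr (_ <= _); ring.
Qed.

End AnnulusWeights.

Lemma expR_le_powR (R : realType) (t y : R) : 0 < t -> 0 < y -> expR (- y) <= (t / y) `^ t.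
Proof.
move=> t0 y0; have yt : 0 < y / t by rewrite divr_gt0.
have -> : t / y = (y / t)^-1 by rewrite invfM invrK mulrC.
rewrite -powR_inv1 ?(ltW yt)// -powRrM mulN1r powRN expRN lef_pV2 ?posrE ?expR_gt0 ?powR_gt0//.
have -> : expR y = expR (y / t) `^ t by rewrite -expRM divfK// gt_eqF.
apply: ge0_ler_powR; rewrite ?nnegrE ?expR_ge0 ?(ltW t0) ?(ltW yt)//.
by apply: le_trans (expR_ge1Dx _); rewrite lerDr.
Qed.

(** A probability is at most 1, so [F] and [F'] have to be compared only where the new bound is
    below 1. *)
Lemma deviation_bound_mono (R : realType) (d : nat) (p q m : R) (F F' : R -> nat -> R -> R) :
  0 < p ->
  (forall c C : R, 0 < c -> 0 < C -> exists c' C' : R, [/\ 0 < c', 0 < C' &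
    forall (N : nat) (x : R), (0 < N)%N -> 0 < x ->
      Num.min 1 (C * F c N x) <= C' * F' c' N x]) ->
  deviation_bound d p q m F -> deviation_bound d p q m F'.
Proof.
move=> p0 FF' [c [C [c0 C0 H]]]; have [c' [C' [c'0 C'0 H']]] := FF' c C c0 C0.
exists c', C'; split=> // mu mom dO Omega P X iid N x N0 x0.
apply: (@le_trans _ _ (Num.min 1 (C * F c N x))%:E); last by rewrite lee_fin H'.
rewrite EFin_min le_min H// andbT.
apply: probability_le1; apply: measurable_transport_cost => //; exact: ltW.
Qed.

(** * The five regimes *)

Section Regimes.
Context {R : realType} (d : nat).
Variables (p q m : R).
Hypothesis d0 : (0 < d)%N.
Hypothesis p0 : 0 < p.
Hypothesis pq : p < q.

Definition tail_term (N : nat) (x : R) : R := N%:R * (N%:R * x) `^ (- (q / p)).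

Lemma tail_term_ge0 (N : nat) (x : R) : 0 <= tail_term N x.
Proof. by rewrite mulr_ge0 ?powR_ge0. Qed.

(** For bounded [x] the tail term is at least a multiple of [N^(1 - q/p)], and an exponential in [N]
    decays faster than any power. *)
Lemma expR_le_tail_term (b B : R) : 0 < b -> 0 < B -> exists2 C : R, 0 < C &
  forall (N : nat) (x : R), (0 < N)%N -> 0 < x -> x <= B ->
    expR (- (b * N%:R)) <= C * tail_term N x.
Proof.
move=> b0 B0; have t0 : 0 < q / p - 1 by rewrite subr_gt0 ltr_pdivlMr// mul1r.
have q0 : 0 < q by exact: lt_trans pq.
have qp : 0 < q / p by rewrite divr_gt0.
set t := q / p - 1 in t0.
exists ((t / b) `^ t * B `^ (q / p)); first by rewrite mulr_gt0 ?powR_gt0 ?divr_gt0.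
move=> N x N0 x0 xB; have NR : 0 < N%:R :> R by rewrite ltr0n.
apply: le_trans (expR_le_powR _ _ _ t0 _) _; first by rewrite mulr_gt0.
rewrite invfM mulrA (powRM _ (ltW (divr_gt0 t0 b0))) ?invr_ge0 ?(ltW NR)//.
rewrite -mulrA ler_wpM2l ?powR_ge0//.
have -> : tail_term N x = N%:R^-1 `^ t * x `^ (- (q / p)).
  rewrite /tail_term (powRM _ (ltW NR) (ltW x0)) mulrA; congr (_ * _).
  rewrite -[N%:R^-1](powR_inv1 (ltW NR)) -powRrM -{1}[N%:R](powRr1 (ltW NR)) -powRD.
    by congr (_ `^ _); rewrite /t; ring.
  by rewrite (gt_eqF NR) implybT.
rewrite mulrCA -[leLHS]mulr1 ler_wpM2l ?powR_ge0// powRN ler_pdivlMr ?powR_gt0// mul1r.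
by apply: ge0_ler_powR; rewrite ?nnegrE ?(ltW qp) ?(ltW x0) ?(ltW B0).
Qed.

(** Between 1 and [B] the rate is at least [a], so the exponential is absorbed by the tail term. *)
Lemma deviation_unit_indicator (psi : R -> R) (B a : R) : 0 < B -> 0 < a ->
  (forall x, 1 <= x -> a <= psi x) ->
  deviation_bound d p q m (fun c N x =>
    expR (- (c * (N%:R * psi x))) * (x < B)%R%:R + tail_term N x) ->
  deviation_bound d p q m (fun c N x =>
    expR (- (c * (N%:R * psi x))) * (x <= 1)%R%:R + tail_term N x).
Proof.
move=> B0 a0 psi1; apply: deviation_bound_mono => // c C c0 C0.
have ca0 : 0 < c * a by rewrite mulr_gt0.
have [C1 C10 H] := expR_le_tail_term (c * a) B ca0 B0.
exists c, (C * (1 + C1)); split=> //; first by rewrite mulr_gt0// addr_gt0.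
move=> N x N0 x0; rewrite ge_min; apply/orP; right.
rewrite -mulrA ler_wpM2l ?(ltW C0)//.
have T0 := tail_term_ge0 N x; have e0 := expR_ge0 (- (c * (N%:R * psi x))).
have C1T : 0 <= C1 * tail_term N x by rewrite mulr_ge0// ltW.
have [x1|x1] := leP x 1.
  rewrite mulr1 mulrDl mul1r -addrA.
  apply: (@le_trans _ _ (expR (- (c * (N%:R * psi x))) + tail_term N x)).
    by rewrite lerD2r; case: (x < B); rewrite ?mulr1// mulr0.
  by rewrite lerD2l lerDl mulr_ge0 ?addr_ge0// ltW.
rewrite mulr0 add0r mulrDl mul1r addrC lerD2l.
have [xB|xB] := ltP x B; last by rewrite mulr0.
rewrite mulr1; apply: le_trans (H N x N0 x0 (ltW xB)).
rewrite ler_expR lerN2 -mulrA ler_wpM2l ?(ltW c0)// mulrC ler_wpM2l//.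
exact/psi1/ltW.
Qed.

Lemma deviation_of_rates (phi psi : R -> R) (a : R) : 0 < a ->
  (forall x, 1 <= x -> a <= psi x) ->
  level_weights d p phi -> annulus_weights d p q m phi psi ->
  deviation_bound d p q m (fun c N x =>
    expR (- (c * (N%:R * psi x))) * (x <= 1)%R%:R + tail_term N x).
Proof.
move=> a0 psi1 lw aw.
apply: (deviation_unit_indicator psi (mass_const q m * scale_const d p) a _ a0 psi1).
  by rewrite mulr_gt0 ?mass_const_gt0 ?scale_const_gt0.
exact: deviation_of_weights d p q m d0 p0 pq phi psi lw aw.
Qed.

Lemma powR_ge1 (s x : R) : 0 <= s -> 1 <= x -> 1 <= x `^ s.
Proof. by move=> s0 x1; rewrite -[leLHS](powRr0 x) ler_powR. Qed.

Lemma deviation_supercritical : d%:R < 2 * p -> 2 * p < q ->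
  deviation_bound d p q m (fun c N x =>
    expR (- (c * (N%:R * x `^ 2))) * (x <= 1)%R%:R + tail_term N x).
Proof.
move=> dp pq2; apply: (deviation_of_rates (fun r => r `^ 2) (fun x => x `^ 2) 1) => //.
- by move=> x x1; exact: powR_ge1.
- exact: level_weights_supercritical.
- by apply: annulus_weights_light => //; lra.
Qed.

Lemma deviation_critical : d%:R = 2 * p -> 2 * p < q ->
  deviation_bound d p q m (fun c N x =>
    expR (- (c * (N%:R * (x / ln (2 + x^-1)) ^+ 2))) * (x <= 1)%R%:R + tail_term N x).
Proof.
move=> dp pq2; apply: (deviation_of_rates (fun r => (r / (1 - ln r)) ^+ 2)
  (fun x => (x / ln (2 + x^-1)) ^+ 2) (2^-1 ^+ 2)) => //.
- move=> x x1; have x0 : 0 < x by exact: lt_le_trans x1.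
  have xV : x^-1 <= 1 by rewrite invf_le1.
  have xV0 : 0 < x^-1 by rewrite invr_gt0.
  have L0 : 0 < ln (2 + x^-1) by rewrite ln_gt0//; lra.
  have L2 : ln (2 + x^-1) <= 2.
    by have := @le_ln1Dx R (1 + x^-1) ltac:(lra); rewrite addrA; lra.
  rewrite lerXn2r ?nnegrE ?invr_ge0// ?divr_ge0 ?(ltW x0) ?(ltW L0)//.
  rewrite ler_pdivlMr//; lra.
- exact: level_weights_critical.
- by apply: annulus_weights_light_log => //; lra.
Qed.

Lemma deviation_subcritical : 2 * p < d%:R -> q * p < d%:R * (q - p) ->
  deviation_bound d p q m (fun c N x =>
    expR (- (c * (N%:R * x `^ (d%:R / p)))) * (x <= 1)%R%:R + tail_term N x).
Proof.
move=> dp dq; have s2 : 2 < d%:R / p by rewrite ltr_pdivlMr.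
have s0 : 0 < d%:R / p by exact: lt_trans s2.
apply: (deviation_of_rates (fun r => r `^ (d%:R / p)) (fun x => x `^ (d%:R / p)) 1) => //.
- by move=> x x1; apply: powR_ge1 => //; exact: ltW.
- by apply: level_weights_subcritical => //; rewrite divfK// gt_eqF.
- by apply: annulus_weights_light => //; rewrite mulrAC ltr_pdivlMr.
Qed.

Lemma deviation_heavy (eps : R) : q <= 2 * p -> d%:R * (q - p) <= q * p -> 0 < eps ->
  deviation_bound d p q m (fun c N x =>
    expR (- (c * N%:R `^ (2 * (1 - p / q - eps)) * x ^+ 2)) * (x <= 1)%R%:R
    + tail_term N x).
Proof.
move=> q2p dq eps0.
have q0 : 0 < q by exact: lt_trans pq.
have rho0 : 0 < q - p by rewrite subr_gt0.
pose eta := 2 * eps * q; have eta0 : 0 < eta by rewrite !mulr_gt0.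
(* Being above [d / p] makes the levels supercritical. By the two hypotheses the maximum times
   [q - p] is at most [q], and the excess over it uses only half of the slack [eta]. *)
pose s := Num.max 2 (d%:R / p) + eta / (2 * (q - p)).
have s'0 : 0 < eta / (2 * (q - p)) by rewrite divr_gt0 ?mulr_gt0.
have s2 : 2 <= s by rewrite -[leLHS]addr0 lerD ?le_max ?lexx// ltW.
have sd : d%:R < s * p.
  by rewrite -ltr_pdivrMr// -[ltLHS]addr0 ler_ltD// le_max lexx orbT.
have sq : s * (q - p) < q + eta.
  rewrite mulrDl ler_ltD//.
    rewrite maxr_pMl ?(ltW rho0)// ge_max; apply/andP; split; first lra.
    by rewrite mulrAC ler_pdivrMr.
  rewrite (_ : eta / (2 * (q - p)) * (q - p) = eta / 2); first lra.
  by field; exact: lt0r_neq0.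
pose b := (q + eta) / (q - p).
have b0 : 0 < b by rewrite divr_gt0// addr_gt0.
have := deviation_of_rates (fun r => r `^ s) (fun x => x `^ b) 1 ltr01
  (fun x x1 => powR_ge1 b x (ltW b0) x1) (level_weights_supercritical d p p0 s s2 sd)
  (annulus_weights_heavy d p q m d0 pq s eta (lt_le_trans _ s2) eta0 sq).
move=> /(_ ltac:(by [])); apply: (deviation_bound_mono R d p q m _ _ p0) => c C c0 C0.
exists c, (1 + C); split=> //; first by rewrite addr_gt0.
move=> N x N0 x0; have NR : 0 < N%:R :> R by rewrite ltr0n.
have T0 := tail_term_ge0 N x.
set G := expR (- (c * _ * _)).
have G0 : 0 <= G * (x <= 1)%R%:R by rewrite mulr_ge0 ?expR_ge0.
have [T1|T1] := leP 1 (tail_term N x).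
  rewrite ge_min; apply/orP; left.
  apply: (le_trans T1); rewrite mulrDl mul1r.
  by rewrite addrAC lerDr addr_ge0// mulr_ge0 ?addr_ge0// ltW.
rewrite ge_min; apply/orP; right.
suff H : expR (- (c * (N%:R * x `^ b))) <= G.
  apply: (@le_trans _ _ (C * (G * (x <= 1)%R%:R + tail_term N x))).
    by rewrite ler_wpM2l ?(ltW C0)// lerD2r ler_wpM2r.
  by rewrite ler_wpM2r ?addr_ge0// lerDr.
rewrite ler_expR lerN2 -mulrA ler_wpM2l ?(ltW c0)//.
(* [tail_term N x < 1] forces [x] to be at least [N ^ (p / q - 1)]. *)
have xN : N%:R `^ (- ((q - p) / q)) <= x.
  have NNx : N%:R <= (N%:R * x) `^ (q / p).
    move: T1; rewrite /tail_term powRN ltr_pdivrMr ?powR_gt0 ?mulr_gt0// mul1r.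
    exact: ltW.
  have : N%:R `^ (p / q) <= N%:R * x.
    rewrite -[leRHS]powRr1 ?mulr_ge0 ?(ltW x0)//.
    rewrite [X in _ <= _ `^ X](_ : 1 = (q / p) * (p / q)); last by field; rewrite !lt0r_neq0.
    rewrite (powRrM (N%:R * x)); apply: ge0_ler_powR; rewrite ?nnegrE ?powR_ge0//.
    by rewrite divr_ge0// ltW.
  have -> : - ((q - p) / q) = p / q - 1 by field; exact: lt0r_neq0.
  by rewrite powRD ?(gt_eqF NR) ?implybT// powR_inv1 ?(ltW NR)// ler_pdivrMr// [leRHS]mulrC.
(* Nonnegative because [q <= 2p]. Replacing [x^f] by its lower bound leaves [N] to the power
   [1 - f (q - p)/q = 2 (1 - p/q) - eta/q]. *)
pose f := b - 2.
have f0 : 0 <= f by rewrite subr_ge0 ler_pdivlMr// /eta; nra.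
have -> : x `^ b = x `^ f * x ^+ 2.
  rewrite -powR_mulrn ?(ltW x0)// -powRD ?(gt_eqF x0) ?implybT//.
  by rewrite subrK.
rewrite mulrA ler_wpM2r ?sqr_ge0//.
have h : (N%:R `^ (- ((q - p) / q))) `^ f <= x `^ f.
  by apply: ge0_ler_powR; rewrite ?nnegrE ?powR_ge0 ?(ltW x0).
apply: le_trans (ler_wpM2l (ltW NR) h).
rewrite -powRrM -{2}[N%:R](powRr1 (ltW NR)) -powRD ?(gt_eqF NR) ?implybT//.
rewrite le_eqVlt; apply/orP; left; apply/eqP; congr (_ `^ _).
by rewrite /f /b /eta; field; rewrite !lt0r_neq0.
Qed.

End Regimes.

Theorem mainTheorem2 (R : realType) (d : nat) (p q m : R)
    (hd : (0 < d)%N) (hp : 0 < p) (hpq : p < q) :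
  [/\ (* (a) *)
      2 * p < q ->
        deviation_bound d p q m (fun c N x =>
          expR (- (c * N%:R * rate_fun d p x)) * (x <= 1)%R%:R
          + N%:R * (N%:R * x) `^ (- (q / p))),
      (* (b) *)
      d%:R / 2 < p -> q <= 2 * p ->
        forall eps : R, 0 < eps -> eps < 1 - p / q ->
        deviation_bound d p q m (fun c N x =>
          expR (- (c * N%:R `^ (2 * (1 - p / q - eps)) * x ^+ 2)) * (x <= 1)%R%:R
          + N%:R * (N%:R * x) `^ (- (q / p))),
      (* (c) *)
      p = d%:R / 2 -> q <= 2 * p ->
        forall eps : R, 0 < eps -> eps < 1 - p / q ->
        deviation_bound d p q m (fun c N x =>
          expR (- (c * N%:R * x `^ (1 / (1 - p / q - eps))
                   / (ln (2 + 1 / x)) ^+ 2)) * (x <= 1)%R%:R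
          + expR (- (c * N%:R `^ (2 * (1 - p / q - eps)) * x ^+ 2))
            * (x <= 1)%R%:R
          + N%:R * (N%:R * x) `^ (- (q / p))),
      (* (d) *)
      p < d%:R / 2 -> d%:R * p / (d%:R - p) < q -> q <= 2 * p ->
        forall eps : R, 0 < eps -> eps < 1 - p / q ->
        deviation_bound d p q m (fun c N x =>
          expR (- (c * N%:R * x `^ (d%:R / p))) * (x <= 1)%R%:R
          + expR (- (c * N%:R `^ (2 * (1 - p / q - eps)) * x ^+ 2))
            * (x <= 1)%R%:R
          + N%:R * (N%:R * x) `^ (- (q / p))) &
      (* (e) *)
      p < d%:R / 2 -> q <= d%:R * p / (d%:R - p) ->
        forall eps : R, 0 < eps -> eps < 1 - p / q ->
        deviation_bound d p q m (fun c N x =>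
          expR (- (c * N%:R `^ (2 * (1 - p / q - eps)) * x ^+ 2)) * (x <= 1)%R%:R
          + N%:R * (N%:R * x) `^ (- (q / p)))].
Proof.
have q0 : 0 < q by exact: lt_trans hpq.
have mono F F' : (forall c N x, (0 < N)%N -> 0 < x -> F c N x <= F' c N x) ->
    deviation_bound d p q m F -> deviation_bound d p q m F'.
  move=> FF'; apply: deviation_bound_mono => // c C c0 C0; exists c, C; split=> //.
  by move=> N x N0 x0; rewrite ge_min ler_wpM2l ?orbT ?FF'// ltW.
have ind0 (c : R) (x : R) : 0 <= expR c * (x <= 1)%R%:R by rewrite mulr_ge0 ?expR_ge0.
split.
- move=> q2; have [dp|dp|dp] := ltgtP (d%:R / 2) p.
  + apply: mono (deviation_supercritical d p q m hd hp hpq _ q2); last by lra.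
    move=> c N x N0 x0; rewrite /rate_fun dp (powR_mulrn 2) ?(ltW x0)//.
    by rewrite mulrA lexx.
  + apply: mono (deviation_subcritical d p q m hd hp hpq _ _); [|lra|nra].
    move=> c N x N0 x0; rewrite /rate_fun ltNge (ltW dp) /= (lt_eqF dp).
    by rewrite mulrA lexx.
  + apply: mono (deviation_critical d p q m hd hp hpq _ q2); last by lra.
    by move=> c N x N0 x0; rewrite /rate_fun dp ltxx eqxx mulrA lexx.
- move=> dp q2 eps eps0 _; apply: (deviation_heavy d p q m hd hp hpq) => //; nra.
(* For [d = 2p] the condition [d (q - p) <= q p] of [deviation_heavy] reads [q <= 2p]. *)
- move=> dp q2 eps eps0 _.
  apply: mono (deviation_heavy d p q m hd hp hpq eps q2 _ eps0); last by rewrite dp; nra.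
  by move=> c N x N0 x0; apply: lerD; rewrite // lerDr ind0.
- move=> dp qd q2 eps eps0 _.
  have {}qd : q * p < d%:R * (q - p).
    have dp0 : 0 < d%:R - p by lra.
    by move: qd; rewrite ltr_pdivrMr//; lra.
  apply: mono (deviation_subcritical d p q m hd hp hpq _ qd); last by lra.
  by move=> c N x N0 x0; apply: lerD; rewrite // mulrA lerDl ind0.
move=> dp qd eps eps0 _.
have dp0 : 0 < d%:R - p by lra.
have {}qd : d%:R * (q - p) <= q * p.
  by move: qd; rewrite ler_pdivlMr//; lra.
(* The goal left over is [q <= 2p]: for [p < d/2] the threshold [dp/(d - p)] is below [2p]. *)
apply: (deviation_heavy d p q m hd hp hpq) => //.
nra.
Qed.
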